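(* Let $B\subset\mathbb R^2$ be a closed ball of positive finite radius and $\tilde B\supset B$ open and connected. Let $a_j,\varphi_j:\tilde B\to\mathbb R$ ($j=1,2,3$) be real analytic, with no $a_j$ vanishing identically. Assume that none of the mappings $\varphi_j$ is constant on $B$, and that there exists no pair of distinct indices $i\ne j\in\{1,2,3\}$ for which $\nabla\varphi_i$ and $\nabla\varphi_j$ are everywhere linearly dependent. Then the following are equivalent. (1) $(\mathbf a,\mathbf\Phi)$ satisfies the main hypothesis. (2) For each point $\bar x\in B$ at which $(\mathbf a,\mathbf\Phi)$ is nondegenerate, there exists a positive integer $M$ such that for any $\mathbf f=(f_1,f_2,f_3)$ with each $f_j$ of class $C^M$ in a neighborhood of $\varphi_j(\bar x)$, if $G_{\mathbf f}$ vanishes to order $M$ at $\bar x$ then every $f_j$ vanishes to order $M$ at $\varphi_j(\bar x)$. (3) There exist $M\in\mathbb N$, $C<\infty$, $\tau>0$ and a real analytic variety $\Sigma\subset\tilde B$ of positive codimension such that for every $\bar x\in B$ and every $\mathbf f=(f_1,f_2,f_3)$ with each $f_j$ of class $C^M$ in a neighborhood of $\varphi_j(\bar x)$, $$\mathrm{distance}(\bar x,\Sigma)^{\tau}\sum_{j=1}^3\sum_{0\le k\le M}\Big|\Big(\frac{d^k}{dy^k}f_j\Big)(\varphi_j(\bar x))\Big|\le C\sum_{0\le|\alpha|\le M}\Big|\frac{\partial^\alpha}{\partial x^\alpha}G_{\mathbf f}(\bar x)\Big|.$$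
   Context: $\mathbf a=(a_1,a_2,a_3)$, $\mathbf\Phi=(\varphi_1,\varphi_2,\varphi_3)$, $C^\omega$ means real analytic, and $$G_{\mathbf f}(x)=\sum_{j=1}^3a_j(x)f_j(\varphi_j(x)).$$ A function vanishes to order $N$ at a point if it and all of its partial derivatives of orders less than or equal to $N$ vanish at that point. Main hypothesis: for any nonempty open set $U\subset\tilde B$ and any $\mathbf f$ with $f_j\in C^\omega(\varphi_j(U))$ satisfying $\sum_{j=1}^3a_j(x)f_j(\varphi_j(x))=0$ for all $x\in U$, each $f_j$ vanishes identically on $\varphi_j(U)$. $(\mathbf a,\mathbf\Phi)$ is nondegenerate at $\bar x$ if $a_j(\bar x)\ne0$ for all $j$ and $\nabla\varphi_i(\bar x),\nabla\varphi_j(\bar x)$ are linearly independent for all $i\ne j$. *)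

(* Defs.v *)
From mathcomp Require Import all_boot all_order all_algebra.
From mathcomp Require Import all_classical all_reals all_analysis.

Set Implicit Arguments.
Unset Strict Implicit.
Unset Printing Implicit Defensive.

Import Order.TTheory GRing.Theory Num.Theory.
Import numFieldNormedType.Exports.

Local Open Scope classical_set_scope.
Local Open Scope ring_scope.

(* Points of the plane are row vectors 'rV[R]_2.  Functions are total; all the
   notions below are local, so values away from the relevant sets are
   irrelevant. *)

(* The library norm on 'rV[R]_2 is the sup norm, hence this one. *)
Definition enorm (R : realType) (v : 'rV[R]_2) : R :=
  Num.sqrt (\sum_i v 0 i ^+ 2).

Definition eball (R : realType) (c : 'rV[R]_2) (r : R) : set 'rV[R]_2 :=
  [set x | enorm (x - c) <= r].

(* Meaningful for nonempty S only: inf set0 = 0. *)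
Definition distance (R : realType) (x : 'rV[R]_2) (S : set 'rV[R]_2) : R :=
  inf [set enorm (x - y) | y in S].

Definition analytic1_at (R : realType) (f : R -> R) (y : R) : Prop :=
  exists c : nat -> R,
    \forall h \near (0 : R), pseries c h @ \oo --> f (y + h).

Definition homogeneous_part (R : realType) (c : nat -> nat -> R) (h : 'rV[R]_2)
    (n : nat) : R :=
  \sum_(i < n.+1) c i (n - i)%N * h 0 0 ^+ i * h 0 1 ^+ (n - i).

Definition abs_homogeneous_part (R : realType) (c : nat -> nat -> R)
    (h : 'rV[R]_2) (n : nat) : R :=
  \sum_(i < n.+1) `|c i (n - i)%N * h 0 0 ^+ i * h 0 1 ^+ (n - i)|.

(* Absolutely convergent double power series
   f (x + h) = \sum_(i, j) c i j * h_0 ^ i * h_1 ^ j, summed by total degree. *)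
Definition analytic2_at (R : realType) (f : 'rV[R]_2 -> R) (x : 'rV[R]_2) :
    Prop :=
  exists c : nat -> nat -> R, \forall h \near (0 : 'rV[R]_2),
    cvgn (series (abs_homogeneous_part c h)) /\
    series (homogeneous_part c h) @ \oo --> f (x + h).

(* For a set D that is not open (such as an image of an open set), this is
   analyticity of some extension of f|_D to a neighborhood of D. *)
Definition analytic1_on (R : realType) (D : set R) (f : R -> R) : Prop :=
  forall y, D y -> analytic1_at f y.

Definition analytic2_on (R : realType) (D : set 'rV[R]_2)
    (f : 'rV[R]_2 -> R) : Prop :=
  forall x, D x -> analytic2_at f x.

(* The mixed partial derivative of orders i and j in the coordinates 0 and 1. *)
Definition pderiv (R : realType) (i j : nat) (f : 'rV[R]_2 -> R) :
    'rV[R]_2 -> R :=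
  iter i (fun g x => derive g x (delta_mx 0 0))
    (iter j (fun g x => derive g x (delta_mx 0 1)) f).

Definition gradient (R : realType) (f : 'rV[R]_2 -> R) (x : 'rV[R]_2) :
    'rV[R]_2 :=
  \row_i derive f x (delta_mx 0 i).

Definition class_C_near (R : realType) (M : nat) (f : R -> R) (y : R) : Prop :=
  \forall z \near y,
    (forall k, (k < M)%N -> derivable (derive1n k f) z 1) /\
    (forall k, (k <= M)%N -> {for z, continuous (derive1n k f)}).

Definition vanishes1 (R : realType) (N : nat) (f : R -> R) (y : R) : Prop :=
  forall k, (k <= N)%N -> derive1n k f y = 0.

Definition vanishes2 (R : realType) (N : nat) (f : 'rV[R]_2 -> R)
    (x : 'rV[R]_2) : Prop :=
  forall i j, (i + j <= N)%N -> pderiv i j f x = 0.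

Definition Gsum (R : realType) (a phi : 'I_3 -> 'rV[R]_2 -> R)
    (f : 'I_3 -> R -> R) (x : 'rV[R]_2) : R :=
  \sum_j a j x * f j (phi j x).

Definition main_hypothesis (R : realType) (Bt : set 'rV[R]_2)
    (a phi : 'I_3 -> 'rV[R]_2 -> R) : Prop :=
  forall (U : set 'rV[R]_2) (f : 'I_3 -> R -> R),
    open U -> U !=set0 -> U `<=` Bt ->
    (forall j, analytic1_on (phi j @` U) (f j)) ->
    (forall x, U x -> Gsum a phi f x = 0) ->
    forall j y, (phi j @` U) y -> f j y = 0.

Definition nondegenerate_at (R : realType) (a phi : 'I_3 -> 'rV[R]_2 -> R)
    (x : 'rV[R]_2) : Prop :=
  (forall j, a j x != 0) /\
  (forall i j, i != j -> free [:: gradient (phi i) x; gradient (phi j) x]).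

(* S is, near each point of Bt, the set of common zeros of finitely many real
   analytic functions; in particular it is relatively closed in Bt. *)
Definition analytic_variety (R : realType) (Bt S : set 'rV[R]_2) : Prop :=
  S `<=` Bt /\
  forall x, Bt x -> exists (W : set 'rV[R]_2) (n : nat)
      (g : 'I_n -> 'rV[R]_2 -> R),
    [/\ open W, W x, forall i, analytic2_on W (g i) &
        S `&` W = [set z | W z /\ forall i, g i z = 0]].

(* The dimension of a variety is the largest dimension of a submanifold it
   contains; in the plane, dimension < 2 means containing no nonempty open
   set. *)
Definition positive_codimension (R : realType) (S : set 'rV[R]_2) : Prop :=
  interior S = set0.

(* Main.v *)
(** The partial derivatives of G_f of order at most M at x are linear combinations
    of the derivatives f_l^(k)(phi_l(x)), k <= M, with coefficients that are analytic
    in x.  Each of the three conditions amounts to the injectivity of this linear map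
    J_M(x) for some M at some point.
    If J_M(x0) is injective, Cramer's rule for the Gram matrix of J_M writes
    g(x) f_l^(k)(phi_l(x)) as a combination of derivatives of G_f, with analytic
    coefficients and g(x0) <> 0.  The main hypothesis then follows from the identity
    theorem, and the estimate from a Lojasiewicz inequality for g.
    Suppose conversely that J_M(x) is never injective at a nondegenerate x.
    Contracting the Hessian of G_f with the directions orthogonal to two of the
    gradients expresses f_l'' through the f_j and f_j', so an element of ker J_M(x)
    is determined by its first order jet, and formal solutions satisfy a first order
    linear system with analytic coefficients, hence converge.  The first order jets
    form a decreasing sequence of nonzero subspaces of a space of dimension 6,
    therefore a nonzero analytic solution exists.
    Analyticity is used in the form of bounds C q^m m! for the derivatives of order
    m. *)
Require Import Defs.
From mathcomp Require Import all_boot all_order all_algebra.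
From mathcomp Require Import all_classical all_reals all_analysis.
From mathcomp Require Import zify ring lra.
Set Implicit Arguments.
Unset Strict Implicit.
Unset Printing Implicit Defensive.
Import Order.TTheory GRing.Theory Num.Theory.
Import numFieldNormedType.Exports.
Local Open Scope classical_set_scope.
Local Open Scope ring_scope.

(** * Derivative bounds *)

(** An element of ker J_M(x) is only a finite jet, whereas the elimination needs functions to
    differentiate. Each jet is therefore realised by polynomials, which solve the first order system
    up to a remainder that is flat at x. This is why [dbound] separates the open set [U], where
    derivatives exist, from the set [S], where they are measured: for [S] reduced to x the flat
    remainder is invisible. The resulting bounds C A^k k! on the k-th derivatives have A independent
    of the order of the jet. This uniformity serves twice: it makes the limiting jet converge, and
    with C = 0 it shows that a jet is determined by its first order part, so that truncations of
    different orders fit together. Derivative bounds pass through products, composites and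
    reciprocals by binomial sums, without any rearrangement of double series. The variety of the
    estimate may be chosen, so it is taken large: besides zeros of derivatives of g it contains the
    part in [Bt] of a line through the centre of the ball, which keeps it nonempty and its distance
    to points of the ball at most the radius. *)

Definition bvec (R : realType) (i : 'I_2) : 'rV[R]_2 := delta_mx 0 i.
Arguments bvec {R} i.

Definition pd (R : realType) (i : 'I_2) (f : 'rV[R]_2 -> R) : 'rV[R]_2 -> R :=
  fun x => derive f x (bvec i).

(* Iterated partial derivatives of f, in any order of the directions, exist on the
   open set U up to order n, and those of order k are at most s k on S.  For S a
   single point only the jet of f there is constrained. *)
Fixpoint dbound (R : realType) (n : nat) (U S : set 'rV[R]_2)
    (f : 'rV[R]_2 -> R) (s : nat -> R) : Prop :=
  [/\ forall z, U z -> {for z, continuous f},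
      forall z, S z -> `|f z| <= s 0%N &
      match n with
      | 0%N => True
      | m.+1 => forall i, (forall z, U z -> derivable f z (bvec i)) /\
                  dbound m U S (pd i f) (fun k => s k.+1)
      end].

Definition binom_conv (R : realType) (s t : nat -> R) (n : nat) : R :=
  \sum_(m < n.+1) s m * t (n - m)%N *+ 'C(n, m).

(** The index [k] counts derivatives already taken: a function bounded by [gevrey C q k] behaves
    like a k-th derivative, and differentiating it moves [k] to [k.+1] with the same [q]. *)
Definition gevrey (R : realType) (C q : R) (k m : nat) : R :=
  C * q ^+ m * ((m + k)`!)%:R.

Section DBound.
Variable R : realType.
Implicit Types (f g : 'rV[R]_2 -> R) (U S : set 'rV[R]_2) (s t : nat -> R)
  (C q B A : R).

Lemma dbound0 n U S f s : dbound n U S f s -> forall z, S z -> `|f z| <= s 0%N.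
Proof. by case: n => [|n] []. Qed.

Lemma dbound_cont n U S f s : dbound n U S f s ->
  forall z, U z -> {for z, continuous f}.
Proof. by case: n => [|n] []. Qed.

Lemma dbound_derivable n U S f s i : dbound n.+1 U S f s ->
  forall z, U z -> derivable f z (bvec i).
Proof. by move=> [_ _ /(_ i) []]. Qed.

Arguments dbound_derivable {n U S f s} i _ {z} _.

Lemma dbound_pd n U S f s i : dbound n.+1 U S f s ->
  dbound n U S (pd i f) (fun k => s k.+1).
Proof. by move=> [_ _ /(_ i) []]. Qed.

Lemma dbound_le n U S f s t : dbound n U S f s ->
  (forall k, (k <= n)%N -> s k <= t k) -> dbound n U S f t.
Proof.
elim: n f s t => [|n IH] f s t [cf bf df] st; split=> //.
- by move=> z /bf /le_trans; apply; apply: st.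
- by move=> z /bf /le_trans; apply; apply: st.
- move=> i; split; first by case: (df i).
  by apply: IH (df i).2 _ => k kn; apply: st.
Qed.

Lemma dbound_order n m U S f s : (m <= n)%N -> dbound n U S f s -> dbound m U S f s.
Proof.
elim: n m f s => [|n IH] [|m] f s //= mn [cf bf df]; split=> // i.
by split; [case: (df i)|apply: IH mn (df i).2].
Qed.

Lemma dbound_sub n U S U' S' f s : U' `<=` U -> S' `<=` S ->
  dbound n U S f s -> dbound n U' S' f s.
Proof.
move=> UU SS; elim: n f s => [|n IH] f s [cf bf df]; split=> //.
- by move=> z /UU /cf.
- by move=> z /SS /bf.
- by move=> z /UU /cf.
- by move=> z /SS /bf.
- move=> i; split; first by move=> z /UU; apply: (df i).1.
  exact: IH (df i).2.
Qed.

Lemma near_open U z (P : 'rV[R]_2 -> Prop) : open U -> U z ->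
  (forall y, U y -> P y) -> \forall y \near z, P y.
Proof.
move=> oU Uz UP; have Uz' : nbhs z U by exact: open_nbhs_nbhs.
exact: filterS Uz'.
Qed.

Lemma pd_eq U f g i : open U -> (forall z, U z -> f z = g z) ->
  forall z, U z -> pd i f z = pd i g z.
Proof.
by move=> oU fg z Uz; apply: near_eq_derive; apply: near_open oU Uz fg.
Qed.

Lemma continuous_eq_on U f g z : open U -> (forall z, U z -> f z = g z) ->
  U z -> {for z, continuous f} -> {for z, continuous g}.
Proof.
move=> oU fg Uz; rewrite /prop_for /continuous_at (fg z Uz).
apply: cvg_trans; apply: (@near_eq_cvg _ _ (nbhs z)).
by apply: near_open oU Uz _ => y /fg.
Qed.

Lemma dbound_ext n U S f g s : open U -> S `<=` U ->
  (forall z, U z -> f z = g z) -> dbound n U S f s -> dbound n U S g s.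
Proof.
move=> oU SU; elim: n f g s => [|n IH] f g s fg [cf bf df].
  split=> [z Uz|z Sz|//]; first exact: continuous_eq_on fg _ (cf z Uz).
  by rewrite -fg ?bf //; exact: SU.
have nU z : U z -> \forall y \near z, f y = g y.
  by move=> Uz; apply: near_open oU Uz fg.
split=> [z Uz|z Sz|i]; first exact: continuous_eq_on fg _ (cf z Uz).
- by rewrite -fg ?bf //; exact: SU.
- split=> [z Uz|].
    by apply: near_eq_derivable ((df i).1 z Uz); exact: nU.
  apply: IH (df i).2; exact: pd_eq.
Qed.

Lemma pdD f g i z : derivable f z (bvec i) -> derivable g z (bvec i) ->
  pd i (f \+ g) z = pd i f z + pd i g z.
Proof. exact: deriveD. Qed.

Lemma pdM f g i z : derivable f z (bvec i) -> derivable g z (bvec i) ->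
  pd i (f \* g) z = f z * pd i g z + g z * pd i f z.
Proof. exact: deriveM. Qed.

Lemma dboundD n U S f g s t : open U -> S `<=` U ->
  dbound n U S f s -> dbound n U S g t ->
  dbound n U S (f \+ g) (fun k => s k + t k).
Proof.
move=> oU SU; elim: n f g s t => [|n IH] f g s t [cf bf df] [cg bg dg];
  (split; [by move=> z Uz; exact: continuousD (cf z Uz) (cg z Uz)
          |move=> z Sz; apply: le_trans (ler_normD _ _) _;
             by apply: lerD; [exact: bf|exact: bg]|]); first exact: I.
move=> i; split=> [z Uz|].
  by apply: derivableD; [exact: (df i).1|exact: (dg i).1].
apply: (@dbound_ext _ _ _ (pd i f \+ pd i g)) => //.
  by move=> z Uz; rewrite pdD //; [exact: (df i).1|exact: (dg i).1].
exact: IH (df i).2 (dg i).2.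
Qed.

(** Pascal's rule, in the form that matches the two terms of the product rule. *)
Lemma binom_convS s t n : binom_conv s t n.+1 =
  binom_conv (fun k => s k.+1) t n + binom_conv s (fun k => t k.+1) n.
Proof.
rewrite /binom_conv big_ord_recl bin0 mulr1n subn0.
under eq_bigr => i _ do rewrite lift0 subSS binS mulrnDr.
rewrite big_split /= addrA addrC; congr (_ + _).
rewrite [in RHS]big_ord_recl bin0 mulr1n subn0; congr (_ + _).
rewrite big_ord_recr /= bin_small // mulr0n addr0.
by apply: eq_bigr => i _; rewrite /bump /= add1n subnSK.
Qed.

Lemma dboundM n U S f g s t : open U -> S `<=` U ->
  dbound n U S f s -> dbound n U S g t -> dbound n U S (f \* g) (binom_conv s t).
Proof.
move=> oU SU.
have b0 (s' t' : nat -> R) (x y : R) :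
    `|x| <= s' 0%N -> `|y| <= t' 0%N -> `|x * y| <= binom_conv s' t' 0.
  move=> xs yt; rewrite /binom_conv big_ord1 bin0 mulr1n subn0 normrM.
  by apply: ler_pM.
elim: n f g s t => [|n IH] f g s t [cf bf df] [cg bg dg];
  (split; [by move=> z Uz; exact: continuousM (cf z Uz) (cg z Uz)
          |by move=> z Sz; apply: b0; [exact: bf|exact: bg]|]); first exact: I.
move=> i; split=> [z Uz|].
  by apply: derivableM; [exact: (df i).1|exact: (dg i).1].
apply: (@dbound_ext _ _ _ ((pd i f \* g) \+ (f \* pd i g))) => //.
  move=> z Uz; rewrite (pdM ((df i).1 z Uz) ((dg i).1 z Uz)).
  by rewrite addrC (mulrC (g z)).
have h1 : dbound n U S (pd i f \* g) (binom_conv (fun k => s k.+1) t).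
  by apply: IH (df i).2 _; apply: dbound_order (leqnSn n) _; split.
have h2 : dbound n U S (f \* pd i g) (binom_conv s (fun k => t k.+1)).
  by apply: IH _ (dg i).2; apply: dbound_order (leqnSn n) _; split.
by apply: dbound_le (dboundD oU SU h1 h2) _ => k _; rewrite -binom_convS.
Qed.

Lemma gevrey_shift C q k m : gevrey C q k m.+1 = gevrey (C * q) q k.+1 m.
Proof. by rewrite /gevrey exprS addSnnS !mulrA. Qed.

Lemma gevrey_ge0 C q k m : 0 <= C -> 0 <= q -> 0 <= gevrey C q k m.
Proof. by move=> C0 q0; rewrite /gevrey !mulr_ge0 ?exprn_ge0. Qed.

Lemma gevrey_le C C' q k m : C <= C' -> 0 <= q -> gevrey C q k m <= gevrey C' q k m.
Proof.
by move=> CC q0; rewrite /gevrey; rewrite ler_wpM2r// ler_wpM2r// exprn_ge0.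
Qed.

Lemma gevrey_le_shift C q k m : 0 <= C -> 0 <= q ->
  gevrey C q k m <= gevrey C q k.+1 m.
Proof.
move=> C0 q0; rewrite /gevrey ler_wpM2l ?mulr_ge0 ?exprn_ge0//.
by rewrite ler_nat addnS factS leq_pmull.
Qed.

Lemma gevreyS_le C q m : 0 <= C -> 0 <= q ->
  gevrey C q 1 m <= gevrey C (2 * q) 0 m.
Proof.
move=> C0 q0; rewrite /gevrey addn1 addn0 factS natrM exprMn.
rewrite -!mulrA ler_wpM2l// mulrCA ler_wpM2r ?mulr_ge0 ?exprn_ge0//.
by rewrite -natrX ler_nat ltn_expl.
Qed.

(* The estimate behind every closure property below: since
   n!/(n-m)! (n-m+k)! <= (n+k)!, the binomial convolution is a geometric sum. *)
Lemma binom_conv_gevrey B (s : R) C q k n : 0 <= B -> 0 <= s -> 0 <= C -> 2 * s <= q ->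
  binom_conv (gevrey B s 0) (gevrey C q k) n <= gevrey (2 * B * C) q k n.
Proof.
move=> B0 s0 C0 sq.
have q0 : 0 <= q by apply: le_trans sq; rewrite mulr_ge0.
have fle m : (m <= n)%N -> (m`! * (n - m + k)`! * 'C(n, m) <= (n + k)`!)%N.
  move=> mn; rewrite mulnAC [(m`! * _)%N]mulnC.
  have -> : ('C(n, m) * m`! = n ^_ m)%N by rewrite bin_ffact.
  rewrite -(@ffact_fact (n + k) m) ?(leq_trans mn) ?leq_addr//.
  rewrite addnC addnBA // [(k + n)%N]addnC leq_mul2r; apply/orP; right.
  elim: m mn => [|m IH] mn; first by rewrite !ffactn0.
  by rewrite !ffactnSr leq_mul ?IH ?(ltnW mn)// leq_sub2r ?leq_addr.
have trm (i : 'I_n.+1) : gevrey B s 0 i * gevrey C q k (n - i) *+ 'C(n, i) <=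
    2^-1 ^+ i * gevrey (B * C) q k n.
  have li : (i <= n)%N by rewrite -ltnS.
  rewrite /gevrey addn0 -mulr_natr.
  have -> : B * s ^+ i * (i`!)%:R * (C * q ^+ (n - i) * ((n - i + k)`!)%:R) *
      'C(n, i)%:R = (B * C * (s ^+ i * q ^+ (n - i))) *
      (i`! * (n - i + k)`! * 'C(n, i))%:R.
    by rewrite !natrM; ring.
  have -> : 2^-1 ^+ i * (B * C * q ^+ n * (n + k)`!%:R) =
      B * C * (2^-1 ^+ i * q ^+ n) * (n + k)`!%:R by ring.
  apply: ler_pM; rewrite ?ler_nat ?fle ?mulr_ge0 ?exprn_ge0//.
  rewrite ler_wpM2l ?mulr_ge0//.
  have -> : q ^+ n = q ^+ i * q ^+ (n - i) by rewrite -exprD subnKC.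
  rewrite mulrA.
  rewrite ler_wpM2r ?exprn_ge0// -exprMn lerXn2r ?nnegrE ?mulr_ge0 ?invr_ge0//.
  by rewrite mulrC ler_pdivlMr// mulrC.
apply: le_trans (ler_sum _ (fun i _ => trm i)) _.
rewrite -mulr_suml.
have -> : gevrey (2 * B * C) q k n = 2 * gevrey (B * C) q k n.
  by rewrite /gevrey; ring.
rewrite ler_wpM2r ?gevrey_ge0 ?mulr_ge0//.
have -> : \sum_(i < n.+1) (2^-1 : R) ^+ i = 2 - 2^-1 ^+ n.
  elim: n {fle trm} => [|n IH]; first by rewrite big_ord1 !expr0; lra.
  rewrite big_ord_recr /= IH exprS.
  by field.
by rewrite lerBlDr lerDl exprn_ge0 ?invr_ge0.
Qed.

Lemma dboundM_gevrey n U S f g B (s : R) C q k : open U -> S `<=` U ->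
  0 <= B -> 0 <= s -> 0 <= C -> 2 * s <= q ->
  dbound n U S f (gevrey B s 0) -> dbound n U S g (gevrey C q k) ->
  dbound n U S (f \* g) (gevrey (2 * B * C) q k).
Proof.
move=> oU SU B0 s0 C0 sq df dg; apply: dbound_le (dboundM oU SU df dg) _ => m _.
exact: binom_conv_gevrey.
Qed.

Lemma pd_cst i (a : R) : pd i (fun=> a) = fun=> 0.
Proof. by apply/funext => z; exact: derive_cst. Qed.

Lemma dbound_zero n U S s : (forall k, 0 <= s k) -> dbound n U S (fun=> 0) s.
Proof.
elim: n s => [|n IH] s s0; (split; [by move=> z _; exact: cst_continuous
  |by move=> z _; rewrite normr0|]); first exact: I.
move=> i; split=> [z _|]; first exact: derivable_cst.
by rewrite pd_cst; apply: IH.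
Qed.

Lemma dbound_cst n U S (a : R) s : `|a| <= s 0%N -> (forall k, 0 <= s k) ->
  dbound n U S (fun=> a) s.
Proof.
move=> as0 s0; case: n => [|n]; (split; [by move=> z _; exact: cst_continuous
  |by move=> z _|]); first exact: I.
move=> i; split=> [z _|]; first exact: derivable_cst.
by rewrite pd_cst; apply: dbound_zero.
Qed.

Lemma dbound_sum (I : Type) (r : seq I) n U S (F : I -> 'rV[R]_2 -> R) s :
  open U -> S `<=` U -> (forall k, 0 <= s k) ->
  (forall i, dbound n U S (F i) s) ->
  dbound n U S (fun z => \sum_(i <- r) F i z) (fun k => s k *+ size r).
Proof.
move=> oU SU s0 dF; elim: r => [|i r IH].
  apply: (@dbound_ext _ _ _ (fun=> 0)) => //; first by move=> z _; rewrite big_nil.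
  by apply: dbound_zero.
apply: (@dbound_ext _ _ _ (F i \+ (fun z => \sum_(j <- r) F j z))) => //.
  by move=> z _; rewrite big_cons.
by apply: dbound_le (dboundD oU SU (dF i) IH) _ => k _; rewrite /= mulrS.
Qed.

Lemma gevrey_mono C C' q q' m : 0 <= C -> 0 <= q -> C <= C' -> q <= q' ->
  gevrey C q 0 m <= gevrey C' q' 0 m.
Proof.
move=> C0 q0 CC qq; rewrite /gevrey ler_wpM2r// ler_pM ?exprn_ge0//.
by rewrite lerXn2r ?nnegrE// (le_trans q0).
Qed.

(* The derivatives of an outer function along an inner one: u k stands for
   f^(k) \o phi and b i for the partial derivatives of phi. *)
Lemma dbound_chain n U S (u : nat -> 'rV[R]_2 -> R) (b : 'I_2 -> 'rV[R]_2 -> R)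
    C A B (s Q : R) k :
  open U -> S `<=` U -> 0 <= C -> 0 <= A -> 0 <= B -> 0 <= s ->
  2 * s <= Q -> 2 * B * A <= Q ->
  (forall k z, U z -> {for z, continuous (u k)}) ->
  (forall k i z, U z -> is_derive z (bvec i) (u k) (b i z * u k.+1 z)) ->
  (forall k z, S z -> `|u k z| <= C * A ^+ k * (k`!)%:R) ->
  (forall i, dbound n U S (b i) (gevrey B s 0)) ->
  dbound n U S (u k) (gevrey (C * A ^+ k) Q k).
Proof.
move=> oU SU C0 A0 B0 s0 sQ AQ cu du bu; elim: n k => [|n IH] k db.
  by split; [exact: cu|move=> z /bu; rewrite /gevrey expr0 mulr1|].
have Q0 : 0 <= Q by apply: le_trans sQ; rewrite mulr_ge0.
split; [exact: cu|by move=> z /bu; rewrite /gevrey expr0 mulr1|move=> i].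
split=> [z Uz|]; first by case: (du k i z Uz).
apply: (@dbound_ext _ _ _ (b i \* u k.+1)) => //.
  by move=> z Uz; rewrite /pd; case: (du k i z Uz) => _ ->.
have db' j : dbound n U S (b j) (gevrey B s 0).
  exact: dbound_order (leqnSn n) (db j).
have CA0 : 0 <= C * A ^+ k by rewrite mulr_ge0 ?exprn_ge0.
apply: dbound_le (dboundM_gevrey oU SU B0 s0 _ sQ (db' i) (IH k.+1 db')) _.
  by rewrite mulr_ge0 ?exprn_ge0.
move=> m _; rewrite gevrey_shift; apply: gevrey_le => //.
rewrite exprS; have -> : 2 * B * (C * (A * A ^+ k)) = C * A ^+ k * (2 * B * A).
  by ring.
exact: ler_wpM2l.
Qed.

(** The converse of the chain rule: with [u k] the composite of f^(k) with phi and [b] the inverse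
    of a nonzero partial derivative of phi, bounds on the first composite give bounds on all f^(k).
    Each step differentiates once, hence the order [n - k], and costs a factor [q] for the
    derivative and [2 * B] for the product. *)
Lemma dbound_vector_field n U S (u : nat -> 'rV[R]_2 -> R) (b : 'rV[R]_2 -> R)
    C q B (s : R) i k :
  open U -> S `<=` U -> 0 <= C -> 0 <= B -> 0 <= s -> 2 * s <= q ->
  (forall k z, U z -> u k.+1 z = b z * pd i (u k) z) ->
  dbound n U S (u 0%N) (gevrey C q 0) ->
  dbound n U S b (gevrey B s 0) ->
  (k <= n)%N -> dbound (n - k) U S (u k) (gevrey (C * (2 * B * q) ^+ k) q k).
Proof.
move=> oU SU C0 B0 s0 sq ub du db; elim: k => [|k IH] kn.
  by rewrite subn0 expr0 mulr1.
have q0 : 0 <= q by apply: le_trans sq; rewrite mulr_ge0.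
have := IH (ltnW kn); rewrite -(subnSK kn) => /(dbound_pd i) d1.
apply: (@dbound_ext _ _ _ (b \* pd i (u k))) => //.
  by move=> z Uz; rewrite ub.
have d2 : dbound (n - k.+1) U S (pd i (u k))
    (gevrey (C * (2 * B * q) ^+ k * q) q k.+1).
  by apply: dbound_le d1 _ => m _; rewrite gevrey_shift.
apply: dbound_le (dboundM_gevrey oU SU B0 s0 _ sq (dbound_order _ db) d2) _.
- by rewrite !mulr_ge0// exprn_ge0// !mulr_ge0.
- exact: leq_subr.
move=> m _; apply: gevrey_le => //; rewrite exprS le_eqVlt; apply/orP; left.
by apply/eqP; ring.
Qed.

(* Uniform Cauchy estimates, equivalent to analyticity locally. *)
Definition anb U f := exists C q : R, [/\ 0 <= C, 0 <= q &
  forall n, dbound n U U f (gevrey C q 0)].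

Lemma anb_sub U U' f : U' `<=` U -> anb U f -> anb U' f.
Proof.
move=> UU [C [q [C0 q0 df]]]; exists C, q; split=> // n; exact: dbound_sub (df n).
Qed.

Lemma anb_ext U f g : open U -> (forall z, U z -> f z = g z) -> anb U f -> anb U g.
Proof.
move=> oU fg [C [q [C0 q0 df]]]; exists C, q; split=> // n.
by apply: dbound_ext (df n).
Qed.

Lemma anbD U f g : open U -> anb U f -> anb U g -> anb U (f \+ g).
Proof.
move=> oU [C [q [C0 q0 df]]] [C' [q' [C0' q0' dg]]].
exists (C + C'), (q + q'); split=> [||n]; rewrite ?addr_ge0//.
apply: dbound_le (dboundD oU _ (df n) (dg n)) _ => // m _.
have -> : gevrey (C + C') (q + q') 0 m =
    gevrey C (q + q') 0 m + gevrey C' (q + q') 0 m by rewrite /gevrey; ring.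
by rewrite lerD// gevrey_mono// ?lerDl// lerDr.
Qed.

Lemma anbM U f g : open U -> anb U f -> anb U g -> anb U (f \* g).
Proof.
move=> oU [C [q [C0 q0 df]]] [C' [q' [C0' q0' dg]]].
exists (2 * C * C'), (2 * q + q'); split=> [||n]; rewrite ?addr_ge0 ?mulr_ge0//.
apply: (@dboundM_gevrey _ _ _ _ _ _ q) => //; first by rewrite lerDl.
by apply: dbound_le (dg n) _ => m _; rewrite gevrey_mono// lerDr mulr_ge0.
Qed.

Lemma anb_pd U f i : open U -> anb U f -> anb U (pd i f).
Proof.
move=> oU [C [q [C0 q0 df]]]; exists (C * q), (2 * q).
split=> [||n]; rewrite ?mulr_ge0//.
apply: dbound_le (dbound_pd i (df n.+1)) _ => m _.
by rewrite gevrey_shift gevreyS_le ?mulr_ge0.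
Qed.

Lemma anb_cst U (a : R) : anb U (fun=> a).
Proof.
exists `|a|, 0; split=> // n; apply: dbound_cst => [|k].
  by rewrite /gevrey expr0 !mulr1.
by rewrite gevrey_ge0.
Qed.

Lemma anb_sum (I : Type) (r : seq I) (P : pred I) U (F : I -> 'rV[R]_2 -> R) :
  open U -> (forall i, anb U (F i)) -> anb U (fun z => \sum_(i <- r | P i) F i z).
Proof.
move=> oU aF; elim: r => [|i r IH].
  by apply: anb_ext (anb_cst U 0) => // z _; rewrite big_nil.
case Pi : (P i); last by apply: anb_ext IH => // z _; rewrite big_cons Pi.
apply: anb_ext (anbD oU (aF i) IH) => //.
by move=> z _; rewrite big_cons Pi.
Qed.

Lemma anb_derivable U f i z : anb U f -> U z -> derivable f z (bvec i).
Proof. by move=> [C [q [_ _ df]]] Uz; exact: (dbound_derivable i (df 1%N) Uz). Qed.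

Lemma anb_continuous U f z : anb U f -> U z -> {for z, continuous f}.
Proof. by move=> [C [q [_ _ df]]] Uz; exact: (dbound_cont (df 1%N) Uz). Qed.

(** Only the chain rule relation between consecutive [u k] enters, so the lemma covers both
    convergent series composed with phi and reciprocals. *)
Lemma anb_comp U (u : nat -> 'rV[R]_2 -> R) phi C A :
  open U -> 0 <= C -> 0 <= A -> anb U phi ->
  (forall k z, U z -> {for z, continuous (u k)}) ->
  (forall k i z, U z -> is_derive z (bvec i) (u k) (pd i phi z * u k.+1 z)) ->
  (forall k z, U z -> `|u k z| <= C * A ^+ k * (k`!)%:R) ->
  forall k, anb U (u k).
Proof.
move=> oU C0 A0 aphi cu du bu k.
have [B [s [B0 s0 db]]] : exists B s : R, [/\ 0 <= B, 0 <= s &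
    forall i n, dbound n U U (pd i phi) (gevrey B s 0)].
  have [C1 [q [C10 q0 d]]] := aphi; exists (C1 * q), (2 * q).
  split=> [||i n]; rewrite ?mulr_ge0//.
  apply: dbound_le (dbound_pd i (d n.+1)) _ => m _.
  by rewrite gevrey_shift gevreyS_le ?mulr_ge0.
pose Q := 2 * s + 2 * B * A.
have Q1 : 2 * s <= Q by rewrite lerDl !mulr_ge0.
have Q2 : 2 * B * A <= Q by rewrite lerDr mulr_ge0.
have Q0 : 0 <= Q by rewrite addr_ge0 ?mulr_ge0.
(* Each shift of the factorial is paid by doubling the ratio, since m + j + 1 <= (m + 1)(j + 1) <=
   2^m (j + 1). *)
have gl j C1 : 0 <= C1 -> exists2 C2, 0 <= C2 &
    forall m, gevrey C1 Q j m <= gevrey C2 (2 ^+ j * Q) 0 m.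
  elim: j C1 => [|j IH] C1 C10.
    by exists C1 => // m; rewrite expr0 mul1r.
  have [C2 C20 h] := IH C1 C10; exists (C2 * j.+1%:R); first by rewrite mulr_ge0.
  move=> m.
  have -> : gevrey C1 Q j.+1 m = gevrey C1 Q j m * (m + j.+1)%:R.
    by rewrite /gevrey addnS factS natrM; ring.
  apply: le_trans (ler_wpM2r _ (h m)) _ => //.
  rewrite /gevrey addn0 exprS -[2 * 2 ^+ j * Q]mulrA [(2 * _) ^+ m]exprMn.
  have -> : C2 * j.+1%:R * (2 ^+ m * (2 ^+ j * Q) ^+ m) * (m`!)%:R =
    (C2 * (2 ^+ j * Q) ^+ m * (m`!)%:R) * (2 ^+ m * j.+1%:R) by ring.
  rewrite ler_wpM2l//.
    by rewrite !mulr_ge0// exprn_ge0// mulr_ge0// exprn_ge0.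
  rewrite -natrX -natrM ler_nat addnS -addSn.
  have h1 : (m < 2 ^ m)%N by exact: ltn_expl.
  have h2 : (m + j.+1 <= m.+1 * j.+1)%N.
    by rewrite mulSn addnC leq_add2l leq_pmulr.
  by rewrite addSnnS (leq_trans h2)// leq_mul2r h1 orbT.
have [C2 C20 h] := gl k _ (mulr_ge0 C0 (exprn_ge0 k A0)).
exists C2, (2 ^+ k * Q); split=> // [|n]; first by rewrite mulr_ge0 ?exprn_ge0.
apply: dbound_le (fun m _ => h m).
by apply: (@dbound_chain _ _ _ _ (fun i => pd i phi) _ _ B s).
Qed.

(** Both difference quotients are the same function of the increment. This carries the mean value
    theorem and the chain rule from the line to directional derivatives. *)
Lemma is_derive_line f (z v : 'rV[R]_2) (t d : R) :
  is_derive t 1 (fun h => f (h *: v + z)) d <-> is_derive (t *: v + z) v f d.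
Proof.
have e : (fun h : R => h^-1 *: (((fun h => f (h *: v + z)) \o shift t) (h *: 1) -
      f (t *: v + z))) =
    (fun h : R => h^-1 *: ((f \o shift (t *: v + z)) (h *: v) - f (t *: v + z))).
  by apply/funext => h /=; rewrite [h *: 1]mulr1 scalerDl addrA.
by split=> -[h1 h2]; constructor; move: h1 h2; rewrite /derivable /derive e.
Qed.

Lemma is_derive_comp (F : R -> R) f (z v : 'rV[R]_2) (D d : R) :
  is_derive (f z) 1 F D -> is_derive z v f d -> is_derive z v (F \o f) (D * d).
Proof.
move=> dF df; have z0 : z = 0 *: v + z by rewrite scale0r add0r.
rewrite z0; apply/(is_derive_line (F \o f)).
apply: (@is_derive1_comp _ F (fun h => f (h *: v + z))).
  by rewrite -z0.
by apply/is_derive_line; rewrite -z0.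
Qed.

(** The k-th derivative of 1/y is (-1)^k k! y^(-k-1), which is at most c^-1 (c^-1)^k k! where |y| >=
    c; hence both constants given to [anb_comp] are [c^-1]. *)
Lemma anb_inv U g (c : R) : open U -> 0 < c -> anb U g ->
  (forall z, U z -> c <= `|g z|) -> anb U (fun z => (g z)^-1).
Proof.
move=> oU c0 ag gc.
pose u (k : nat) z := (-1) ^+ k * (k`!)%:R * (g z)^-1 ^+ k.+1.
have gn0 z : U z -> g z != 0.
  by move=> /gc; rewrite -normr_gt0; apply: lt_le_trans.
have idg z i : U z -> is_derive z (bvec i) g (pd i g z).
  by move=> Uz; apply: DeriveDef => //; exact: anb_derivable ag Uz.
pose v k := ((-1) ^+ k * (k`!)%:R) \*: (fun y : R => y^-1) ^+ k.+1.
have uv k : u k = v k \o g.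
  by apply/funext => y; rewrite /u /v /= /GRing.scale /= exprfctE.
have dv k z : U z -> is_derive (g z) 1 (v k)
    ((-1) ^+ k.+1 * (k.+1`!)%:R * (g z)^-1 ^+ k.+2).
  move=> Uz; have g0 := gn0 z Uz.
  have d1 : is_derive (g z) 1 (fun y : R => y^-1) (- (g z) ^- 2).
    by apply: is_derive_eq (is_deriveV g0 (is_derive_id _ _)) _; rewrite /GRing.scale /= mulr1.
  have d3 := is_deriveZ ((-1) ^+ k * (k`!)%:R) (is_deriveX k.+1 d1).
  apply: is_derive_eq d3 _; rewrite /GRing.scale /= factS natrM !exprS.
  by field.
have du k i z : U z -> is_derive z (bvec i) (u k) (pd i g z * u k.+1 z).
  move=> Uz; rewrite uv mulrC; exact: is_derive_comp (dv k z Uz) (idg z i Uz).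
have cu k z : U z -> {for z, continuous (u k)}.
  move=> Uz; rewrite uv; apply: continuous_comp; first exact: anb_continuous ag Uz.
  by apply/differentiable_continuous/derivable1_diffP; case: (dv k z Uz).
apply: (@anb_ext _ (u 0%N)) => //.
  by move=> z _; rewrite /u expr0 fact0 expr1 !mul1r.
apply: (@anb_comp _ _ g c^-1 c^-1) => //; rewrite ?invr_ge0 ?ltW//.
move=> k z Uz; rewrite /u !normrM normrX normrN1 expr1n mul1r normrX normfV.
rewrite -exprS mulrC ger0_norm// ler_wpM2r//.
have gp : 0 < `|g z| by rewrite normr_gt0 gn0.
apply: lerXn2r; rewrite ?nnegrE ?invr_ge0 ?(ltW c0) ?(ltW gp)//.
by rewrite lef_pV2 ?posrE ?gc.
Qed.

End DBound.

(** * Coordinates, the sup norm and mixed partial derivatives in the plane *)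

Section Plane.
Variable R : realType.
Implicit Types (f : 'rV[R]_2 -> R) (U S : set 'rV[R]_2) (v x y z : 'rV[R]_2).

Lemma I2P (i : 'I_2) : i = 0 \/ i = 1.
Proof.
by case: i => [[|[|//]] p]; [left|right]; apply/val_inj.
Qed.

Lemma norm_le2 v (d : R) : (`|v| <= d) = (`|v 0 0| <= d) && (`|v 0 1| <= d).
Proof.
have e (i j : _) : `|v i j| <= `|v|.
  rewrite [leRHS]/Num.norm /= mx_normrE.
  exact: (le_bigmax _ (fun k => `|v k.1 k.2|) (i, j)).
apply/idP/andP => [vd|[h0 h1]]; first by rewrite !(le_trans (e _ _)).
rewrite [leLHS]/Num.norm /= mx_normrE; apply/bigmax_leP; split=> /=.
  by apply: le_trans h0.
by move=> [i j] _ /=; rewrite (ord1 i); case: (I2P j) => ->.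
Qed.

Lemma coord_le_norm v i : `|v 0 i| <= `|v|.
Proof.
by have := lexx `|v|; rewrite {1}norm_le2 => /andP[]; case: (I2P i) => ->.
Qed.

Lemma norm_le_sum2 v : `|v| <= `|v 0 0| + `|v 0 1|.
Proof. by rewrite norm_le2 lerDl lerDr !normr_ge0. Qed.

Lemma bvecE (i j : 'I_2) : (bvec i : 'rV[R]_2) 0 j = (i == j)%:R.
Proof. by rewrite mxE eqxx eq_sym. Qed.

Lemma decomp2 v : v = v 0 0 *: bvec 0 + v 0 1 *: bvec 1.
Proof.
apply/rowP => i; rewrite mxE [in RHS]mxE [X in _ = _ + X]mxE !bvecE.
by case: (I2P i) => -> /=; rewrite ?mulr1 ?mulr0 ?addr0 ?add0r.
Qed.

Lemma comb2E (a b : R) : ((a *: bvec 0 + b *: bvec 1 : 'rV[R]_2) 0 0 = a) *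
  ((a *: bvec 0 + b *: bvec 1 : 'rV[R]_2) 0 1 = b).
Proof. by split; rewrite !mxE /= ?mulr1 ?mulr0 ?addr0 ?add0r. Qed.

Lemma norm_bvec i : `|bvec i : 'rV[R]_2| = 1.
Proof.
apply/eqP; rewrite eq_le norm_le2 !bvecE; apply/andP; split.
  by case: (I2P i) => -> /=; rewrite ?normr1 ?normr0 ?lexx ?ler01.
by apply: le_trans (coord_le_norm _ i); rewrite bvecE eqxx normr1.
Qed.

Lemma open_box U z : open U -> U z ->
  exists2 d : R, 0 < d & forall y, `|y - z| < d -> U y.
Proof.
move=> oU Uz; have : nbhs z U by exact: open_nbhs_nbhs.
move=> /nbhs_ballP [d /= d0 dU]; exists d => // y yz; apply: dU.
by rewrite -ball_normE /= distrC.
Qed.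

Definition box z (d : R) : set 'rV[R]_2 := [set y | `|y - z| < d].

Lemma box_open z (d : R) : open (box z d).
Proof.
rewrite openE => y yz; apply/nbhs_ballP; exists (d - `|y - z|) => /=.
  by rewrite subr_gt0.
move=> t; rewrite -ball_normE /= => ty; rewrite /box /=.
have -> : t - z = (t - y) + (y - z) by rewrite addrA subrK.
by rewrite (le_lt_trans (ler_normD _ _))// distrC -ltrBrDr.
Qed.

Lemma box_center z (d : R) : 0 < d -> box z d z.
Proof. by move=> d0; rewrite /box /= subrr normr0. Qed.

Lemma line_MVT U f i y (a b : R) : a < b ->
  (forall z, U z -> derivable f z (bvec i)) ->
  (forall t, a <= t <= b -> U (t *: bvec i + y)) ->
  exists2 t, a < t < b &
    f (b *: bvec i + y) - f (a *: bvec i + y) = pd i f (t *: bvec i + y) * (b - a).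
Proof.
move=> ab df Uab.
have d t : a <= t <= b -> is_derive t 1 (fun h => f (h *: bvec i + y))
    (pd i f (t *: bvec i + y)).
  by move=> /Uab /df dt; apply/is_derive_line; exact: DeriveDef.
have [t||t] := @MVT R (fun h => f (h *: bvec i + y))
  (fun t => pd i f (t *: bvec i + y)) a b ab.
- by rewrite in_itv /= => /andP[/ltW ? /ltW ?]; apply: d; apply/andP.
- apply: derivable_within_continuous => t; rewrite in_itv /= => tab.
  by case: (d t tab).
- by rewrite in_itv /= => tab e; exists t.
Qed.

Lemma line_lipschitz U f i y (h K : R) :
  (forall z, U z -> derivable f z (bvec i)) ->
  (forall z, U z -> `|pd i f z| <= K) ->
  (forall t, `|t| <= `|h| -> U (t *: bvec i + y)) ->
  `|f (h *: bvec i + y) - f y| <= K * `|h|.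
Proof.
move=> df bf Uh; have e0 : y = 0 *: bvec i + y by rewrite scale0r add0r.
have [h0|h0|->] := ltgtP h 0; last by rewrite -e0 subrr !normr0 mulr0.
- rewrite {2}e0 distrC.
  have [t|t /andP[ht t0] ->] := line_MVT h0 df (y := y).
    move=> /andP[ht t0]; apply: Uh; rewrite ler0_norm// [leRHS]ler0_norm ?lerN2//.
    exact: ltW.
  rewrite sub0r normrM normrN ler_wpM2r//; apply/bf/Uh.
  by rewrite (ltr0_norm t0) (ltr0_norm h0) lerN2 ltW.
- rewrite {2}e0.
  have [t|t /andP[t0 ht] ->] := line_MVT h0 df (y := y).
    by move=> /andP[t0 ht]; apply: Uh; rewrite ger0_norm// gtr0_norm.
  rewrite subr0 normrM ler_wpM2r//; apply/bf/Uh.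
  by rewrite (gtr0_norm t0) (gtr0_norm h0) ltW.
Qed.

Lemma continuous_boxP f z : {for z, continuous f} <->
  forall e : R, 0 < e -> exists2 d : R, 0 < d &
    forall y, `|y - z| < d -> `|f y - f z| < e.
Proof.
have H := @cvgrPdist_lt _ _ _ (nbhs z) _ f (f z).
split=> [/H h e e0|h].
  have /nbhs_ballP [d /= d0 hd] := h e e0; exists d => // y yz.
  by rewrite distrC; apply: hd; rewrite -ball_normE /= distrC.
apply/H => e e0; have [d d0 hd] := h e e0; apply/nbhs_ballP; exists d => // y.
by rewrite -ball_normE /= distrC => /hd; rewrite distrC.
Qed.

(** Bounded partial derivatives make [f] Lipschitz along coordinate segments, and two such segments
    join [z] to any nearby point. *)
Lemma continuous_of_pd U f (K : R) : open U ->
  (forall i z, U z -> derivable f z (bvec i)) ->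
  (forall i z, U z -> `|pd i f z| <= K) ->
  forall z, U z -> {for z, continuous f}.
Proof.
move=> oU df bf z Uz; have [d d0 dU] := open_box oU Uz.
have K0 : 0 <= K by apply: le_trans (bf 0 z Uz).
apply/continuous_boxP => e e0.
exists (Num.min d (e / (2 * K + 1))).
  by rewrite /= lt_min d0 divr_gt0// ltr_wpDl// mulr_ge0.
move=> y; rewrite lt_min => /andP[yd ye].
set v := y - z; have ev : y = v 0 1 *: bvec 1 + (v 0 0 *: bvec 0 + z).
  by rewrite addrA [X in X + z]addrC -decomp2 subrK.
have h1 : `|f y - f (v 0 0 *: bvec 0 + z)| <= K * `|v 0 1|.
  rewrite {1}ev; apply: line_lipschitz (df 1) (bf 1) _ => t tv; apply: dU.
  apply: le_lt_trans yd; rewrite addrA addrK norm_le2.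
  rewrite [t *: _ + _]addrC !comb2E coord_le_norm.
  by rewrite (le_trans tv)// coord_le_norm.
have h0 : `|f (v 0 0 *: bvec 0 + z) - f z| <= K * `|v 0 0|.
  apply: line_lipschitz (df 0) (bf 0) _ => t tv; apply: dU.
  apply: le_lt_trans yd; rewrite addrK normrZ norm_bvec mulr1.
  by rewrite (le_trans tv)// coord_le_norm.
have -> : f y - f z = (f y - f (v 0 0 *: bvec 0 + z)) +
  (f (v 0 0 *: bvec 0 + z) - f z) by rewrite addrA subrK.
apply: le_lt_trans (ler_normD _ _) _.
apply: le_lt_trans (lerD h1 h0) _; rewrite -mulrDr.
have h2 : `|v 0 1| + `|v 0 0| <= 2 * `|v|.
  by rewrite mulrDl !mul1r lerD// coord_le_norm.
apply: le_lt_trans (ler_wpM2l K0 h2) _.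
rewrite -/v ltr_pdivlMr in ye; last by rewrite ltr_wpDl// mulr_ge0.
by have := normr_ge0 v; move: ye; rewrite mulrDr mulr1; lra.
Qed.

(** The mean value theorem applied twice to the second difference. That difference is symmetric in
    [i] and [j], so it compares the two mixed derivatives. *)
Lemma double_increment U f i j z (h : R) : 0 < h ->
  (forall k y, U y -> derivable f y (bvec k)) ->
  (forall k l y, U y -> derivable (pd k f) y (bvec l)) ->
  (forall y, `|y - z| <= 2 * h -> U y) ->
  exists2 p, `|p - z| <= 2 * h &
    f (h *: bvec i + (h *: bvec j + z)) - f (h *: bvec i + z) -
    (f (h *: bvec j + z) - f z) = pd j (pd i f) p * h * h.
Proof.
move=> h0 df ddf Uh.
have nU (s t : R) k l : 0 <= s <= h -> 0 <= t <= h ->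
    `|s *: bvec k + (t *: bvec l + z) - z| <= 2 * h.
  move=> /andP[s0 sh] /andP[t0 th]; rewrite addrA addrK.
  apply: le_trans (ler_normD _ _) _; rewrite !normrZ !norm_bvec !mulr1 !ger0_norm//.
  lra.
have hh : 0 <= h <= h by rewrite lexx ltW.
have zh : (0 : R) <= (0 : R) <= h by rewrite lexx ltW.
pose phi := fun y => f (h *: bvec j + y) - f y.
have z0 k (y : 'rV[R]_2) : 0 *: bvec k + y = y by rewrite scale0r add0r.
have U1 (t : R) : 0 <= t <= h -> U (t *: bvec i + z).
  by move=> th; apply: Uh; have := nU t 0 i j th zh; rewrite z0.
have U2 (t : R) : 0 <= t <= h -> U (h *: bvec j + (t *: bvec i + z)).
  by move=> th; apply: Uh; apply: nU.
have dphi t : 0 <= t <= h -> is_derive (t *: bvec i + z) (bvec i) phi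
    (pd i f (h *: bvec j + (t *: bvec i + z)) - pd i f (t *: bvec i + z)).
  move=> th; apply: is_deriveB; last by apply: DeriveDef => //; apply: df; exact: U1.
  have := df i _ (U2 t th) => dd.
  apply/is_derive_line.
  have -> : (fun s : R => f (h *: bvec j + (s *: bvec i + z))) =
      (fun s => f (s *: bvec i + (h *: bvec j + z))).
    by apply/funext => s; rewrite addrCA.
  by apply/is_derive_line; rewrite addrCA; exact: DeriveDef.
pose L := [set y : 'rV[R]_2 | exists2 t, 0 <= t <= h & y = t *: bvec i + z].
have [y [t th ->]|t th|t /andP[t0 th] e] := @line_MVT L phi i z 0 h h0.
- by case: (dphi t th).
- by exists t.
have th' : 0 <= t <= h by rewrite !ltW.
have e2 : pd i phi (t *: bvec i + z) =
    pd i f (h *: bvec j + (t *: bvec i + z)) - pd i f (t *: bvec i + z).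
  by rewrite /pd; case: (dphi t th') => _ ->.
have [s|s /andP[s0 sh] e3] := line_MVT (f := pd i f) (i := j) (y := t *: bvec i + z)
  h0 (ddf i j).
  by move=> sh; apply: Uh; apply: nU.
exists (s *: bvec j + (t *: bvec i + z)); first by apply: nU => //; rewrite !ltW.
move: e e3; rewrite e2 /phi !z0 !subr0 [h *: bvec j + (h *: _ + _)]addrCA => -> ->.
by ring.
Qed.

(** Schwarz's theorem: the two mixed derivatives agree at points [p] and [q] as close to [z] as
    desired, and both are continuous at [z]. *)
Lemma pd_comm n U S f s : open U -> dbound n.+2 U S f s ->
  forall i j z, U z -> pd j (pd i f) z = pd i (pd j f) z.
Proof.
move=> oU df i j z Uz; apply/eqP; apply: contraT => ne.
pose A := pd j (pd i f); pose B := pd i (pd j f).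
have cA : {for z, continuous A} by exact: dbound_cont (dbound_pd j (dbound_pd i df)) z Uz.
have cB : {for z, continuous B} by exact: dbound_cont (dbound_pd i (dbound_pd j df)) z Uz.
pose e := `|A z - B z| / 2.
have e0 : 0 < e by rewrite divr_gt0// normr_gt0 subr_eq0.
have [d d0 dU] := open_box oU Uz.
have [d1 d10 h1] := (continuous_boxP _ _).1 cA e e0.
have [d2 d20 h2] := (continuous_boxP _ _).1 cB e e0.
pose h := Num.min d (Num.min d1 d2) / 3.
have h0 : 0 < h by rewrite divr_gt0// !lt_min d0 d10 d20.
have hd : 2 * h < Num.min d (Num.min d1 d2).
  rewrite /h mulrCA gtr_pMr; last by rewrite !lt_min d0 d10 d20.
  by rewrite ltr_pdivrMr// mul1r ltr_nat.
clearbody h.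
have Uh y : `|y - z| <= 2 * h -> U y.
  move=> yz; apply: dU; apply: le_lt_trans yz _; apply: lt_le_trans hd _.
  by rewrite ge_min lexx.
have D k y : U y -> derivable f y (bvec k) by exact: dbound_derivable df y.
have DD k l y : U y -> derivable (pd k f) y (bvec l).
  exact: dbound_derivable (dbound_pd k df) y.
have [p pz ep] := @double_increment U f i j z h h0 D DD Uh.
have [q qz eq] := @double_increment U f j i z h h0 D DD Uh.
have epq : A p = B q.
  have hn0 : h * h != 0 by rewrite mulf_neq0// gt_eqF.
  rewrite /A /B; move: ep eq; rewrite [h *: bvec i + (_ + _)]addrCA.
  move: (f _) (f _) (f _) (f _) (pd j _ p) (pd i _ q) => a1 a2 a3 a4 x y ep eq.
  by apply: (mulIf hn0); rewrite !mulrA -ep -eq; ring.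
have hA : `|A z - A p| < e.
  rewrite distrC; apply: h1; apply: le_lt_trans pz _.
  by apply: lt_le_trans hd _; rewrite !ge_min lexx orbT.
have hB : `|B z - B q| < e.
  rewrite distrC; apply: h2; apply: le_lt_trans qz _.
  by apply: lt_le_trans hd _; rewrite !ge_min lexx !orbT.
have : `|A z - B z| < e + e.
  move: hA hB; rewrite epq; move: (A z) (B z) (B q) => a b c hA hB.
  have -> : a - b = (a - c) - (b - c) by ring.
  by apply: le_lt_trans (ler_normB _ _) _; rewrite ltrD.
by rewrite /e -splitr ltxx.
Qed.

Lemma pderivE i j f : pderiv i j f = iter i (pd 0) (iter j (pd 1) f).
Proof. by []. Qed.

Lemma dbound_iter n U S f s i k : dbound (k + n) U S f s ->
  dbound n U S (iter k (pd i) f) (fun m => s (k + m)%N).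
Proof.
elim: k f s => [|k IH] f s // df; rewrite iterSr.
by have := IH _ _ (dbound_pd i df).
Qed.

Lemma dbound_pderiv n U S f s i j : dbound (i + j + n) U S f s ->
  dbound n U S (pderiv i j f) (fun m => s (i + j + m)%N).
Proof.
move=> df; rewrite pderivE.
have := @dbound_iter (i + n) U S f s 1 j; rewrite addnCA addnA => /(_ df) d1.
apply: dbound_le (@dbound_iter n U S _ _ 0 i d1) _ => m _.
by rewrite addnA [(j + i)%N]addnC.
Qed.

Lemma iter_pd1_pd0 n U S f s j : open U -> dbound (j + n.+1) U S f s ->
  forall z, U z -> iter j (pd 1) (pd 0 f) z = pd 0 (iter j (pd 1) f) z.
Proof.
move=> oU; elim: j n => [|j IH] n df z Uz //.
have df' : dbound (j + n.+2) U S f s by rewrite addnS -addSn.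
have d2 : dbound n.+2 U S (iter j (pd 1) f) (fun m => s (j + m)%N).
  exact: dbound_iter df'.
rewrite iterS (pd_eq 1 oU (IH n.+1 df') Uz).
exact: pd_comm oU d2 0 1 z Uz.
Qed.

(** [pderiv] takes the derivatives in one fixed order of the directions, whereas [dbound] controls
    every order; commuting the derivatives bridges the two. *)
Lemma dbound_flat n U x f s : open U -> U x -> dbound n U [set x] f s ->
  (forall i j, (i + j <= n)%N -> pderiv i j f x = 0) ->
  dbound n U [set x] f (fun=> 0).
Proof.
move=> oU Ux; elim: n f s => [|n IH] f s df fl; have f0 := fl 0%N 0%N isT.
  by case: df => cf _ _; split=> // z ->; rewrite [f x]f0 normr0.
have [cf _ h] := df; split=> [//|z ->|k]; first by rewrite [f x]f0 normr0.
split; first exact: (h k).1.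
apply: IH (h k).2 _ => i j ij; case: (I2P k) => ->.
  rewrite pderivE.
  have jn : (j <= n)%N by apply: leq_trans ij; rewrite leq_addl.
  have e : forall z, U z -> iter j (pd 1) (pd 0 f) z = pd 0 (iter j (pd 1) f) z.
    apply: (@iter_pd1_pd0 0 U [set x] f s) => //.
    by apply: dbound_order df; rewrite addn1 ltnS.
  have e2 : forall z, U z -> iter i (pd 0) (iter j (pd 1) (pd 0 f)) z =
      iter i (pd 0) (pd 0 (iter j (pd 1) f)) z.
    elim: i {ij} => [|i IHi] //; rewrite !iterS; exact: pd_eq.
  by rewrite e2// -iterSr; apply: (fl i.+1 j); rewrite addSn ltnS.
by have := fl i j.+1; rewrite addnS ltnS => /(_ ij); rewrite pderivE iterSr.
Qed.

End Plane.

(** * Taylor's formula with remainder in one and two variables *)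

Section Taylor.
Variable R : realType.

Lemma MVT_le0 (w w' : R -> R) (t : R) : 0 < t ->
  (forall s : R, 0 <= s <= t -> is_derive s 1 w (w' s)) ->
  (forall s : R, 0 <= s <= t -> w' s <= 0) -> w t <= w 0.
Proof.
move=> t0 dw lw.
have [s||s] := @MVT R w w' 0 t t0.
- by rewrite in_itv /= => /andP[/ltW ? /ltW ?]; apply: dw; apply/andP.
- apply: derivable_within_continuous => s; rewrite in_itv /= => st.
  by case: (dw s st).
- rewrite in_itv /= => /andP[/ltW s0 /ltW st] e.
  rewrite -subr_le0 e subr0 mulr_le0_ge0 ?(ltW t0)//.
  by apply: lw; rewrite s0.
Qed.

Lemma is_derive_monomial (a s : R) n :
  is_derive s 1 (fun y : R => a * y ^+ n.+1) (a * (n.+1%:R * s ^+ n)).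
Proof.
have d := is_deriveZ a (is_deriveX n.+1 (is_derive_id s (1 : R))).
have -> : (fun y : R => a * y ^+ n.+1) = a \*: (id : R -> R) ^+ n.+1.
  by apply/funext => y; rewrite /= /GRing.scale /= exprfctE.
by apply: is_derive_eq d _; rewrite /GRing.scale /= mulr1.
Qed.

(** A comparison takes the place of integration: [w] minus the monomial has a nonpositive
    derivative. *)
Lemma monomial_growth_pos (w w' : R -> R) (t B : R) (N : nat) : 0 < t ->
  (forall s : R, 0 <= s <= t -> is_derive s 1 w (w' s)) ->
  (forall s : R, 0 <= s <= t -> w' s <= B * s ^+ N / (N`!)%:R) ->
  w 0 = 0 -> w t <= B * t ^+ N.+1 / (N.+1`!)%:R.
Proof.
move=> t0 dw lw w0.
pose m s := B / (N.+1`!)%:R * s ^+ N.+1.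
have fN : (N`!)%:R != 0 :> R by rewrite pnatr_eq0 -lt0n fact_gt0.
have := @MVT_le0 (w - m) (fun s => w' s - B / (N.+1`!)%:R * (N.+1%:R * s ^+ N)) t t0.
have -> : (w - m) t = w t - B * t ^+ N.+1 / (N.+1`!)%:R.
  by rewrite /m !fctE; congr (_ - _); rewrite mulrAC.
have -> : (w - m) 0 = 0 by rewrite /m !fctE w0 expr0n /= mulr0 subr0.
rewrite subr_le0; apply=> s st.
  by apply: is_deriveB; [exact: dw|exact: is_derive_monomial].
rewrite subr_le0; apply: le_trans (lw s st) _; rewrite le_eqVlt; apply/orP; left.
by apply/eqP; rewrite factS natrM; field; rewrite fN /= -(natrD _ 1 N) pnatr_eq0.
Qed.

Lemma monomial_growth (w w' : R -> R) (t B : R) (N : nat) :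
  (forall s : R, `|s| <= `|t| -> is_derive s 1 w (w' s)) ->
  (forall s : R, `|s| <= `|t| -> `|w' s| <= B * `|s| ^+ N / (N`!)%:R) ->
  w 0 = 0 -> `|w t| <= B * `|t| ^+ N.+1 / (N.+1`!)%:R.
Proof.
have pos (v v' : R -> R) (x : R) : 0 < x ->
    (forall s : R, `|s| <= x -> is_derive s 1 v (v' s)) ->
    (forall s : R, `|s| <= x -> `|v' s| <= B * `|s| ^+ N / (N`!)%:R) ->
    v 0 = 0 -> `|v x| <= B * x ^+ N.+1 / (N.+1`!)%:R.
  move=> x0 dv lv v0.
  have ab s : 0 <= s <= x -> (`|s| <= x) * (`|s| = s).
    by move=> /andP[s0 sx]; rewrite ger0_norm.
  rewrite ler_norml; apply/andP; split; last first.
    apply: (monomial_growth_pos (w' := v')) => // s /ab [sx se]; first exact: dv.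
    by have := lv s sx; rewrite se; apply: le_trans; exact: ler_norm.
  rewrite lerNl; apply: (@monomial_growth_pos (- v) (fun s => - v' s)) => //.
  - by move=> s /ab [sx se]; apply: is_deriveN; exact: dv.
  - move=> s /ab [sx se]; have := lv s sx; rewrite se; apply: le_trans.
    by rewrite -normrN; exact: ler_norm.
  - by rewrite fctE v0 oppr0.
move=> dw lw w0; have [t0|t0|->] := ltgtP t 0.
- have e : `|t| = - t by rewrite ltr0_norm.
  rewrite e -[t in `|w t|]opprK; apply: (pos (fun s => w (- s)) (fun s => - w' (- s))).
  + by rewrite oppr_gt0.
  + move=> s st; rewrite -mulrN1.
    apply: (@is_derive1_comp _ w (fun s => - s)).
    by apply: dw; rewrite normrN e.
  + by move=> s st; rewrite normrN; have := lw (- s); rewrite normrN e; apply.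
  + by rewrite oppr0.
- rewrite [`|t|]gtr0_norm//; apply: (pos w w') => // s st.
  + by apply: dw; rewrite [leRHS]gtr0_norm.
  + by apply: lw; rewrite [leRHS]gtr0_norm.
- by rewrite w0 normr0 expr0n /= mulr0 mul0r.
Qed.

(** Induction on [N] over the shifted family: the derivative of the remainder of [u 0] is the
    remainder of [u 1], and [monomial_growth] integrates its bound. Giving the derivatives as a
    family lets restrictions of plane functions to lines be used directly. *)
Lemma taylor1 (u : nat -> R -> R) (t B : R) (N : nat) :
  (forall k (s : R), (k < N)%N -> `|s| <= `|t| -> is_derive s 1 (u k) (u k.+1 s)) ->
  (forall s : R, `|s| <= `|t| -> `|u N s| <= B) ->
  `|u 0%N t - \sum_(k < N) u k 0 / (k`!)%:R * t ^+ k| <= B * `|t| ^+ N / (N`!)%:R.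
Proof.
elim: N u t => [|N IH] u t du bu.
  by rewrite big_ord0 subr0 expr0 fact0 divr1 mulr1 bu.
pose p (v : nat -> R -> R) n s := \sum_(k < n) v k 0 / (k`!)%:R * s ^+ k.
have dp (s : R) n (v : nat -> R -> R) : is_derive s 1 (p v n.+1) (p (fun k => v k.+1) n s).
  elim: n => [|n IHn].
    have -> : p v 1%N = fun=> v 0%N 0 / (0`!)%:R * 1.
      by apply/funext => y; rewrite /p big_ord1 expr0.
    by rewrite /p big_ord0; exact: is_derive_cst.
  have e : p v n.+2 = p v n.+1 + (fun s => v n.+1 0 / (n.+1`!)%:R * s ^+ n.+1).
    by apply/funext => y; rewrite /p big_ord_recr fctE.
  rewrite e [X in is_derive _ _ _ X]big_ord_recr /=.
  apply: is_deriveD; apply: is_derive_eq (is_derive_monomial _ _ _) _.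
  have fN : (n`!)%:R != 0 :> R by rewrite pnatr_eq0 -lt0n fact_gt0.
  rewrite factS natrM; field.
  by rewrite fN /= -(natrD _ 1 n) pnatr_eq0.
apply: (@monomial_growth (u 0%N - p u N.+1) (fun s => u 1%N s - p (fun k => u k.+1) N s)).
- by move=> s st; exact: is_deriveB (du 0%N s isT st) (dp s N u).
- move=> s st; apply: (IH (fun k => u k.+1) s) => [k y kN ys|y ys].
    by apply: du => //; apply: le_trans ys st.
  by apply: bu; apply: le_trans ys st.
- have -> : (u 0%N - p u N.+1) 0 = u 0%N 0 - p u N.+1 0 by [].
  rewrite /p big_ord_recl fact0 expr0 divr1 mulr1 big1 ?addr0 ?subrr// => i _.
  by rewrite lift0 expr0n /= mulr0.
Qed.

Lemma triangular_sum (a : nat -> nat -> R) N :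
  \sum_(n < N) \sum_(i < n.+1) a i (n - i)%N = \sum_(j < N) \sum_(i < N - j) a i j.
Proof.
elim: N => [|N IH]; first by rewrite !big_ord0.
rewrite big_ord_recr /= IH.
have -> : \sum_(j < N.+1) \sum_(i < N.+1 - j) a i j =
    \sum_(j < N.+1) (\sum_(i < N - j) a i j + a (N - j)%N j).
  by apply: eq_bigr => j _; rewrite subSn ?big_ord_recr// -ltnS.
rewrite big_split /= [X in _ = X + _]big_ord_recr /= subnn.
rewrite [X in _ = _ + X + _]big_ord0 addr0; congr (_ + _).
rewrite (reindex_inj rev_ord_inj) /=; apply: eq_bigr => i _.
by rewrite subSS subKn// -ltnS.
Qed.

Definition taylor_coef (f : 'rV[R]_2 -> R) (x : 'rV[R]_2) (i j : nat) : R :=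
  pderiv i j f x / ((i`!)%:R * (j`!)%:R).

Lemma line_derives (U : set 'rV[R]_2) f i y (s : nat -> R) N (t : R) k :
  dbound N U U f s -> U (t *: bvec i + y) -> (k < N)%N ->
  is_derive t 1 (fun t => iter k (pd i) f (t *: bvec i + y))
    (iter k.+1 (pd i) f (t *: bvec i + y)).
Proof.
move=> df Ut kN; apply/is_derive_line.
have d1 : dbound 1 U U (iter k (pd i) f) (fun m => s (k + m)%N).
  by apply: dbound_iter; apply: dbound_order df; rewrite addn1.
exact: DeriveDef (@dbound_derivable _ _ _ _ _ _ i d1 _ Ut) _.
Qed.

(** One Taylor expansion along the second coordinate, then one for each of its coefficients along
    the first. *)
Lemma taylor2 (U : set 'rV[R]_2) f x (d C q : R) N (h : 'rV[R]_2) :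
  0 <= C -> 0 <= q -> (forall y, `|y - x| < d -> U y) ->
  dbound N U U f (gevrey C q 0) -> `|h| < d ->
  `|f (h + x) - \sum_(n < N) homogeneous_part (taylor_coef f x) h n| <=
    C * (q * (`|h 0 0| + `|h 0 1|)) ^+ N.
Proof.
move=> C0 q0 Ux df hd.
set h0 := h 0 0; set h1 := h 0 1.
have eh : h + x = h1 *: bvec 1 + (h0 *: bvec 0 + x).
  by rewrite {1}[h]decomp2 addrA; congr (_ + _); exact: addrC.
have U1 (s : R) : `|s| <= `|h1| -> U (s *: bvec 1 + (h0 *: bvec 0 + x)).
  move=> sh; apply: Ux; apply: le_lt_trans hd; rewrite addrA addrK [_ *: _ + _]addrC.
  by rewrite norm_le2 !comb2E coord_le_norm (le_trans sh)// coord_le_norm.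
have U0 (s : R) : `|s| <= `|h0| -> U (s *: bvec 0 + x).
  move=> sh; apply: Ux; apply: le_lt_trans hd; rewrite addrK normrZ norm_bvec mulr1.
  by rewrite (le_trans sh)// coord_le_norm.
pose u k t := iter k (pd 1) f (t *: bvec 1 + (h0 *: bvec 0 + x)).
have bN (g : 'rV[R]_2 -> R) k m i y : dbound m U U g (fun l => gevrey C q 0 (k + l)) ->
    U y -> `|iter m (pd i) g y| <= gevrey C q 0 (k + m).
  move=> dg Uy.
  have d0 : dbound 0 U U (iter m (pd i) g) (fun l => gevrey C q 0 (k + (m + l))).
    by apply: (@dbound_iter _ _ _ _ _ (fun l => gevrey C q 0 (k + l))); rewrite addn0.
  by have := dbound0 d0 Uy; rewrite addn0.
have T1 : `|u 0%N h1 - \sum_(k < N) u k 0 / (k`!)%:R * h1 ^+ k| <=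
    gevrey C q 0 N * `|h1| ^+ N / (N`!)%:R.
  apply: taylor1 => [k s kN sh|s sh].
    exact: line_derives df (U1 s sh) kN.
  by apply: (bN f 0%N N 1 _ df); exact: U1.
have T2 (j : 'I_N) : `|u j 0 -
      \sum_(i < N - j) pderiv i j f x / (i`!)%:R * h0 ^+ i| <=
    gevrey C q 0 N * `|h0| ^+ (N - j) / ((N - j)`!)%:R.
  have jN : (j <= N)%N by rewrite ltnW.
  pose g := iter j (pd 1) f.
  have dg : dbound (N - j) U U g (fun m => gevrey C q 0 (j + m)).
    by apply: dbound_iter; rewrite subnKC.
  have := @taylor1 (fun k t => iter k (pd 0) g (t *: bvec 0 + x)) h0
    (gevrey C q 0 N) (N - j).
  have -> : u j 0 = g (h0 *: bvec 0 + x) by rewrite /u scale0r add0r.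
  have eg i : pderiv i j f x = iter i (pd 0) g (0 *: bvec 0 + x).
    by rewrite scale0r add0r.
  under [X in _ -> `|_ - X| <= _]eq_bigr => i _ do rewrite eg.
  apply=> [k s kN sh|s sh].
    exact: line_derives dg (U0 s sh) kN.
  by have := bN g j (N - j)%N 0 (s *: bvec 0 + x) dg (U0 s sh); rewrite subnKC.
have e1 : \sum_(n < N) homogeneous_part (taylor_coef f x) h n =
  \sum_(j < N) (\sum_(i < N - j) pderiv i j f x / (i`!)%:R * h0 ^+ i) /
     (j`!)%:R * h1 ^+ j.
  rewrite /homogeneous_part (triangular_sum (fun i j => taylor_coef f x i j * h0 ^+ i * h1 ^+ j)).
  apply: eq_bigr => j _; rewrite -mulrA mulr_suml; apply: eq_bigr => i _.
  by rewrite /taylor_coef invfM; ring.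
rewrite eh e1 -[f _]/(u 0%N h1).
have -> : u 0%N h1 - \sum_(j < N)
      (\sum_(i < N - j) pderiv i j f x / i`!%:R * h0 ^+ i) / j`!%:R * h1 ^+ j =
    (u 0%N h1 - \sum_(k < N) u k 0 / (k`!)%:R * h1 ^+ k) +
    \sum_(k < N) (u k 0 - \sum_(i < N - k) pderiv i k f x / i`!%:R * h0 ^+ i) /
       (k`!)%:R * h1 ^+ k.
  rewrite -addrA; congr (_ + _); rewrite -sumrN -sumrN -big_split /=.
  by apply: eq_bigr => k _; ring.
apply: le_trans (ler_normD _ _) _.
have T3 : `|\sum_(k < N) (u k 0 - \sum_(i < N - k) pderiv i k f x / i`!%:R * h0 ^+ i) /
       (k`!)%:R * h1 ^+ k| <=
   \sum_(k < N) gevrey C q 0 N * `|h0| ^+ (N - k) / ((N - k)`!)%:R / (k`!)%:R * `|h1| ^+ k.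
  apply: le_trans (ler_norm_sum _ _ _) _; apply: ler_sum => k _.
  rewrite !normrM normfV normr_nat normrX.
  by do 2 rewrite ler_wpM2r ?exprn_ge0 ?invr_ge0//.
apply: le_trans (lerD T1 T3) _.
(* The remainders are exactly the terms of the binomial expansion of (|h0| + |h1|)^N: the horizontal
   one of index k is the k-th term, the vertical one is the last, and the N! of the derivative bound
   supplies the binomial coefficients. *)
rewrite exprMn mulrA exprDn mulr_sumr [leRHS]big_ord_recr /= subnn expr0 mul1r binn mulr1n.
have f0 n : (n`!)%:R != 0 :> R by rewrite pnatr_eq0 -lt0n fact_gt0.
rewrite addrC; apply: lerD; last first.
  apply: ler_sum => k _; rewrite le_eqVlt; apply/orP; left; apply/eqP.
  have kN : (k <= N)%N by rewrite ltnW.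
  rewrite -mulr_natr /gevrey addn0 -(bin_fact kN) !natrM.
  by field; rewrite !f0.
by rewrite /gevrey addn0 le_eqVlt; apply/orP; left; apply/eqP; field.
Qed.

End Taylor.

(** * Sequences with geometric bounds and derivatives from quadratic errors *)

Section GeometricBounds.
Variable R : realType.

Lemma cvg_of_geometric (u : R^nat) (l C x : R) : 0 <= x -> x < 1 ->
  (forall n, `|u n - l| <= C * x ^+ n) -> u @ \oo --> l.
Proof.
move=> x0 x1 ul; have x1' : `|x| < 1 by rewrite ger0_norm.
have g0 := cvg_geometric C x1'.
apply: (@squeeze_cvgr _ _ _ _ (fun n => l - geometric C x n) (fun n => l + geometric C x n)).
- by near=> n; have := ul n; rewrite ler_distl /geometric /= => /andP[-> ->].
- by rewrite -[X in _ --> X]subr0; apply: cvgB => //; exact: cvg_cst.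
- by rewrite -[X in _ --> X]addr0; apply: cvgD => //; exact: cvg_cst.
Unshelve. all: by end_near. Qed.

Lemma zero_of_geometric (a C x : R) : 0 <= x -> x < 1 ->
  (forall n, `|a| <= C * x ^+ n) -> a = 0.
Proof.
move=> x0 x1 an.
have c1 : (fun _ : nat => a) @ \oo --> (0 : R).
  by apply: (cvg_of_geometric x0 x1) => n; rewrite subr0.
exact: (cvg_unique _ (cvg_cst a) c1).
Qed.

Lemma is_cvg_series_geometric (u : R^nat) (C x : R) : 0 <= x -> x < 1 ->
  (forall n, `|u n| <= C * x ^+ n) -> cvgn [normed series u].
Proof.
move=> x0 x1 un; have x1' : `|x| < 1 by rewrite ger0_norm.
apply: (series_le_cvg (v_ := geometric C x)) => //=.
  by move=> n; apply: le_trans (un n).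
exact: is_cvg_geometric_series.
Qed.

Lemma norm_lim_le (u : R^nat) (l B : R) : u @ \oo --> l ->
  (forall n, `|u n| <= B) -> `|l| <= B.
Proof.
move=> ul uB; rewrite ler_norml; apply/andP; split.
- apply: (ler_cvg_to (cvg_cst (- B)) ul).
  by near=> n; have := uB n; rewrite ler_norml => /andP[].
- apply: (ler_cvg_to ul (cvg_cst B)).
  by near=> n; have := uB n; rewrite ler_norml => /andP[].
Unshelve. all: by end_near. Qed.

Lemma half_sum_le (M : R) n : 0 <= M -> \sum_(i < n) M * 2^-1 ^+ i <= 2 * M.
Proof.
move=> M0; rewrite -mulr_sumr mulrC ler_wpM2r//.
suff -> : \sum_(i < n) (2^-1 : R) ^+ i = 2 - 2 * 2^-1 ^+ n.
  by rewrite lerBlDr lerDl mulr_ge0 ?exprn_ge0 ?invr_ge0.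
elim: n => [|n IH]; first by rewrite big_ord0 expr0; lra.
by rewrite big_ord_recr /= IH exprS; field.
Qed.

Lemma is_derive_quadratic (V : normedModType R) (F : V -> R) (y v : V) (D d K : R) :
  0 < d -> (forall h, `|h| < d -> `|F (h *: v + y) - F y - h * D| <= K * h ^+ 2) ->
  is_derive y v F D.
Proof.
move=> d0 FD.
have c : (fun h : R => h^-1 *: (F (h *: v + y) - F y) : R) @ 0^' --> D.
  have c0 : (fun h : R => h^-1 *: (F (h *: v + y) - F y) - D : R) @ 0^' --> (0 : R).
    apply: (cvg_to_0_linear (K := K) d0) => h /andP[h0 hd].
    have hn : h != 0 by rewrite -normr_gt0.
    have -> : h^-1 *: (F (h *: v + y) - F y) - D =
        h^-1 * (F (h *: v + y) - F y - h * D).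
      by rewrite mulrBr mulrA mulVf ?mul1r.
    rewrite normrM normfV mulrC ler_pdivrMr// -mulrA -expr2 -normrX.
    by rewrite [`|h ^+ 2|]ger0_norm ?sqr_ge0 ?FD.
  exact/subr_cvg0.
by constructor; [apply/cvg_ex; exists D|exact: cvg_lim].
Qed.

End GeometricBounds.

(** * From derivative bounds to convergent power series *)

Section ToSeries.
Variable R : realType.
Implicit Types (f : 'rV[R]_2 -> R) (U : set 'rV[R]_2).

Lemma near_norm_lt (d : R) : 0 < d -> \forall h \near (0 : 'rV[R]_2), `|h| < d.
Proof.
move=> d0; apply/nbhs_ballP; exists d => // y.
by rewrite -ball_normE /= sub0r normrN.
Qed.

(** With a flat jet the Taylor remainder is the function itself, and it is bounded by every power of
    a number below 1. The size allowed for [h] depends on [d] and [q] alone, which is what lets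
    vanishing propagate to limit points. *)
Lemma flat_zero U f z (d C q : R) (h : 'rV[R]_2) : 0 <= C -> 0 <= q ->
  (forall n, dbound n U U f (gevrey C q 0)) ->
  (forall y, `|y - z| < d -> U y) ->
  (forall i j, pderiv i j f z = 0) ->
  `|h| < d -> q * (`|h 0 0| + `|h 0 1|) < 1 -> f (h + z) = 0.
Proof.
move=> C0 q0 df Uz fl hd qh; apply: (zero_of_geometric (C := C) _ qh).
  by rewrite mulr_ge0 ?addr_ge0.
move=> n; have := taylor2 C0 q0 Uz (df n) hd; rewrite big1 ?subr0// => i _.
by rewrite /homogeneous_part big1// => j _; rewrite /taylor_coef fl !mul0r.
Qed.

Lemma anb_analytic2 U f x : open U -> U x -> anb U f -> analytic2_at f x.
Proof.
move=> oU Ux [C [q [C0 q0 df]]]; have [d d0 Ud] := open_box oU Ux.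
(* The radius (4q + 1)^-1 gives q(|h0| + |h1|) <= 2q|h| < 1; the summand 1 keeps it meaningful when
   q = 0. *)
have p0 : 0 < 4 * q + 1 by rewrite ltr_wpDl// mulr_ge0.
exists (taylor_coef f x); near=> h.
have hd : `|h| < d by near: h; exact: near_norm_lt.
have hq : `|h| < (4 * q + 1)^-1 by near: h; apply: near_norm_lt; rewrite invr_gt0.
set r := q * (`|h 0 0| + `|h 0 1|).
have r0 : 0 <= r by rewrite mulr_ge0 ?addr_ge0.
have r1 : r < 1.
  have h1 := coord_le_norm h 0; have h2 := coord_le_norm h 1.
  have : (4 * q + 1) * `|h| < 1 by rewrite mulrC -ltr_pdivlMr// mul1r.
  have : r <= q * (2 * `|h|) by rewrite ler_wpM2l//; lra.
  by have := normr_ge0 h; lra.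
split.
  have -> : abs_homogeneous_part (taylor_coef f x) h =
      (fun n => `|abs_homogeneous_part (taylor_coef f x) h n|).
    by apply/funext => n; rewrite ger0_norm// sumr_ge0.
  apply: (is_cvg_series_geometric (C := C) r0 r1) => n.
  rewrite /abs_homogeneous_part ger0_norm ?sumr_ge0//.
  (* The derivative bound turns the sum of the absolute values in degree n into a binomial
     expansion, term by term. *)
  rewrite /r exprMn mulrA [`|h 0 0| + _]addrC exprDn mulr_sumr; apply: ler_sum => i _.
  have li : (i <= n)%N by rewrite -ltnS.
  rewrite !normrM normfV normrM !normr_nat !normrX -[X in _ <= _ * X]mulr_natr.
  have d1 : `|pderiv i (n - i) f x| <= gevrey C q 0 n.
    have d1 : dbound 0 U U (pderiv i (n - i) f) (fun m => gevrey C q 0 (i + (n - i) + m)).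
      by apply: dbound_pderiv; exact: df.
    by have := dbound0 d1 Ux; rewrite addn0 subnKC.
  have f0 k : (k`!)%:R != 0 :> R by rewrite pnatr_eq0 -lt0n fact_gt0.
  have -> : C * q ^+ n * (`|h 0 1| ^+ (n - i) * `|h 0 0| ^+ i * 'C(n, i)%:R) =
    gevrey C q 0 n / ((i`!)%:R * ((n - i)`!)%:R) * `|h 0 0| ^+ i * `|h 0 1| ^+ (n - i).
    by rewrite /gevrey addn0 -(bin_fact li) !natrM; field; rewrite !f0.
  by do 3 rewrite ler_wpM2r ?exprn_ge0 ?invr_ge0 ?mulr_ge0//.
apply: (cvg_of_geometric (C := C) r0 r1) => n.
rewrite /series /= big_mkord distrC [x + h]addrC.
exact: taylor2 C0 q0 Ud (df n) hd.
Unshelve. all: by end_near. Qed.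

Lemma analytic1_of_bounds (f : R -> R) (y d C q : R) : 0 < d -> 0 <= C -> 0 <= q ->
  (forall k t, `|t - y| < d -> is_derive t 1 (derive1n k f) (derive1n k.+1 f t)) ->
  (forall k t, `|t - y| < d -> `|derive1n k f t| <= C * q ^+ k * (k`!)%:R) ->
  analytic1_at f y.
Proof.
move=> d0 C0 q0 df bf.
have p0 : 0 < q + 1 by rewrite ltr_wpDl.
exists (fun k => derive1n k f y / (k`!)%:R); near=> h.
have hd : `|h| < d.
  by near: h; apply/nbhs_ballP; exists d => // t; rewrite -ball_normE /= sub0r normrN.
have hq : `|h| < (q + 1)^-1.
  near: h; apply/nbhs_ballP; exists (q + 1)^-1 => /=; first by rewrite invr_gt0.
  by move=> t; rewrite -ball_normE /= sub0r normrN.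
have r1 : q * `|h| < 1.
  have : (q + 1) * `|h| < 1 by rewrite mulrC -ltr_pdivlMr// mul1r.
  by have := normr_ge0 h; lra.
apply: (cvg_of_geometric (C := C) _ r1) => [|n]; first by rewrite mulr_ge0.
pose u k t := derive1n k f (t + y).
have nt (t : R) : `|t| <= `|h| -> `|t + y - y| < d.
  by move=> th; rewrite addrK; apply: le_lt_trans hd.
have du k (t : R) : `|t| <= `|h| -> is_derive t 1 (u k) (u k.+1 t).
  move=> /nt /(df k) d1; rewrite -[u k.+1 t]mulr1.
  apply: (@is_derive1_comp _ (derive1n k f) (fun s => s + y)) => //.
  have := is_deriveD (is_derive_id t (1 : R)) (is_derive_cst y t (1 : R)).
  by rewrite addr0.
have -> : pseries (fun k => derive1n k f y / (k`!)%:R) h n =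
    \sum_(k < n) u k 0 / (k`!)%:R * h ^+ k.
  by rewrite /pseries /series /= big_mkord; apply: eq_bigr => k _; rewrite /u add0r.
rewrite distrC [y + h]addrC -[f (h + y)]/(u 0%N h).
have := @taylor1 R u h (C * q ^+ n * (n`!)%:R) n.
have f0 : (n`!)%:R != 0 :> R by rewrite pnatr_eq0 -lt0n fact_gt0.
have -> : C * q ^+ n * (n`!)%:R * `|h| ^+ n / (n`!)%:R = C * (q * `|h|) ^+ n.
  by rewrite exprMn; field.
by apply=> s sh; exact/bf/nt.
Unshelve. all: by end_near. Qed.

End ToSeries.

(** * Power series in two variables *)

Section PowerSeries.
Variable R : realType.
Implicit Types (c : nat -> nat -> R) (h x y z : 'rV[R]_2) (K q rho : R).

Definition psum c h : R := limn (series (homogeneous_part c h)).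

Definition dcoef (i : 'I_2) c (a b : nat) : R :=
  if i == 0 then a.+1%:R * c a.+1 b else b.+1%:R * c a b.+1.

Definition coef_bound K q c := forall a b, `|c a b| <= K * q ^+ (a + b).

Lemma coef_bound_ge0 K q c : coef_bound K q c -> 0 <= K.
Proof. by move=> /(_ 0%N 0%N); rewrite expr0 mulr1; apply: le_trans. Qed.

Lemma leq_sq_expn n : (n ^ 2 * n.+1 <= 8 ^ n)%N.
Proof.
have h : (n < 2 ^ n)%N by exact: ltn_expl.
have -> : (8 ^ n = (2 ^ n) ^ 2 * 2 ^ n)%N by rewrite -expnSr -expnM mulnC expnM.
by rewrite leq_mul// leq_exp2r// ltnW.
Qed.

Lemma homogeneous_part_le K q c h rho n : coef_bound K q c -> 0 <= q -> 0 <= rho ->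
  `|h| <= rho -> `|homogeneous_part c h n| <= n.+1%:R * (K * (q * rho) ^+ n).
Proof.
move=> cK q0 r0 hr; have K0 := coef_bound_ge0 cK.
apply: le_trans (ler_norm_sum _ _ _) _.
have -> : n.+1%:R * (K * (q * rho) ^+ n) = \sum_(i < n.+1) K * (q * rho) ^+ n.
  by rewrite sumr_const card_ord mulr_natl.
apply: ler_sum => i _; have li : (i <= n)%N by rewrite -ltnS.
rewrite !normrM !normrX exprMn -mulrA [K * _]mulrA.
have -> : rho ^+ n = rho ^+ i * rho ^+ (n - i) by rewrite -exprD subnKC.
apply: ler_pM; rewrite ?mulr_ge0 ?exprn_ge0//.
  by have := cK i (n - i)%N; rewrite subnKC.
by apply: ler_pM; rewrite ?exprn_ge0// lerXn2r ?nnegrE// (le_trans (coord_le_norm h _)).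
Qed.

Lemma homogeneous_part_half K q c h rho n : coef_bound K q c -> 0 <= q -> 0 <= rho ->
  16 * q * rho <= 1 -> `|h| <= rho -> `|homogeneous_part c h n| <= K * 2^-1 ^+ n.
Proof.
move=> cK q0 r0 qr hr; have K0 := coef_bound_ge0 cK.
apply: le_trans (homogeneous_part_le n cK q0 r0 hr) _.
rewrite mulrCA ler_wpM2l//.
apply: (@le_trans _ _ (2 ^+ n * (q * rho) ^+ n)).
  by rewrite ler_wpM2r ?exprn_ge0 ?mulr_ge0// -natrX ler_nat ltn_expl.
rewrite -exprMn lerXn2r ?nnegrE ?mulr_ge0 ?invr_ge0//.
have : 0 <= q * rho by rewrite mulr_ge0.
by move: qr; rewrite -mulrA; lra.
Qed.

Lemma psum_cvg K q c h rho : coef_bound K q c -> 0 <= q -> 0 <= rho ->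
  16 * q * rho <= 1 -> `|h| <= rho ->
  series (homogeneous_part c h) @ \oo --> psum c h.
Proof.
move=> cK q0 r0 qr hr; apply: normed_cvg.
apply: (@is_cvg_series_geometric _ _ K 2^-1); rewrite ?invr_ge0//.
  by rewrite invf_lt1 ?ltr1n.
by move=> n; apply: homogeneous_part_half cK q0 r0 qr hr.
Qed.

Lemma psum_le K q c h rho : coef_bound K q c -> 0 <= q -> 0 <= rho ->
  16 * q * rho <= 1 -> `|h| <= rho -> `|psum c h| <= 2 * K.
Proof.
move=> cK q0 r0 qr hr; have K0 := coef_bound_ge0 cK.
apply: (norm_lim_le (psum_cvg cK q0 r0 qr hr)) => n.
rewrite /series /= big_mkord; apply: le_trans (ler_norm_sum _ _ _) _.
apply: le_trans (half_sum_le n K0); apply: ler_sum => i _.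
exact: homogeneous_part_half cK q0 r0 qr hr.
Qed.

(** If E_i is the second order error of the i-th power, then E_(i+1) = (a + t) E_i + t^2 i a^(i-1),
    and i^2 + i <= (i + 1)^2. The factor [rho ^+ 2] avoids the exponent i - 2. *)
Lemma expr_increment_le (a t rho : R) i : `|a| <= rho -> `|a + t| <= rho ->
  `|(a + t) ^+ i - a ^+ i - t * (i%:R * a ^+ i.-1)| * rho ^+ 2 <=
    (i ^ 2)%:R * t ^+ 2 * rho ^+ i.
Proof.
move=> ar atr; have r0 : 0 <= rho by apply: le_trans ar.
elim: i => [|i IH].
  by rewrite !expr0 subrr mul0r mulr0 subr0 normr0 !mul0r.
set E := (X in `|X| * _ <= _) in IH.
have -> : (a + t) ^+ i.+1 - a ^+ i.+1 - t * (i.+1%:R * a ^+ i.+1.-1) =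
    (a + t) * E + t ^+ 2 * (i%:R * a ^+ i.-1).
  rewrite /E /=; case: i {IH E} => [|i]; first by rewrite !expr0 !expr1 /=; ring.
  by rewrite /= !exprS -natr1; ring.
have h1 : `|(a + t) * E| * rho ^+ 2 <= (i ^ 2)%:R * t ^+ 2 * rho ^+ i.+1.
  have -> : (i ^ 2)%:R * t ^+ 2 * rho ^+ i.+1 = rho * ((i ^ 2)%:R * t ^+ 2 * rho ^+ i).
    by rewrite [rho ^+ i.+1]exprS; ring.
  rewrite normrM -[X in X <= _]mulrA.
  by apply: ler_pM; rewrite ?mulr_ge0 ?exprn_ge0.
have h2 : `|t ^+ 2 * (i%:R * a ^+ i.-1)| * rho ^+ 2 <= i%:R * t ^+ 2 * rho ^+ i.+1.
  case: i {IH E h1} => [|i]; first by rewrite !mul0r mulr0 normr0 mul0r.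
  have -> : `|t ^+ 2 * (i.+1%:R * a ^+ i.+1.-1)| = t ^+ 2 * (i.+1%:R * `|a| ^+ i).
    by rewrite normrM [`|t ^+ 2|]ger0_norm ?sqr_ge0// normrM normr_nat normrX.
  have -> : i.+1%:R * t ^+ 2 * rho ^+ i.+2 = t ^+ 2 * (i.+1%:R * rho ^+ i) * rho ^+ 2.
    by rewrite -[i.+2]addn2 exprD; ring.
  rewrite ler_wpM2r ?exprn_ge0// ler_wpM2l ?sqr_ge0// ler_wpM2l//.
  by rewrite lerXn2r ?nnegrE.
apply: le_trans (ler_wpM2r (exprn_ge0 2 r0) (ler_normD _ _)) _.
rewrite mulrDl; apply: le_trans (lerD h1 h2) _.
rewrite -!mulrDl -natrD ler_wpM2r ?exprn_ge0// ler_wpM2r ?sqr_ge0// ler_nat.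
by rewrite -mulnn -[(i.+1 ^ 2)%N]mulnn mulnS mulSn; lia.
Qed.

(** Termwise differentiation through an error quadratic in [t], summed over all degrees;
    [is_derive_quadratic] then yields the derivative. *)
Lemma psum_increment0 K q c h rho (t : R) : coef_bound K q c -> 0 <= q -> 0 < rho ->
  coef_bound K q (dcoef 0 c) -> 16 * q * rho <= 1 ->
  `|h| <= rho -> `|t *: bvec 0 + h| <= rho ->
  `|psum c (t *: bvec 0 + h) - psum c h - t * psum (dcoef 0 c) h| <=
    2 * K / rho ^+ 2 * t ^+ 2.
Proof.
move=> cK q0 r0 cK' qr hr tr; have K0 := coef_bound_ge0 cK.
have r0' := ltW r0.
set h' := t *: bvec 0 + h.
have e0 : h' 0 0 = h 0 0 + t by rewrite /h' !mxE /= mulr1 addrC.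
have e1 : h' 0 1 = h 0 1 by rewrite /h' !mxE /= mulr0 add0r.
(* The derivative of the part of degree n has degree n - 1, so this series is that of [dcoef 0 c]
   shifted by one, with first term 0. *)
pose D n := \sum_(i < n.+1) c i (n - i)%N * (i%:R * h 0 0 ^+ i.-1) * h 0 1 ^+ (n - i).
have DS n : D n.+1 = homogeneous_part (dcoef 0 c) h n.
  rewrite /D big_ord_recl mul0r mulr0 mul0r add0r; apply: eq_bigr => i _.
  by rewrite lift0 subSS /dcoef eqxx /=; ring.
have D0 : D 0%N = 0 by rewrite /D big_ord1 mul0r mulr0 mul0r.
have cD : series D @ \oo --> psum (dcoef 0 c) h.
  rewrite -cvg_shiftS /=.
  have -> : (fun n => series D n.+1) = series (homogeneous_part (dcoef 0 c) h).
    apply/funext => n; rewrite /series /= big_nat_recl// D0 add0r.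
    by apply: eq_bigr => i _; rewrite DS.
  exact: psum_cvg cK' q0 r0' qr hr.
have cc := cvgB (cvgB (psum_cvg cK q0 r0' qr tr) (psum_cvg cK q0 r0' qr hr))
  (cvgM (cvg_cst t) cD).
apply: (norm_lim_le (cc _ _ _ _)) => N.
rewrite -[X in `|X| <= _]/(series (homogeneous_part c h') N -
  series (homogeneous_part c h) N - t * series D N).
rewrite /series /= !big_mkord mulr_sumr -!sumrB.
apply: le_trans (ler_norm_sum _ _ _) _.
have -> : 2 * K / rho ^+ 2 * t ^+ 2 = 2 * (K / rho ^+ 2 * t ^+ 2) by rewrite -!mulrA.
have KK : 0 <= K / rho ^+ 2 * t ^+ 2 by apply: mulr_ge0; rewrite ?sqr_ge0// divr_ge0 ?exprn_ge0.
apply: le_trans (half_sum_le N KK); apply: ler_sum => n _.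
have rr : 0 < rho ^+ 2 by rewrite exprn_gt0.
rewrite mulrAC -mulrA mulrAC ler_pdivlMr//.
have -> : homogeneous_part c h' n - homogeneous_part c h n - t * D n =
   \sum_(i < n.+1) c i (n - i)%N * h 0 1 ^+ (n - i) *
     ((h 0 0 + t) ^+ i - h 0 0 ^+ i - t * (i%:R * h 0 0 ^+ i.-1)).
  rewrite /homogeneous_part /D mulr_sumr -!sumrB; apply: eq_bigr => i _.
  by rewrite e0 e1; ring.
have r00 : `|h 0 0| <= rho by apply: le_trans (coord_le_norm h 0) hr.
have r01 : `|h 0 1| <= rho by apply: le_trans (coord_le_norm h 1) hr.
have r02 : `|h 0 0 + t| <= rho by rewrite -e0; apply: le_trans (coord_le_norm h' 0) tr.
apply: le_trans (ler_wpM2r (ltW rr) (ler_norm_sum _ _ _)) _.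
rewrite mulr_suml.
apply: (@le_trans _ _ (\sum_(i < n.+1) K * (q * rho) ^+ n * ((n ^ 2)%:R * t ^+ 2))).
  apply: ler_sum => i _; have li : (i <= n)%N by rewrite -ltnS.
  rewrite normrM -mulrA.
  have := expr_increment_le i r00 r02.
  set E := (X in `|X| * _ <= _); move=> hE.
  have -> : K * (q * rho) ^+ n * ((n ^ 2)%:R * t ^+ 2) =
    (K * q ^+ n * rho ^+ (n - i)) * ((n ^ 2)%:R * t ^+ 2 * rho ^+ i).
    have -> : (q * rho) ^+ n = q ^+ n * (rho ^+ (n - i) * rho ^+ i).
      by rewrite exprMn -exprD subnK.
    by ring.
  apply: ler_pM; rewrite ?mulr_ge0 ?exprn_ge0//.
    rewrite normrM; apply: ler_pM => //.
      by have := cK i (n - i)%N; rewrite subnKC.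
    by rewrite normrX lerXn2r ?nnegrE.
  apply: le_trans hE _; rewrite ler_wpM2r ?exprn_ge0// ler_wpM2r ?sqr_ge0//.
  by rewrite ler_nat leq_exp2r.
rewrite sumr_const card_ord -[X in X <= _]mulr_natr.
have -> : K * (q * rho) ^+ n * ((n ^ 2)%:R * t ^+ 2) * n.+1%:R =
   K * t ^+ 2 * ((n ^ 2 * n.+1)%:R * (q * rho) ^+ n) by rewrite natrM; ring.
have -> : K * (2^-1 ^+ n * t ^+ 2) = K * t ^+ 2 * 2^-1 ^+ n by ring.
apply: ler_wpM2l; first by apply: mulr_ge0; rewrite ?sqr_ge0.
(* The factor n^2 comes from the second order errors and n + 1 from the number of monomials; 8^n
   absorbs both, and [16 * q * rho <= 1] leaves 2^-n. *)
apply: (@le_trans _ _ (8 ^+ n * (q * rho) ^+ n)).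
  by rewrite ler_wpM2r ?exprn_ge0 ?mulr_ge0// -natrX ler_nat leq_sq_expn.
rewrite -exprMn lerXn2r ?nnegrE ?mulr_ge0 ?invr_ge0//.
have : 0 <= q * rho by rewrite mulr_ge0.
by move: qr; rewrite -mulrA; lra.
Qed.

Definition swap_vec h : 'rV[R]_2 := h 0 1 *: bvec 0 + h 0 0 *: bvec 1.
Definition swap_coef c (a b : nat) : R := c b a.

Lemma psum_swap c h : psum c h = psum (swap_coef c) (swap_vec h).
Proof.
rewrite /psum; have -> // : homogeneous_part c h =
  homogeneous_part (swap_coef c) (swap_vec h).
apply/funext => n.
rewrite /homogeneous_part /swap_vec !comb2E (reindex_inj rev_ord_inj) /=.
apply: eq_bigr => i _; have li : (i <= n)%N by rewrite -ltnS.
by rewrite subSS subKn// /swap_coef mulrAC.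
Qed.

Lemma norm_swap_vec h : `|swap_vec h| = `|h|.
Proof.
have e v : `|swap_vec v| <= `|v| by rewrite norm_le2 /swap_vec !comb2E !coord_le_norm.
have k : swap_vec (swap_vec h) = h by rewrite {1}/swap_vec !comb2E -decomp2.
by apply/eqP; rewrite eq_le e -{1}k e.
Qed.

Lemma psum_increment K q c h rho (t : R) i : coef_bound K q c -> 0 <= q -> 0 < rho ->
  coef_bound K q (dcoef i c) -> 16 * q * rho <= 1 ->
  `|h| <= rho -> `|t *: bvec i + h| <= rho ->
  `|psum c (t *: bvec i + h) - psum c h - t * psum (dcoef i c) h| <=
    2 * K / rho ^+ 2 * t ^+ 2.
Proof.
case: (I2P i) => -> cK q0 r0 cK' qr hr tr; first exact: (psum_increment0 cK q0 r0 cK' qr hr tr).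
have sw (g : nat -> nat -> R) : coef_bound K q g -> coef_bound K q (swap_coef g).
  by move=> gK a b; rewrite /swap_coef addnC.
have e1 : swap_vec (t *: bvec 1 + h) = t *: bvec 0 + swap_vec h.
  rewrite /swap_vec !mxE /= mulr1 mulr0 add0r scalerDl addrA; congr (_ + _).
have e2 : swap_coef (dcoef 1 c) = dcoef 0 (swap_coef c) by [].
rewrite !(psum_swap _ h) (psum_swap c) e1 e2.
apply: (psum_increment0 (sw _ cK) q0 r0) => //; rewrite ?norm_swap_vec//.
  exact: sw cK'.
by rewrite -e1 norm_swap_vec.
Qed.

(** The growth of the coefficients after [m] formal derivatives of a series with geometric
    coefficients. Differentiation keeps [q] exactly, so the radius of convergence does not shrink
    with the number of derivatives. *)
Definition coef_class K q (m : nat) c :=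
  forall a b, `|c a b| <= K * q ^+ (a + b) * ((a + b + m)`!)%:R / ((a + b)`!)%:R.

Lemma coef_class0 K q c : coef_bound K q c -> coef_class K q 0 c.
Proof.
move=> cK a b; rewrite addn0 mulfK; first exact: cK.
by rewrite pnatr_eq0 -lt0n fact_gt0.
Qed.

(** (n + m)!/n! is m! times a binomial coefficient, hence at most m! 2^(n+m): the ratio doubles
    once, whatever [m]. This turns the threshold 16 into the 32 of the lemmas below. *)
Lemma coef_class_bound K q m c : 0 <= K -> 0 <= q -> coef_class K q m c ->
  coef_bound (K * (m`!)%:R * 2 ^+ m) (2 * q) c.
Proof.
move=> K0 q0 cK a b; apply: le_trans (cK a b) _; set n := (a + b)%N.
have f0 k : (k`!)%:R != 0 :> R by rewrite pnatr_eq0 -lt0n fact_gt0.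
have -> : K * q ^+ n * ((n + m)`!)%:R / (n`!)%:R =
    K * (m`!)%:R * q ^+ n * ('C(n + m, m))%:R.
  have mn : (m <= n + m)%N by rewrite leq_addl.
  rewrite -(bin_fact mn) !natrM addnK; field; exact: f0.
have -> : K * (m`!)%:R * 2 ^+ m * (2 * q) ^+ n = K * (m`!)%:R * q ^+ n * 2 ^+ (n + m).
  by rewrite exprMn exprD; ring.
rewrite ler_wpM2l ?mulr_ge0 ?exprn_ge0// -natrX ler_nat.
have := @Pascal 1 1 (n + m); rewrite addn1 => ->.
rewrite (bigD1 (inord m)) //= inordK ?ltnS ?leq_addl//.
by rewrite !exp1n !muln1 leq_addr.
Qed.

Lemma coef_class_dcoef K q m c i : 0 <= K -> 0 <= q -> coef_class K q m c ->
  coef_class (K * q) q m.+1 (dcoef i c).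
Proof.
move=> K0 q0 cK a b.
have f0 k : (k`!)%:R != 0 :> R by rewrite pnatr_eq0 -lt0n fact_gt0.
have key (x : nat) (v : R) : `|v| <= K * q ^+ (a + b).+1 *
    (((a + b).+1 + m)`!)%:R / ((a + b).+1`!)%:R -> (x <= a + b)%N ->
    `|x.+1%:R * v| <= K * q * q ^+ (a + b) * ((a + b + m.+1)`!)%:R / ((a + b)`!)%:R.
  move=> hv xl; rewrite normrM normr_nat.
  apply: (@le_trans _ _ ((a + b).+1%:R * (K * q ^+ (a + b).+1 *
    (((a + b).+1 + m)`!)%:R / ((a + b).+1`!)%:R))).
    by apply: ler_pM => //; rewrite ler_nat ltnS.
  rewrite le_eqVlt; apply/orP; left; apply/eqP.
  rewrite addSnnS exprS [(a + b).+1`!]factS natrM; field.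
  by rewrite f0 /= -natrD -(natrD _ 1) pnatr_eq0.
rewrite /dcoef; case: ifP => _.
  by apply: key; [rewrite -addSn; exact: cK|exact: leq_addr].
by apply: key; [rewrite -addnS; exact: cK|exact: leq_addl].
Qed.

Lemma psum_derive K q m c x rho : 0 <= K -> 0 <= q -> 0 < rho -> 32 * q * rho <= 1 ->
  coef_class K q m c ->
  [/\ forall y, box x rho y -> `|psum c (y - x)| <= 2 * (K * (m`!)%:R * 2 ^+ m),
      forall i y, box x rho y ->
        is_derive y (bvec i) (fun y => psum c (y - x)) (psum (dcoef i c) (y - x)) &
      forall y, box x rho y -> {for y, continuous (fun y => psum c (y - x))}].
Proof.
move=> K0 q0 r0 qr cK; have oU := @box_open R x rho.
have q20 : 0 <= 2 * q by rewrite mulr_ge0.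
have qr' : 16 * (2 * q) * rho <= 1 by rewrite mulrA -natrM.
have Kq m' K' : 0 <= K' -> 0 <= K' * (m'`!)%:R * 2 ^+ m'.
  by move=> K'0; rewrite !mulr_ge0 ?exprn_ge0.
have cb := coef_class_bound K0 q0 cK.
have Kq0 : 0 <= K * q by rewrite mulr_ge0.
have cb' i := coef_class_bound Kq0 q0 (coef_class_dcoef i K0 q0 cK).
(* [psum_increment] requires one constant for the coefficients and for their formal derivatives. *)
pose K2 := K * (m`!)%:R * 2 ^+ m + K * q * (m.+1`!)%:R * 2 ^+ m.+1.
have cK2 : coef_bound K2 (2 * q) c.
  by move=> a b; apply: le_trans (cb a b) _; rewrite ler_wpM2r ?exprn_ge0// lerDl Kq.
have cK2' i : coef_bound K2 (2 * q) (dcoef i c).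
  by move=> a b; apply: le_trans (cb' i a b) _; rewrite ler_wpM2r ?exprn_ge0// lerDr Kq.
have ds i y : box x rho y ->
    is_derive y (bvec i) (fun y => psum c (y - x)) (psum (dcoef i c) (y - x)).
  move=> yx; have d0 : 0 < rho - `|y - x| by rewrite subr_gt0.
  apply: (is_derive_quadratic (K := 2 * K2 / rho ^+ 2) d0) => t td.
  rewrite -[t *: bvec i + y - x]addrA.
  apply: (psum_increment cK2 q20 r0 (cK2' i) qr' (ltW yx)).
  by rewrite (le_trans (ler_normD _ _))// normrZ norm_bvec mulr1 -lerBrDr ltW.
split=> [y yx||] //; first exact: psum_le cb q20 (ltW r0) qr' (ltW yx).
apply: (continuous_of_pd (K := 2 * K2) oU) => i y yx; first by case: (ds i y yx).
rewrite /pd; case: (ds i y yx) => _ ->.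
exact: psum_le (cK2' i) q20 (ltW r0) qr' (ltW yx).
Qed.

Lemma psum_dbound n K q m c x rho : 0 <= K -> 0 <= q -> 0 < rho -> 32 * q * rho <= 1 ->
  coef_class K q m c ->
  dbound n (box x rho) (box x rho) (fun y => psum c (y - x))
    (fun k => 2 * (K * q ^+ k * ((m + k)`!)%:R * 2 ^+ (m + k))).
Proof.
move=> K0 q0 r0 qr; have oU := @box_open R x rho.
elim: n K m c K0 => [|n IH] K m c K0 cK;
  have [bd ds ct] := psum_derive x K0 q0 r0 qr cK;
  (split; [exact: ct|by move=> z /bd; rewrite expr0 mulr1 addn0|]); first exact: I.
move=> i; split; first by move=> z /(ds i) [].
apply: (@dbound_ext _ _ _ _ (fun y => psum (dcoef i c) (y - x))) => //.
  by move=> z /(ds i) [_]; rewrite /pd => ->.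
have Kq0 : 0 <= K * q by rewrite mulr_ge0.
apply: dbound_le (IH _ _ _ Kq0 (coef_class_dcoef i K0 q0 cK)) _ => k _.
by rewrite !addSnnS [q ^+ k.+1]exprS [K * (q * _)]mulrA.
Qed.

Lemma psum_anb K q c x rho : 0 <= q -> 0 < rho -> 32 * q * rho <= 1 ->
  coef_bound K q c -> forall n,
  dbound n (box x rho) (box x rho) (fun y => psum c (y - x)) (gevrey (2 * K) (2 * q) 0).
Proof.
move=> q0 r0 qr cK n; have K0 := coef_bound_ge0 cK.
apply: dbound_le (psum_dbound n x K0 q0 r0 qr (coef_class0 cK)) _ => k _.
by rewrite /gevrey add0n addn0 exprMn le_eqVlt; apply/orP; left; apply/eqP; ring.
Qed.

(** At the diagonal point (d, d) each |c a b| d^(a+b) is one summand of the absolute homogeneous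
    part of degree a + b, and the terms of a convergent series are bounded. *)
Lemma abs_cvg_coef_bound c h (d : R) : 0 < d -> h = d *: bvec 0 + d *: bvec 1 ->
  cvgn (series (abs_homogeneous_part c h)) -> exists K, coef_bound K d^-1 c.
Proof.
move=> d0 -> cv; have [M M0 hM] : exists2 M, 0 < M &
    forall n, `|abs_homogeneous_part c (d *: bvec 0 + d *: bvec 1) n| <= M.
  have /pinfty_ex_gt0[M M0 hM] := cvg_series_bounded cv.
  by exists M => // n; apply: hM.
exists M => a b; rewrite exprVn ler_pdivlMr ?exprn_gt0//.
apply: le_trans (hM (a + b)%N); apply: le_trans (ler_norm _).
have la : (a < (a + b).+1)%N by rewrite ltnS leq_addr.
rewrite /abs_homogeneous_part (bigD1 (Ordinal la)) //= !comb2E addKn.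
rewrite -[leLHS]addr0 lerD ?sumr_ge0// -mulrA -exprD normrM.
by rewrite [`|d ^+ _|]ger0_norm ?exprn_ge0 ?(ltW d0).
Qed.

Lemma analytic2_anb f x : analytic2_at f x ->
  exists2 d : R, 0 < d & anb (box x d) f.
Proof.
move=> [c /nbhs_ballP [e /= e0 he]].
have he' h : `|h| < e -> cvgn (series (abs_homogeneous_part c h)) /\
    series (homogeneous_part c h) @ \oo --> f (x + h).
  by move=> hh; apply: he; rewrite -ball_normE /= sub0r normrN.
have d0 : 0 < e / 2 by rewrite divr_gt0.
have [|cv _] := he' (e / 2 *: bvec 0 + e / 2 *: bvec 1).
  apply: (@le_lt_trans _ _ (e / 2)).
    by rewrite norm_le2 !comb2E ger0_norm ?lexx ?ltW.
  by rewrite ltr_pdivrMr// ltr_pMr// ltr1n.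
have [K cK] := abs_cvg_coef_bound d0 erefl cv.
set q := (e / 2)^-1 in cK; have q0 : 0 < q by rewrite invr_gt0.
pose rho := (32 * q)^-1; have r0 : 0 < rho by rewrite invr_gt0 mulr_gt0.
have qr : 32 * q * rho <= 1 by rewrite /rho divff// mulf_neq0// gt_eqF.
have re : rho < e.
  by rewrite /rho invfM /q invrK; lra.
exists rho => //; apply: (@anb_ext _ _ (fun y => psum c (y - x))).
- exact: box_open.
- move=> z zx; have [_] := he' (z - x) (lt_trans zx re).
  by rewrite [x + _]addrC subrK => /cvg_lim; apply.
- exists (2 * K), (2 * q); rewrite !mulr_ge0 ?(ltW q0) ?(coef_bound_ge0 cK)//.
  by split=> //; apply: psum_anb => //; exact: ltW.
Qed.

End PowerSeries.

(** * Analytic functions of two variables *)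

Section Analytic.
Variable R : realType.
Implicit Types (f g : 'rV[R]_2 -> R) (U Bt : set 'rV[R]_2) (x y z : 'rV[R]_2).

Lemma box_sub x y (d e : R) : `|y - x| + e <= d -> box y e `<=` box x d.
Proof.
move=> yd z zy; rewrite /box /=; have -> : z - x = (z - y) + (y - x) by rewrite addrA subrK.
apply: le_lt_trans (ler_normD _ _) _; apply: lt_le_trans yd.
by rewrite addrC ltrD2l.
Qed.

Lemma box_le x (d e : R) : e <= d -> box x e `<=` box x d.
Proof. by move=> ed; apply: box_sub; rewrite subrr normr0 add0r. Qed.

(** The working form of analyticity at a point, equivalent to [analytic2_at]: closure under the
    algebraic operations and derivatives comes from the estimates of [anb]. *)
Definition anl f x := exists2 d : R, 0 < d & anb (box x d) f.

Lemma anl_analytic2 f x : anl f x -> analytic2_at f x.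
Proof.
by move=> [d d0]; apply: anb_analytic2; [exact: box_open|exact: box_center].
Qed.

Lemma analytic2_anl f x : analytic2_at f x -> anl f x.
Proof. by move=> /analytic2_anb. Qed.

Lemma anb_anl U f x : open U -> U x -> anb U f -> anl f x.
Proof.
move=> oU Ux af; have [d d0 dU] := open_box oU Ux.
by exists d => //; apply: anb_sub af => y /dU.
Qed.

Lemma anl_near f x : anl f x -> exists2 d : R, 0 < d & forall y, box x d y -> anl f y.
Proof.
by move=> [d d0 af]; exists d => // y yx; apply: anb_anl af => //; exact: box_open.
Qed.

Lemma anl2 f g x : anl f x -> anl g x ->
  exists2 d : R, 0 < d & anb (box x d) f /\ anb (box x d) g.
Proof.
move=> [d d0 af] [e e0 ag]; exists (Num.min d e); first by rewrite lt_min d0.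
split; [apply: anb_sub af|apply: anb_sub ag]; apply: box_le.
  by rewrite ge_min lexx.
by rewrite ge_min lexx orbT.
Qed.

Lemma anlD f g x : anl f x -> anl g x -> anl (f \+ g) x.
Proof.
move=> af ag; have [d d0 [bf bg]] := anl2 af ag.
by exists d => //; apply: anbD => //; exact: box_open.
Qed.

Lemma anlM f g x : anl f x -> anl g x -> anl (f \* g) x.
Proof.
move=> af ag; have [d d0 [bf bg]] := anl2 af ag.
by exists d => //; apply: anbM => //; exact: box_open.
Qed.

Lemma anl_pd f i x : anl f x -> anl (pd i f) x.
Proof. by move=> [d d0 af]; exists d => //; apply: anb_pd => //; exact: box_open. Qed.

Lemma anl_pderiv f i j x : anl f x -> anl (pderiv i j f) x.
Proof.
move=> af; rewrite pderivE.
have : anl (iter j (pd 1) f) x by elim: j => [|j IH] //=; exact: anl_pd.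
by elim: i => [|i IH] //= h; apply: anl_pd; exact: IH.
Qed.

Lemma anl_cst (a : R) x : anl (fun=> a) x.
Proof. by exists 1 => //; exact: anb_cst. Qed.

Lemma anl_continuous f x : anl f x -> {for x, continuous f}.
Proof. by move=> [d d0 af]; apply: (anb_continuous af); exact: box_center. Qed.

Lemma anl_derivable f x i : anl f x -> derivable f x (bvec i).
Proof. by move=> [d d0 af]; exact: (@anb_derivable _ _ _ i x af (box_center x d0)). Qed.

Lemma anl_ext f g x (d : R) : 0 < d -> (forall y, box x d y -> f y = g y) ->
  anl f x -> anl g x.
Proof.
move=> d0 fg [e e0 af]; exists (Num.min d e); first by rewrite lt_min d0.
apply: (anb_ext (@box_open _ _ _) _ (anb_sub _ af)) => z /=.
  by move=> zx; apply: fg; apply: box_le zx; rewrite ge_min lexx.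
by apply: box_le; rewrite ge_min lexx orbT.
Qed.

Lemma anlN f x : anl f x -> anl (fun y => - f y) x.
Proof.
move=> af; apply: (anl_ext ltr01 _ (anlM (anl_cst (-1) x) af)) => y _ /=.
by rewrite mulN1r.
Qed.

Lemma anl_sum (I : Type) (r : seq I) (P : pred I) (F : I -> 'rV[R]_2 -> R) x :
  (forall i, anl (F i) x) -> anl (fun z => \sum_(i <- r | P i) F i z) x.
Proof.
move=> aF; elim: r => [|i r IH].
  by apply: (anl_ext ltr01 _ (anl_cst 0 x)) => z _; rewrite big_nil.
case Pi : (P i); last first.
  by apply: (anl_ext ltr01 _ IH) => z _; rewrite big_cons Pi.
by apply: (anl_ext ltr01 _ (anlD (aF i) IH)) => z _; rewrite big_cons Pi.
Qed.

Lemma anl_prod (I : Type) (r : seq I) (P : pred I) (F : I -> 'rV[R]_2 -> R) x :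
  (forall i, P i -> anl (F i) x) -> anl (fun z => \prod_(i <- r | P i) F i z) x.
Proof.
move=> aF; elim: r => [|i r IH].
  by apply: (anl_ext ltr01 _ (anl_cst 1 x)) => z _; rewrite big_nil.
case Pi : (P i); last first.
  by apply: (anl_ext ltr01 _ IH) => z _; rewrite big_cons Pi.
by apply: (anl_ext ltr01 _ (anlM (aF i Pi) IH)) => z _; rewrite big_cons Pi.
Qed.

Lemma anl_det n (A : 'rV[R]_2 -> 'M[R]_n) x :
  (forall i j, anl (fun y => A y i j) x) -> anl (fun y => \det (A y)) x.
Proof.
move=> aA; rewrite /determinant; apply: anl_sum => s.
by apply: (anlM (anl_cst _ x)); apply: anl_prod => i _; exact: aA.
Qed.

Lemma anl_adjugate n (A : 'rV[R]_2 -> 'M[R]_n) x i j :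
  (forall i j, anl (fun y => A y i j) x) -> anl (fun y => (\adj (A y)) i j) x.
Proof.
move=> aA.
apply: (anl_ext ltr01 (f := fun y => (-1) ^+ (j + i) * \det (row' j (col' i (A y))))).
  by move=> y _; rewrite mxE.
apply: (anlM (anl_cst _ x)); apply: anl_det => k l.
by apply: (anl_ext ltr01 _ (aA (lift j k) (lift i l))) => y _; rewrite !mxE.
Qed.

Lemma anl_coord i (a : R) x : anl (fun y => y 0 i - a) x.
Proof.
have d1 y k : is_derive y (bvec k) (fun y : 'rV[R]_2 => y 0 i - a) (k == i)%:R.
  apply: (@is_derive_quadratic _ _ _ _ _ _ 1 0) => // h _.
  rewrite mul0r normr_le0 !mxE eqxx /= [i == k]eq_sym; apply/eqP; ring.
pose f := fun y : 'rV[R]_2 => y 0 i - a.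
have pdf k : pd k f = fun=> (k == i)%:R.
  by apply/funext => y; rewrite /pd; case: (d1 y k).
exists 1 => //; have oU := @box_open R x 1.
pose C : R := `|x 0 i| + 2 + `|a|.
have C2 : 2 <= C.
  by rewrite /C; have := normr_ge0 a; have := normr_ge0 (x 0 i); lra.
have C0 : 0 <= C by apply: le_trans C2.
exists C, 1; split=> // n.
have cf : forall z, box x 1 z -> {for z, continuous f}.
  apply: (continuous_of_pd (K := 1) oU) => k y _; first by case: (d1 y k).
  by rewrite pdf; case: (k == i); rewrite ?normr1 ?normr0.
have bf : forall z, box x 1 z -> `|f z| <= gevrey C 1 0 0.
  move=> z zx; rewrite /gevrey expr0 !mulr1 /f.
  have h1 : `|z 0 i - x 0 i| <= 1.
    have -> : z 0 i - x 0 i = (z - x) 0 i by rewrite !mxE.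
    by apply: le_trans (coord_le_norm _ i) _; exact: ltW.
  have -> : z 0 i - a = (z 0 i - x 0 i) + (x 0 i - a) by ring.
  apply: le_trans (ler_normD _ _) _.
  have h2 := ler_normB (x 0 i) a; rewrite /C; lra.
case: n => [|n]; (split; [exact: cf|exact: bf|]); first exact: I.
move=> k; split; first by move=> z _; case: (d1 z k).
rewrite pdf; apply: dbound_cst => [|m]; last by rewrite gevrey_ge0.
by rewrite /gevrey expr1 !mulr1; case: (k == i); rewrite ?normr1 ?normr0; lra.
Qed.

Lemma iter_pd_eq U f g i k : open U -> (forall z, U z -> f z = g z) ->
  forall z, U z -> iter k (pd i) f z = iter k (pd i) g z.
Proof. by move=> oU fg; elim: k => [|k IH] //= z Uz; exact: pd_eq oU IH z Uz. Qed.

Lemma pderiv_eq U f g i j : open U -> (forall z, U z -> f z = g z) ->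
  forall z, U z -> pderiv i j f z = pderiv i j g z.
Proof. by move=> oU fg; apply: (iter_pd_eq _ _ oU); exact: iter_pd_eq. Qed.

Lemma pderiv0 i j z : pderiv i j (fun=> 0 : R) z = 0.
Proof.
have h k l : iter k (pd l) (fun=> 0 : R) = fun=> 0.
  by elim: k => [|k IH] //=; rewrite IH pd_cst.
by rewrite pderivE !h.
Qed.

Lemma anl_flat_zero f x : anl f x -> (forall i j, pderiv i j f x = 0) ->
  exists2 d : R, 0 < d & forall y, box x d y -> f y = 0.
Proof.
move=> [d d0 [C [q [C0 q0 df]]]] fl.
have p0 : 0 < 4 * q + 1 by rewrite ltr_wpDl// mulr_ge0.
exists (Num.min d (4 * q + 1)^-1); first by rewrite lt_min d0 invr_gt0.
move=> y; rewrite /box /= lt_min => /andP[yd yq]; rewrite -(subrK x y).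
apply: (flat_zero C0 q0 df _ fl yd); first by [].
have h1 := coord_le_norm (y - x) 0; have h2 := coord_le_norm (y - x) 1.
have : (4 * q + 1) * `|y - x| < 1 by rewrite mulrC -ltr_pdivlMr// mul1r.
have h3 := normr_ge0 (y - x).
have : q * (`|(y - x) 0 0| + `|(y - x) 0 1|) <= q * (2 * `|y - x|).
  by rewrite ler_wpM2l//; lra.
have := mulr_ge0 q0 h3; lra.
Qed.

(** The set of points near which [f] vanishes is nonempty, open and relatively closed in the
    connected set [Bt]. Closedness rests on the uniformity of the radius in [flat_zero]. *)
Lemma identity_theorem Bt U f : open Bt -> connected Bt ->
  (forall x, Bt x -> anl f x) -> open U -> U !=set0 -> U `<=` Bt ->
  (forall x, U x -> f x = 0) -> forall x, Bt x -> f x = 0.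
Proof.
move=> oB cB af oU [u Uu] UB fU.
pose C1 := [set x | exists2 d : R, 0 < d & forall y, box x d y -> f y = 0].
pose Z := Bt `&` C1.
have oC1 : open C1.
  rewrite openE => x [d d0 hd]; apply/nbhs_ballP; exists (d / 2) => /=.
    by rewrite divr_gt0.
  move=> y; rewrite -ball_normE /= distrC => yx; exists (d / 2); first by rewrite divr_gt0.
  by move=> t ty; apply: hd; apply: box_sub ty; lra.
have ZE : Z = Bt.
  apply: cB.
  - exists u; split; first exact: UB.
    have [d d0 hd] := open_box oU Uu; exists d => // y /hd; exact: fU.
  - by exists C1.
  - exists (closure Z); first exact: closed_closure.
    apply/seteqP; split=> x [Bx Zx]; split=> //; first exact: subset_closure.
    have [d d0 [C [q [C0 q0 df]]]] := af x Bx.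
    have p0 : 0 < 16 * q + 1 by rewrite ltr_wpDl// mulr_ge0.
    (* Chosen so that the expansion at any point [z] of the box of radius [e] about [x], with the
       constants valid near [x], reaches the whole of that box: its points are within 2e of [z], and
       q times the sum of the coordinates of the increment is at most 4qe < 1. *)
    pose e := Num.min (d / 4) (16 * q + 1)^-1.
    have e0 : 0 < e by rewrite lt_min divr_gt0//= invr_gt0.
    have ed : e <= d / 4 by rewrite ge_min lexx.
    have eq : e <= (16 * q + 1)^-1 by rewrite ge_min lexx orbT.
    have [|z [[Bz [r r0 hr]] zx]] := Zx (box x e).
      by apply: open_nbhs_nbhs; split; [exact: box_open|exact: box_center].
    have fl i j : pderiv i j f z = 0.
      rewrite (pderiv_eq i j (@box_open _ z r) hr) ?pderiv0//; exact: box_center.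
    have zb y : `|y - z| < d / 2 -> box x d y.
      move=> yz; apply: (@box_sub x z d (d / 2)) => //.
      by have := ltW zx; rewrite /box /=; lra.
    exists e => // y yx; rewrite -(subrK z y).
    have yz : `|y - z| < 2 * e.
      have -> : y - z = (y - x) - (z - x) by rewrite opprB addrA subrK.
      apply: le_lt_trans (ler_normB _ _) _; rewrite mulrDl !mul1r ltrD//.
    apply: (flat_zero C0 q0 df zb fl); first by lra.
    have h1 := coord_le_norm (y - z) 0; have h2 := coord_le_norm (y - z) 1.
    have h3 : (16 * q + 1) * e <= 1 by rewrite mulrC -ler_pdivlMr// mul1r.
    have h4 : q * (`|(y - z) 0 0| + `|(y - z) 0 1|) <= q * (4 * e).
      by rewrite ler_wpM2l//; lra.
    have := mulr_ge0 q0 (ltW e0); lra.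
move=> x; rewrite -ZE => -[_ [d d0 hd]]; apply: hd; exact: box_center.
Qed.

Lemma nonzero_somewhere Bt U f : open Bt -> connected Bt ->
  (forall x, Bt x -> anl f x) -> ~ (forall x, Bt x -> f x = 0) ->
  open U -> U !=set0 -> U `<=` Bt -> exists2 x, U x & f x != 0.
Proof.
move=> oB cB af nf oU U0 UB; apply: contrapT => h; apply: nf.
apply: (identity_theorem oB cB af oU U0 UB) => x Ux.
by apply/eqP; apply: contrapT => /negP fx; apply: h; exists x.
Qed.

(** Analytic functions on a connected open set form an integral domain: near a point where [f] is
    nonzero [g] would vanish, hence everywhere. *)
Lemma mul_not_zero Bt f g : open Bt -> connected Bt ->
  (forall x, Bt x -> anl f x) -> (forall x, Bt x -> anl g x) ->
  ~ (forall x, Bt x -> f x = 0) -> ~ (forall x, Bt x -> g x = 0) ->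
  ~ (forall x, Bt x -> f x * g x = 0).
Proof.
move=> oB cB af ag nf ng h.
have [x Bx fx] : exists2 x, Bt x & f x != 0.
  apply: contrapT => k; apply: nf => x Bx; apply/eqP; apply: contrapT => /negP fx.
  by apply: k; exists x.
have fp : 0 < `|f x| by rewrite normr_gt0.
have [d d0 hd] := (continuous_boxP _ _).1 (anl_continuous (af x Bx)) _ fp.
have [e e0 he] := open_box oB Bx.
apply: ng; apply: (identity_theorem oB cB ag (@box_open _ x (Num.min d e))).
- by exists x; apply: box_center; rewrite lt_min d0.
- by move=> y; rewrite /box /= lt_min => /andP[_ /he].
move=> y; rewrite /box /= lt_min => /andP[yd ye].
have fy : f y != 0.
  apply/eqP => fy0; have := hd y yd.
  by rewrite fy0 sub0r normrN ltxx.
by have /eqP := h y (he y ye); rewrite mulf_eq0 (negPf fy) => /eqP.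
Qed.

End Analytic.

(** * Functions of one variable *)

Section OneVariable.
Variable R : realType.
Implicit Types (f g : R -> R) (y t : R).

Definition smooth_at f y := exists2 d : R, 0 < d &
  forall k t, `|t - y| < d -> derivable (derive1n k f) t 1.

Lemma near_interval y (d : R) : 0 < d -> \forall t \near y, `|t - y| < d.
Proof.
by move=> d0; apply/nbhs_ballP; exists d => // t; rewrite -ball_normE /= distrC.
Qed.

Lemma near_interval_in y t (d : R) (P : R -> Prop) : `|t - y| < d ->
  (forall s, `|s - y| < d -> P s) -> \forall s \near t, P s.
Proof.
move=> td h; have d0 : 0 < d - `|t - y| by rewrite subr_gt0.
apply: filterS (near_interval t d0) => s st; apply: h.
have -> : s - y = (s - t) + (t - y) by rewrite addrA subrK.
by apply: le_lt_trans (ler_normD _ _) _; rewrite -ltrBrDr.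
Qed.

Lemma derive1n_eq f g y (d : R) k : (forall t, `|t - y| < d -> f t = g t) ->
  forall t, `|t - y| < d -> derive1n k f t = derive1n k g t.
Proof.
move=> fg; elim: k => [|k IH] t td; first exact: fg.
rewrite !derive1nS !derive1E; apply: near_eq_derive.
exact: near_interval_in td IH.
Qed.

Lemma smooth_at_eq f g y (d : R) : 0 < d -> (forall t, `|t - y| < d -> f t = g t) ->
  smooth_at f y -> smooth_at g y.
Proof.
move=> d0 fg [e e0 df]; exists (Num.min d e); first by rewrite lt_min d0.
move=> k t; rewrite lt_min => /andP[td te].
apply: near_eq_derivable (df k t te).
apply: (near_interval_in td) => s sd; exact: derive1n_eq fg s sd.
Qed.

Lemma smooth_at_class_C M f y : smooth_at f y -> class_C_near M f y.
Proof.
move=> [d d0 df]; apply: filterS (near_interval y d0) => t td; split=> k _.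
  exact: df.
by apply/differentiable_continuous/derivable1_diffP; exact: df.
Qed.

Lemma derive1n_horner (p : {poly R}) k : derive1n k (horner p) = horner (derivn k p).
Proof.
elim: k => [|k IH]; first by rewrite derivn0.
by rewrite derive1nS IH derivnS derivE.
Qed.

Lemma smooth_at_horner (p : {poly R}) y : smooth_at (horner p) y.
Proof. by exists 1 => // k t _; rewrite derive1n_horner; exact: derivable_horner. Qed.

(** Realises an arbitrary finite jet at [y] by a smooth function. *)
Definition jet_poly (c : nat -> R) (N : nat) y : {poly R} :=
  (\poly_(k < N.+1) (c k / (k`!)%:R)) \Po ('X - y%:P).

Lemma derivn_comp_XsubC (p : {poly R}) y k :
  derivn k (p \Po ('X - y%:P)) = derivn k p \Po ('X - y%:P).
Proof.
elim: k => [|k IH]; first by rewrite !derivn0.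
by rewrite !derivnS IH deriv_comp derivXsubC mulr1.
Qed.

Lemma derive1n_jet_poly (c : nat -> R) N y k : (k <= N)%N ->
  derive1n k (horner (jet_poly c N y)) y = c k.
Proof.
move=> kN; rewrite derive1n_horner /jet_poly derivn_comp_XsubC horner_comp.
rewrite hornerXsubC subrr horner_coef0 coef_derivn addn0 ffactnn coef_poly.
by rewrite ltnS kN -[LHS]mulr_natr divfK// pnatr_eq0 -lt0n fact_gt0.
Qed.

(** A series in one variable is read as one in two variables independent of the second, so that the
    estimates for plane series apply. *)
Definition coef1 (c : nat -> R) (a b : nat) : R := if b == 0%N then c a else 0.

Definition psum1 (c : nat -> R) y t : R := psum (coef1 c) ((t - y) *: bvec 0).

Lemma homogeneous_part_coef1 (c : nat -> R) (h : R) n :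
  homogeneous_part (coef1 c) (h *: bvec 0) n = c n * h ^+ n.
Proof.
have e0 : (h *: bvec 0 : 'rV[R]_2) 0 0 = h by rewrite !mxE /= mulr1.
have e1 : (h *: bvec 0 : 'rV[R]_2) 0 1 = 0 by rewrite !mxE /= mulr0.
rewrite /homogeneous_part big_ord_recr /= subnn e0 e1 /coef1 eqxx expr0 mulr1.
rewrite big1 ?add0r// => i _; rewrite subn_eq0 leqNgt ltn_ord /=.
by rewrite !mul0r.
Qed.

Lemma coef_bound_coef1 (c : nat -> R) (K q : R) : 0 <= K -> 0 <= q ->
  (forall k, `|c k| <= K * q ^+ k) -> coef_bound K q (coef1 c).
Proof.
move=> K0 q0 cK a b; rewrite /coef1; case: eqP => [->|_]; first by rewrite addn0.
by rewrite normr0 mulr_ge0 ?exprn_ge0.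
Qed.

Lemma derive1n_psum1 (c : nat -> R) y k t :
  derive1n k (psum1 c y) t = iter k (pd 0) (psum (coef1 c)) ((t - y) *: bvec 0).
Proof.
elim: k t => [|k IH] t //; rewrite derive1nS.
have -> : derive1n k (psum1 c y) =
    (fun t => iter k (pd 0) (psum (coef1 c)) ((t - y) *: bvec 0)).
  exact/funext.
rewrite iterS; move: (iter k _ _) => G; rewrite /derive1 /pd /derive.
have -> // : (fun h : R => h^-1 *: (G ((h + t - y) *: bvec 0) - G ((t - y) *: bvec 0))) =
  (fun h => h^-1 *: ((G \o shift ((t - y) *: bvec 0)) (h *: bvec 0) - G ((t - y) *: bvec 0))).
by apply/funext => h /=; rewrite -addrA scalerDl.
Qed.

Lemma iter_dcoef (c : nat -> R) k a b :
  iter k (dcoef 0) (coef1 c) a b * (a`!)%:R = ((a + k)`!)%:R * coef1 c (a + k) b.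
Proof.
elim: k a => [|k IH] a; first by rewrite addn0 mulrC.
rewrite iterS /dcoef eqxx; have := IH a.+1.
by rewrite addSnnS => <-; rewrite factS natrM; ring.
Qed.

Lemma psum_at0 (c : nat -> nat -> R) (K q : R) : 0 <= q -> coef_bound K q c ->
  psum c 0 = c 0%N 0%N.
Proof.
move=> q0 cK; apply: cvg_lim => //.
rewrite -cvg_shiftS /=.
have -> : (fun n => series (homogeneous_part c 0) n.+1) = fun=> c 0%N 0%N.
  apply/funext => n; rewrite /series /= big_nat_recl// big1 ?addr0.
    by rewrite /homogeneous_part big_ord1 !expr0 !mulr1.
  move=> i _; rewrite /homogeneous_part big1// => j _; rewrite !mxE.
  have jl : (j <= i.+1)%N by rewrite -ltnS.
  by rewrite -mulrA -exprD subnKC// expr0n mulr0.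
exact: cvg_cst.
Qed.

Lemma psum1_spec (c : nat -> R) (K q d : R) y : 0 <= K -> 0 <= q -> 0 < d ->
  32 * q * d <= 1 -> (forall k, `|c k| <= K * q ^+ k) ->
  [/\ forall k t, `|t - y| < d -> derivable (derive1n k (psum1 c y)) t 1,
      forall k t, `|t - y| < d ->
        `|derive1n k (psum1 c y) t| <= 2 * K * (2 * q) ^+ k * (k`!)%:R &
      forall k, derive1n k (psum1 c y) y = (k`!)%:R * c k].
Proof.
move=> K0 q0 d0 qd cK; have cb := coef_bound_coef1 K0 q0 cK.
have db n := @psum_anb R K q (coef1 c) 0 d q0 d0 qd cb n.
have e0 : (fun v : 'rV[R]_2 => psum (coef1 c) (v - 0)) = psum (coef1 c).
  by apply/funext => z; rewrite subr0.
rewrite e0 in db.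
have bx t : `|t - y| < d -> box 0 d ((t - y) *: bvec 0).
  by move=> td; rewrite /box /= subr0 normrZ norm_bvec mulr1.
have dk k n : dbound n (box 0 d) (box 0 d) (iter k (pd 0) (psum (coef1 c)))
    (fun m => gevrey (2 * K) (2 * q) 0 (k + m)).
  by apply: dbound_iter; exact: db.
split=> [k t td|k t td|k].
- have h1 := @dbound_derivable _ _ _ _ _ _ 0 (dk k 1%N) _ (bx t td).
  have -> : derive1n k (psum1 c y) =
      (fun t => iter k (pd 0) (psum (coef1 c)) (t *: bvec 0 + (- y) *: bvec 0)).
    by apply/funext => s; rewrite derive1n_psum1 scalerDl.
  have := DeriveDef h1 erefl; rewrite scalerDl.
  by move=> /is_derive_line [].
- rewrite derive1n_psum1; have := dbound0 (dk k 0%N) (bx t td).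
  by rewrite /gevrey !addn0.
- rewrite derive1n_psum1 subrr scale0r.
  (* Analytic and formal derivatives are matched on the whole box, because the induction
     differentiates the equality; only the constant term at 0 is used afterwards. *)
  have ek : forall z, box 0 d z ->
      iter k (pd 0) (psum (coef1 c)) z = psum (iter k (dcoef 0) (coef1 c)) z /\
      coef_class (K * q ^+ k) q k (iter k (dcoef 0) (coef1 c)).
    elim: k => [|k IH] z zd /=.
      by split=> //; rewrite expr0 mulr1; exact: coef_class0.
    have ck := (IH z zd).2.
    have Kk : 0 <= K * q ^+ k by rewrite mulr_ge0 ?exprn_ge0.
    split; last first.
      by rewrite exprSr mulrA; apply: coef_class_dcoef.
    have [_ ds _] := psum_derive 0 Kk q0 d0 qd ck.
    have e1 : (fun v : 'rV[R]_2 => psum (iter k (dcoef 0) (coef1 c)) (v - 0)) =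
        psum (iter k (dcoef 0) (coef1 c)) by apply/funext => w; rewrite subr0.
    rewrite e1 in ds.
    rewrite (pd_eq 0 (@box_open _ 0 d) (fun w wd => (IH w wd).1) zd) /pd.
    by case: (ds 0 z zd) => _ ->; rewrite subr0.
  have [-> ck] := ek 0 (box_center 0 d0).
  have Kk : 0 <= K * q ^+ k by rewrite mulr_ge0 ?exprn_ge0.
  rewrite (psum_at0 _ (coef_class_bound Kk q0 ck)) ?mulr_ge0//.
  by have := iter_dcoef c k 0 0; rewrite fact0 mulr1 add0n => ->.
Qed.

Lemma psum1_analytic (c : nat -> R) (K q d : R) y t : 0 <= K -> 0 <= q -> 0 < d ->
  32 * q * d <= 1 -> (forall k, `|c k| <= K * q ^+ k) -> `|t - y| < d ->
  analytic1_at (psum1 c y) t.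
Proof.
move=> K0 q0 d0 qd cK td; have [dk bk _] := psum1_spec y K0 q0 d0 qd cK.
have sub s : `|s - t| < d - `|t - y| -> `|s - y| < d.
  move=> st; have -> : s - y = (s - t) + (t - y) by rewrite addrA subrK.
  by apply: le_lt_trans (ler_normD _ _) _; rewrite -ltrBrDr.
apply: (@analytic1_of_bounds _ _ _ (d - `|t - y|) (2 * K) (2 * q)).
- by rewrite subr_gt0.
- by rewrite mulr_ge0.
- by rewrite mulr_ge0.
- by move=> k s /sub sd; rewrite derive1nS derive1E; apply: derivableP; exact: dk.
- by move=> k s /sub sd; exact: bk.
Qed.

Lemma analytic1_smooth f y : analytic1_at f y -> smooth_at f y.
Proof.
move=> [c /nbhs_ballP [e /= e0 he]].
have he' h : `|h| < e -> pseries c h @ \oo --> f (y + h).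
  by move=> hh; apply: he; rewrite -ball_normE /= sub0r normrN.
have d0 : 0 < e / 2 by rewrite divr_gt0.
have [M M0 hM] : exists2 M, 0 < M & forall n, `|c n * (e / 2) ^+ n| <= M.
  have cv : cvgn (series (fun n => c n * (e / 2) ^+ n)).
    apply/cvg_ex; exists (f (y + e / 2)); apply: he'.
    by rewrite gtr0_norm// ltr_pdivrMr// ltr_pMr// ltr1n.
  have /pinfty_ex_gt0[M M0 hM] := cvg_series_bounded cv.
  by exists M => // n; apply: hM.
set q := (e / 2)^-1; have q0 : 0 < q by rewrite invr_gt0.
have cK k : `|c k| <= M * q ^+ k.
  rewrite /q exprVn ler_pdivlMr ?exprn_gt0//; have := hM k.
  by rewrite normrM [`|(e / 2) ^+ k|]ger0_norm// exprn_ge0// ltW.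
pose d := Num.min e (32 * q)^-1; have dp : 0 < d.
  by rewrite lt_min e0 invr_gt0 mulr_gt0.
have qd : 32 * q * d <= 1.
  have q32 : 0 < 32 * q by rewrite mulr_gt0.
  by rewrite mulrC -ler_pdivlMr// mul1r ge_min lexx orbT.
have [dk _ _] := psum1_spec y (ltW M0) (ltW q0) dp qd cK.
apply: (@smooth_at_eq (psum1 c y) f y d dp); last by exists d.
move=> t td; rewrite /psum1 /psum.
have -> : homogeneous_part (coef1 c) ((t - y) *: bvec 0) = (fun n => c n * (t - y) ^+ n).
  by apply/funext => n; rewrite homogeneous_part_coef1.
have te : `|t - y| < e by apply: lt_le_trans td _; rewrite ge_min lexx.
by have := he' _ te; rewrite [y + _]addrC subrK => /cvg_lim; apply.
Qed.

End OneVariable.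

(** * A Lojasiewicz inequality *)

Section Lojasiewicz.
Variable R : realType.
Implicit Types (f g : 'rV[R]_2 -> R) (U Bt : set 'rV[R]_2) (c v x y z : 'rV[R]_2).

Lemma enorm2E v : enorm v = Num.sqrt (v 0 0 ^+ 2 + v 0 1 ^+ 2).
Proof.
rewrite /enorm !big_ord_recl big_ord0 addr0.
by congr (Num.sqrt (_ + v _ _ ^+ _)); apply/val_inj.
Qed.

Lemma enorm_ge0 v : 0 <= enorm v. Proof. exact: sqrtr_ge0. Qed.

Lemma norm_le_enorm v : `|v| <= enorm v.
Proof.
rewrite norm_le2 enorm2E -!sqrtr_sqr !ler_sqrt ?addr_ge0 ?sqr_ge0//.
by rewrite lerDl lerDr !sqr_ge0.
Qed.

Lemma enorm_le_sum v : enorm v <= `|v 0 0| + `|v 0 1|.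
Proof.
have h : 0 <= `|v 0 0| + `|v 0 1| by rewrite addr_ge0.
rewrite enorm2E -[leRHS]ger0_norm// -sqrtr_sqr ler_sqrt ?sqr_ge0//.
rewrite sqrrD !real_normK ?num_real// -addrA [_ *+ 2 + _]addrC addrA lerDl.
by rewrite mulrn_wge0// mulr_ge0.
Qed.

Lemma enormN v : enorm (- v) = enorm v.
Proof. by rewrite !enorm2E !mxE !sqrrN. Qed.

Lemma eball_center c (r : R) : 0 < r -> eball c r c.
Proof.
move=> r0; rewrite /eball /= subrr enorm2E !mxE expr0n /= addr0 sqrtr0; exact: ltW.
Qed.

Lemma box_eball c (r : R) : 0 < r -> box c (r / 2) `<=` eball c r.
Proof.
move=> r0 y yc; rewrite /eball /=; apply: le_trans (enorm_le_sum _) _.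
have h1 := coord_le_norm (y - c) 0; have h2 := coord_le_norm (y - c) 1.
by move: yc; rewrite /box /=; lra.
Qed.

Lemma compact_eball c (r : R) : compact (eball c r).
Proof.
apply: bounded_closed_compact.
  exists (`|c| + r); split; first exact: num_real.
  move=> M hM x xB /=; apply/ltW; apply: le_lt_trans hM.
  have -> : x = c + (x - c) by rewrite addrC subrK.
  apply: le_trans (ler_normD _ _) _; rewrite lerD2l.
  exact: le_trans (norm_le_enorm _) xB.
have [r0|r0] := leP 0 r; last first.
  have -> : eball c r = set0; last exact: closed0.
  apply/seteqP; split=> // x; rewrite /eball /= => h.
  by have := le_lt_trans (le_trans (enorm_ge0 _) h) r0; rewrite ltxx.
pose f x := (x 0 0 - c 0 0) ^+ 2 + (x 0 1 - c 0 1) ^+ 2.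
have -> : eball c r = f @^-1` [set t | t <= r ^+ 2].
  apply/seteqP; split=> x; rewrite /eball /= enorm2E !mxE -/(f x) => h.
    have f0 : 0 <= f x by rewrite addr_ge0 ?sqr_ge0.
    by rewrite -(sqr_sqrtr f0) lerXn2r ?nnegrE ?sqrtr_ge0.
  by rewrite -(ger0_norm r0) -sqrtr_sqr ler_sqrt ?sqr_ge0.
apply: closed_comp; last exact: closed_le.
move=> x _; apply: anl_continuous.
by apply: (@anlD _ (fun x => _ ^+ 2) (fun x => _ ^+ 2));
  apply: (anlM (anl_coord _ _ _) (anl_coord _ _ _)).
Qed.

Lemma same_sign (v : R -> R) (a b : R) : a <= b ->
  (forall t, a <= t <= b -> {for t, continuous v}) ->
  (forall t, a <= t <= b -> v t != 0) -> 0 < v a * v b.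
Proof.
move=> ab cv v0.
have cw : {within `[a, b], continuous v}.
  by apply: continuous_in_subspaceT => t; rewrite inE /= in_itv /=; exact: cv.
have iv : ~ (Num.min (v a) (v b) <= 0 <= Num.max (v a) (v b)).
  move=> h; have [t] := IVT ab cw h; rewrite in_itv /= => tab vt.
  by have := v0 t tab; rewrite vt eqxx.
have va : v a != 0 by apply: v0; rewrite lexx ab.
have vb : v b != 0 by apply: v0; rewrite lexx ab.
have [a0|a0|a0] := ltgtP (v a) 0; last by rewrite a0 eqxx in va.
- have [b0|b0|b0] := ltgtP (v b) 0; last by rewrite b0 eqxx in vb.
  + by rewrite nmulr_rgt0.
  + by case: iv; rewrite ge_min le_max (ltW a0) (ltW b0) orbT.
- have [b0|b0|b0] := ltgtP (v b) 0; last by rewrite b0 eqxx in vb.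
  + by case: iv; rewrite ge_min le_max (ltW a0) (ltW b0) orbT.
  + by rewrite mulr_gt0.
Qed.

(* Where f and its derivative keep their signs, |f| increases in one of the two
   directions, so going back in the other one bounds it from below. *)
Lemma step_bound f i y (d e : R) : 0 < d -> 0 < e ->
  (forall t, `|t| <= d -> anl f (t *: bvec i + y)) ->
  (forall t, `|t| <= d -> f (t *: bvec i + y) != 0) ->
  (forall t, `|t| <= d -> e <= `|pd i f (t *: bvec i + y)|) ->
  e * d <= `|f y|.
Proof.
move=> d0 e0 af f0 ef.
pose u t := f (t *: bvec i + y); pose u' t := pd i f (t *: bvec i + y).
pose U := [set z | anl f z].
have dU z : U z -> derivable f z (bvec i) by exact: anl_derivable.
have cont g t : anl g (t *: bvec i + y) -> {for t, continuous (fun t : R => g (t *: bvec i + y))}.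
  move=> ag; apply/differentiable_continuous/derivable1_diffP.
  have := DeriveDef (@anl_derivable _ _ _ i ag) erefl.
  by move=> /is_derive_line [].
have cu t : `|t| <= d -> {for t, continuous u} by move=> td; apply: cont; exact: af.
have cu' t : `|t| <= d -> {for t, continuous u'}.
  by move=> td; apply: (cont (pd i f)); apply: anl_pd; exact: af.
have dab t : - d <= t <= d -> `|t| <= d by rewrite ler_norml.
have u'0 t : `|t| <= d -> u' t != 0.
  by move=> /ef; rewrite -normr_gt0; apply: lt_le_trans.
have m1 : exists2 t, 0 < t < d & u d - u 0 = u' t * (d - 0).
  by apply: (line_MVT d0 dU) => t /andP[t0 td]; apply: af; rewrite ger0_norm.
have dn : - d < 0 by rewrite oppr_lt0.
have m2 : exists2 t, - d < t < 0 & u 0 - u (- d) = u' t * (0 - - d).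
  apply: (line_MVT dn dU) => t /andP[td t0]; apply: af.
  by rewrite ler0_norm// lerNl.
have [t1 /andP[t10 t1d] e1] := m1; have [t2 /andP[t2d t20] e2] := m2.
have dd := ltW d0.
have b1 : `|t1| <= d by rewrite gtr0_norm// ltW.
have b2 : `|t2| <= d by rewrite ltr0_norm// lerNl ltW.
have s0 a b : - d <= a -> a <= b -> b <= d -> 0 < u a * u b.
  move=> da ab bd; apply: same_sign => // t /andP[ta tb]; [apply: cu|apply: f0];
  by rewrite ler_norml (le_trans da)//= (le_trans _ bd).
have s1 : 0 < u' t2 * u' t1.
  apply: same_sign; first by rewrite ltW// (lt_trans t20).
    by move=> t /andP[ta tb]; apply: cu';
      rewrite ler_norml (le_trans (ltW t2d) ta) (le_trans tb (ltW t1d)).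
  by move=> t /andP[ta tb]; apply: u'0;
    rewrite ler_norml (le_trans (ltW t2d) ta) (le_trans tb (ltW t1d)).
have s2 : 0 < u 0 * u d by apply: s0 => //; exact: ltW.
have s3 : 0 < u (- d) * u 0 by apply: s0 => //; exact: ltW.
have y0 : u 0 = f y by rewrite /u scale0r add0r.
have h1 := ef _ b1; have h2 := ef _ b2; rewrite -/(u' t1) in h1; rewrite -/(u' t2) in h2.
rewrite -y0; move: e1 e2 s1 s2 s3 h1 h2; rewrite subr0 sub0r opprK.
move: (u 0) (u d) (u (- d)) (u' t1) (u' t2) => a b m p q e1 e2 s1 s2 s3 h1 h2.
(* Here [a], [b], [m] are the values at the centre and at the two ends, [p] and [q] the mean slopes,
   of equal sign. At one of the ends the value still has the sign of [a] but is closer to 0, by at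
   least [e * d]. *)
have [p0|p0|p0] := ltgtP p 0; last by move: s1; rewrite p0 mulr0 ltxx.
- have q0 : q < 0 by rewrite -(nmulr_lgt0 _ p0).
  rewrite (ltr0_norm p0) in h1; rewrite (ltr0_norm q0) in h2.
  have [a0|a0|a0] := ltgtP a 0; last by move: s2; rewrite a0 mul0r ltxx.
  + rewrite (ltr0_norm a0).
    have m0 : m < 0 by rewrite -(nmulr_lgt0 _ a0).
    have : e * d <= - q * d by rewrite ler_wpM2r.
    by lra.
  + rewrite (gtr0_norm a0).
    have b0 : 0 < b by rewrite -(pmulr_rgt0 _ a0).
    have : e * d <= - p * d by rewrite ler_wpM2r.
    by lra.
- have q0 : 0 < q by rewrite -(pmulr_lgt0 _ p0).
  rewrite (gtr0_norm p0) in h1; rewrite (gtr0_norm q0) in h2.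
  have [a0|a0|a0] := ltgtP a 0; last by move: s2; rewrite a0 mul0r ltxx.
  + rewrite (ltr0_norm a0).
    have b0 : b < 0 by rewrite -(nmulr_rgt0 _ a0).
    have : e * d <= p * d by rewrite ler_wpM2r.
    by lra.
  + rewrite (gtr0_norm a0).
    have m0 : 0 < m by rewrite -(pmulr_lgt0 _ a0).
    have : e * d <= q * d by rewrite ler_wpM2r.
    by lra.
Qed.

(** By the identity theorem no point has a flat jet, so locally some derivative stays away from 0.
    Compactness makes order, radius and lower bound uniform, and a single [m] controls all three. *)
Lemma uniform_nonflat Bt c (r : R) g : open Bt -> connected Bt ->
  eball c r `<=` Bt -> (forall x, Bt x -> anl g x) ->
  ~ (forall x, Bt x -> g x = 0) ->
  exists m : nat, forall x, eball c r x -> exists i j : 'I_m.+1,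
    forall y, box x m.+1%:R^-1 y -> Bt y /\ m.+1%:R^-1 <= `|pderiv i j g y|.
Proof.
move=> oB cB BB ag ng.
pose P (n : nat) x := exists i j : 'I_n.+1,
    forall y, box x n.+1%:R^-1 y -> Bt y /\ n.+1%:R^-1 <= `|pderiv i j g y|.
have cov := (compact_near_coveringP _).1 (@compact_eball c r).
have : \forall n \near \oo, eball c r `<=` P n.
  apply: cov => x /BB Bx.
  have [i [j nij]] : exists i j, pderiv i j g x != 0.
    apply: contrapT => h; apply: ng.
    have fl i j : pderiv i j g x = 0.
      by apply/eqP; apply: contrapT => /negP k; apply: h; exists i, j.
    have [d d0 hd] := anl_flat_zero (ag x Bx) fl.
    have [e e0 he] := open_box oB Bx.
    apply: (identity_theorem oB cB ag (@box_open _ x (Num.min d e))).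
    - by exists x; apply: box_center; rewrite lt_min d0.
    - by move=> y; rewrite /box /= lt_min => /andP[_ /he].
    - by move=> y; rewrite /box /= lt_min => /andP[/hd].
  set G := pderiv i j g in nij.
  have cG := anl_continuous (anl_pderiv i j (ag x Bx)).
  have G0 : 0 < `|G x| / 2 by rewrite divr_gt0// normr_gt0.
  have [d d0 hd] := (continuous_boxP _ _).1 cG _ G0.
  have [e e0 he] := open_box oB Bx.
  pose s := Num.min (`|G x| / 2) (Num.min d e / 2).
  have s0 : 0 < s by rewrite lt_min G0 divr_gt0// lt_min d0.
  have [N hN] : exists N : nat, forall n, (N <= n)%N -> n.+1%:R^-1 < s.
    have [N _ hN] := near_infty_natSinv_lt (PosNum s0).
    by exists N => n; exact: hN.
  have s1 : s <= `|G x| / 2 by rewrite ge_min lexx.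
  have s2 : s <= Num.min d e / 2 by rewrite ge_min lexx orbT.
  have m1 : Num.min d e <= d by rewrite ge_min lexx.
  have m2 : Num.min d e <= e by rewrite ge_min lexx orbT.
  exists (box x (Num.min d e / 2), [set n | (maxn N (maxn i j) <= n)%N]).
    split=> /=; last by exists (maxn N (maxn i j)).
    apply: open_nbhs_nbhs; split; first exact: box_open.
    by apply: box_center; rewrite divr_gt0// lt_min d0.
  move=> [x' n] /= [x'x]; rewrite !geq_max => /and3P[nN ni nj].
  have i1 : (i < n.+1)%N by rewrite ltnS.
  have j1 : (j < n.+1)%N by rewrite ltnS.
  exists (Ordinal i1), (Ordinal j1) => y yx' /=.
  have yx : `|y - x| < Num.min d e.
    have -> : y - x = (y - x') + (x' - x) by rewrite addrA subrK.
    apply: le_lt_trans (ler_normD _ _) _; rewrite [ltRHS]splitr ltrD//.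
    by apply: lt_le_trans yx' _; apply: le_trans (ltW (hN n nN)) _.
  split; first by apply: he; apply: lt_le_trans yx _.
  have := hd y (lt_le_trans yx m1); rewrite -/G => hG.
  have k1 := hN n nN; have k2 := lerB_dist (G x) (G y).
  rewrite distrC in hG; move: hG k1 k2 s1.
  by move: `|G x - G y| `|G x| `|G y| n.+1%:R^-1 => *; lra.
move=> [N _ /(_ N (leqnn _)) h]; exists N; exact: h.
Qed.

Lemma distance_le x y (S : set 'rV[R]_2) : S y -> distance x S <= enorm (x - y).
Proof.
move=> Sy; apply: ge_inf; last by exists y.
by exists 0 => _ [z _ <-]; exact: enorm_ge0.
Qed.

Lemma distance_ge0 x (S : set 'rV[R]_2) : S !=set0 -> 0 <= distance x S.
Proof.
move=> [y Sy]; apply: lb_le_inf; first by exists (enorm (x - y)), y.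
by move=> _ [z _ <-]; exact: enorm_ge0.
Qed.

Lemma zero_set_variety Bt g : open Bt -> (forall x, Bt x -> anl g x) ->
  analytic_variety Bt (Bt `&` [set x | g x = 0]).
Proof.
move=> oB ag; split=> [x []//|x Bx]; exists Bt, 1%N, (fun=> g); split=> //.
  by move=> _ z Bz; apply: anl_analytic2; exact: ag.
apply/seteqP; split=> z /=; first by move=> [[Bz gz] _].
by move=> [Bz gz]; split=> //; split=> //; exact: gz ord0.
Qed.

Lemma zero_set_codim Bt g : open Bt -> connected Bt -> (forall x, Bt x -> anl g x) ->
  ~ (forall x, Bt x -> g x = 0) ->
  positive_codimension (Bt `&` [set x | g x = 0]).
Proof.
move=> oB cB ag ng; apply/seteqP; split=> // x ix; apply: ng.
have := @identity_theorem R Bt (Bt `&` [set x | g x = 0])^° g oB cB ag.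
apply; first exact: open_interior.
- by exists x.
- by move=> y /interior_subset [].
- by move=> y /interior_subset [].
Qed.

Lemma prod_not_zero (I : Type) (s : seq I) (F : I -> 'rV[R]_2 -> R) (P : pred I) Bt x0 :
  open Bt -> connected Bt -> Bt x0 -> (forall i x, Bt x -> anl (F i) x) ->
  (forall i, P i -> ~ (forall x, Bt x -> F i x = 0)) ->
  ~ (forall x, Bt x -> \prod_(i <- s | P i) F i x = 0).
Proof.
move=> oB cB Bx0 aF nF; elim: s => [|i s IH] h.
  by have := h x0 Bx0; rewrite big_nil => /eqP; rewrite oner_eq0.
case Pi : (P i).
  apply: (@mul_not_zero _ Bt (F i) (fun x => \prod_(i <- s | P i) F i x) oB cB).
  - exact: aF.
  - by move=> x Bx; apply: anl_prod => j _; exact: aF.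
  - exact: nF.
  - exact: IH.
  - by move=> x Bx; have := h x Bx; rewrite big_cons Pi.
by apply: IH => x Bx; have := h x Bx; rewrite big_cons Pi.
Qed.

(* Adding to the zero set of g the zeros of all its low order derivatives makes
   the inequality elementary, by iterating [step_bound]. *)
Lemma lojasiewicz Bt c (r : R) g : 0 < r -> open Bt -> connected Bt ->
  eball c r `<=` Bt -> (forall x, Bt x -> anl g x) ->
  ~ (forall x, Bt x -> g x = 0) ->
  exists (tau K : R) (S : set 'rV[R]_2),
    [/\ 0 < tau, 0 < K, analytic_variety Bt S /\ positive_codimension S, S c &
      forall x, eball c r x -> distance x S `^ tau <= K * `|g x|].
Proof.
move=> r0 oB cB BB ag ng.
have Bc : Bt c by apply: BB; exact: eball_center.
have [m hm] := uniform_nonflat oB cB BB ag ng.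
pose P (ij : 'I_m.+1 * 'I_m.+1) :=
  `[< ~ (forall x, Bt x -> pderiv ij.1 ij.2 g x = 0) >].
pose F (ij : 'I_m.+1 * 'I_m.+1) := pderiv ij.1 ij.2 g.
have aF ij x : Bt x -> anl (F ij) x by move=> Bx; apply: anl_pderiv; exact: ag.
(* Derivatives vanishing identically are left out, so that H is not identically zero. The linear
   factor puts the centre into the zero set, which makes it nonempty and bounds the distance by [r]
   on the ball. *)
pose H x := (\prod_(ij | P ij) F ij x) * (x 0 0 - c 0 0).
have aH x : Bt x -> anl H x.
  move=> Bx; apply: (anlM _ (anl_coord _ _ _)).
  by apply: anl_prod => ij _; exact: aF.
have nH : ~ (forall x, Bt x -> H x = 0).
  apply: (mul_not_zero oB cB).
  - by move=> x Bx; apply: anl_prod => ij _; exact: aF.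
  - by move=> x _; exact: anl_coord.
  - by apply: (prod_not_zero oB cB Bc aF) => ij /asboolP.
  - move=> h; have := h (r / 2 / 2 *: bvec 0 + c).
    have Br : Bt (r / 2 / 2 *: bvec 0 + c).
      apply/BB/(box_eball r0); rewrite /box /= addrK normrZ norm_bvec mulr1.
      by rewrite gtr0_norm; lra.
    by move=> /(_ Br) /eqP; rewrite !mxE /= mulr1 addrK !mulf_eq0 !invr_eq0 gt_eqF// pnatr_eq0.
pose S := Bt `&` [set x | H x = 0].
have Sc : S c by split=> //; rewrite /= /H subrr mulr0.
have S0 : S !=set0 by exists c.
pose e : R := m.+1%:R^-1; have e0 : 0 < e by rewrite invr_gt0.
have e1 : e <= 1 by rewrite invf_le1// ler1n.
(* Makes a chain of fewer than 2(m + 1) steps of length d = k D stay both at distance less than D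
   from x, hence off S, and inside the box of radius e; recall D <= r. *)
pose k : R := e / ((2 * m.+1)%:R * (r + 1)).
have rp : 0 < r + 1 by rewrite addr_gt0.
have kp : 0 < k by rewrite divr_gt0// mulr_gt0.
(* At most 2m steps are made; the extra 1 makes the exponent positive, which settles the case of
   distance 0. *)
pose N := (2 * m)%N.+1.
exists N%:R, (e * k ^+ N)^-1, S; split=> //.
- by rewrite invr_gt0 mulr_gt0// exprn_gt0.
- by split; [exact: zero_set_variety|exact: zero_set_codim].
move=> x Bx; have dx := distance_ge0 x S0.
rewrite powR_mulrn// mulrC ler_pdivlMr ?mulr_gt0 ?exprn_gt0//.
have [->|d0] := eqVneq (distance x S) 0; first by rewrite expr0n mul0r.
have dp : 0 < distance x S by rewrite lt_neqAle eq_sym d0.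
have dr : distance x S <= r.
  by apply: le_trans (distance_le x Sc) _; exact: Bx.
set D := distance x S in dx dp dr d0 *.
pose d := k * D; have dpos : 0 < d by rewrite mulr_gt0.
have kE : k * (2 * m.+1)%:R * (r + 1) = e.
  by rewrite /k -mulrA divfK// mulf_neq0// gt_eqF.
have m1 : 1 <= (2 * m.+1)%:R :> R by rewrite ler1n muln_gt0.
have kr : k * (2 * m.+1)%:R <= e.
  rewrite -kE; apply: ler_peMr; first by rewrite mulr_ge0 ?(ltW kp).
  by rewrite lerDr ltW.
have dD : (2 * m.+1)%:R * d <= D.
  rewrite mulrA -[leRHS]mul1r ler_wpM2r// mulrC; exact: le_trans kr e1.
have de : (2 * m.+1)%:R * d < e.
  have -> : (2 * m.+1)%:R * d = k * (2 * m.+1)%:R * D by rewrite /d; ring.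
  rewrite -kE ltr_pM2l; first by apply: le_lt_trans dr _; rewrite ltrDl.
  by rewrite mulr_gt0// ltr0n muln_gt0.
have d1 : d <= 1.
  apply: le_trans e1; apply: ltW; apply: le_lt_trans de.
  by rewrite -[leLHS]mul1r ler_wpM2r// ltW.
have [i [j hij]] := hm x Bx.
have ij2 : (i + j < 2 * m.+1)%N.
  by rewrite mul2n -addnn -addSn leq_add// ltnW.
pose n1 v : R := `|v 0 0| + `|v 0 1|.
(* Coordinate steps add up in the norm [n1], so this covers every point reached from [x] by at most
   i + j steps. *)
have near n y : (n <= i + j)%N -> n1 (y - x) <= n%:R * d ->
    [/\ Bt y, n1 (y - x) < e & ~ S y].
  move=> nij yx.
  have s1 : n1 (y - x) < (2 * m.+1)%:R * d.
    apply: le_lt_trans yx _; rewrite ltr_pM2r// ltr_nat; exact: leq_ltn_trans ij2.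
  have s2 : n1 (y - x) < e by apply: lt_trans de.
  have By : Bt y.
    by have [] := hij y; rewrite // /box /=; apply: le_lt_trans (norm_le_sum2 _) s2.
  split=> // Sy; have := distance_le x Sy; rewrite -/D => Dy.
  have := lt_le_trans s1 dD; rewrite ltNge => /negP; apply.
  by apply: le_trans Dy _; rewrite -enormN opprB enorm_le_sum.
have fac n y (ij : 'I_m.+1 * 'I_m.+1) : (n <= i + j)%N -> n1 (y - x) <= n%:R * d -> P ij ->
    pderiv ij.1 ij.2 g y != 0.
  move=> nij yx Pij; have [By _ nS] := near n y nij yx.
  apply/eqP => h; apply: nS; split=> //; rewrite /= /H (bigD1 ij) //= /F h.
  by rewrite !mul0r.
(* All derivatives met on the way down from order (i, j) to [g] are not identically zero, since a
   further derivative of each is not; thus their zeros belong to S. *)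
have pij : ~ (forall y, Bt y -> pderiv i j g y = 0).
  move=> h; have [Bx' hx] := hij x (box_center x e0).
  by move: hx; rewrite (h x Bx') normr0 leNgt invr_gt0 ltr0Sn.
have iter0 l a : (forall y, Bt y -> iter l (pd a) (fun=> 0 : R) y = 0).
  move=> y _; suff -> : iter l (pd a) (fun=> 0 : R) = fun=> 0 by [].
  by elim: l => [|l IH] //=; rewrite IH pd_cst.
have pi0 a : (a <= i)%N -> ~ (forall y, Bt y -> pderiv a j g y = 0).
  move=> ai h; apply: pij => y By.
  rewrite pderivE -(subnK ai) iterD.
  by rewrite (@iter_pd_eq _ _ _ (fun=> 0) 0 (i - a) oB h y By) iter0.
have pj0 b : (b <= j)%N -> ~ (forall y, Bt y -> pderiv 0 b g y = 0).
  move=> bj h; apply: (pi0 0%N isT) => y By.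
  rewrite pderivE /= -(subnK bj) iterD.
  by rewrite (@iter_pd_eq _ _ _ (fun=> 0) 1 (j - b) oB h y By) iter0.
have n1shift y a t : `|t| <= d -> n1 (t *: bvec a + y - x) <= n1 (y - x) + d.
  move=> td; rewrite -addrA /n1; set v := y - x.
  have h0 : `|(t *: bvec a + v) 0 0| <= `|t| * (a == 0)%:R + `|v 0 0|.
    apply: le_trans _ (_ : `|(t *: bvec a) 0 0| + `|v 0 0| <= _).
      by rewrite [X in `|X|]mxE ler_normD.
    by rewrite lerD2r mxE normrM bvecE normr_nat.
  have h1 : `|(t *: bvec a + v) 0 1| <= `|t| * (a == 1)%:R + `|v 0 1|.
    apply: le_trans _ (_ : `|(t *: bvec a) 0 1| + `|v 0 1| <= _).
      by rewrite [X in `|X|]mxE ler_normD.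
    by rewrite lerD2r mxE normrM bvecE normr_nat.
  move: h0 h1; case: (I2P a) => -> /=; rewrite ?mulr1 ?mulr0 ?add0r => h0 h1; lra.
(* Each use of [step_bound] removes one derivative, at the price of a factor d in the bound and a
   step d in the radius; [A2] continues in the other coordinate until [g] itself is bounded at
   [x]. *)
have A1 l : (l <= i)%N -> forall y, n1 (y - x) <= (i + j - l)%:R * d ->
    e * d ^+ l <= `|pderiv (i - l) j g y|.
  elim: l => [|l IH] li y yx.
    have [By ye _] := near (i + j)%N y (leqnn _) ltac:(by rewrite subn0 in yx).
    rewrite subn0 expr0 mulr1; apply: (hij y _).2.
    by apply: le_lt_trans (norm_le_sum2 _) ye.
  have lij : (l < i + j)%N by apply: leq_trans li _; rewrite leq_addr.
  have step t : `|t| <= d -> n1 (t *: bvec 0 + y - x) <= (i + j - l)%:R * d.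
    move=> td; apply: le_trans (n1shift y 0 t td) _.
    by rewrite -(subnSK lij) -natr1 mulrDl mul1r lerD2r.
  have il : (i - l.+1 < m.+1)%N by apply: leq_ltn_trans (leq_subr _ _) (ltn_ord i).
  rewrite exprSr mulrA; apply: (step_bound (i := 0) dpos).
  - by rewrite mulr_gt0// exprn_gt0.
  - move=> t td; apply/anl_pderiv/ag.
    by have [] := near _ _ (leq_subr _ _) (step t td).
  - move=> t td; apply: (fac _ _ (Ordinal il, j) (leq_subr l (i + j)) (step t td)).
    by apply/asboolP; apply: pi0; exact: leq_subr.
  - move=> t td; have := IH (ltnW li) _ (step t td).
    by rewrite -(subnSK li).
have A2 l : (l <= j)%N -> forall y, n1 (y - x) <= (j - l)%:R * d ->
    e * d ^+ (i + l) <= `|pderiv 0 (j - l) g y|.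
  elim: l => [|l IH] lj y yx.
    have := A1 i (leqnn i) y; rewrite subnn addKn addn0 subn0; apply.
    by rewrite subn0 in yx.
  have step t : `|t| <= d -> n1 (t *: bvec 1 + y - x) <= (j - l)%:R * d.
    move=> td; apply: le_trans (n1shift y 1 t td) _.
    by rewrite -(subnSK lj) -natr1 mulrDl mul1r lerD2r.
  have jl : (j - l.+1 < m.+1)%N by apply: leq_ltn_trans (leq_subr _ _) (ltn_ord j).
  have jij : (j - l <= i + j)%N by apply: leq_trans (leq_subr _ _) (leq_addl _ _).
  rewrite addnS exprSr mulrA; apply: (step_bound (i := 1) dpos).
  - by rewrite mulr_gt0// exprn_gt0.
  - move=> t td; apply/anl_pderiv/ag.
    by have [] := near _ _ jij (step t td).
  - move=> t td; apply: (fac _ _ (ord0, Ordinal jl) jij (step t td)).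
    by apply/asboolP; apply: pj0; exact: leq_subr.
  - move=> t td; have := IH (ltnW lj) _ (step t td).
    by rewrite -(subnSK lj).
have := A2 j (leqnn j) x; rewrite subnn subrr /n1 !mxE normr0 addr0 mul0r lexx.
move=> /(_ isT); apply: le_trans.
rewrite mulrCA ler_wpM2l ?(ltW e0)// [_ * k ^+ N]mulrC -exprMn -/d.
rewrite ler_wiXn2l ?(ltW dpos)//.
by move: ij2; rewrite mulnS add2n ltnS.
Qed.

End Lojasiewicz.

(** * Analytic left inverses of injective matrices *)

Section GramInverse.
Variable R : realType.

Lemma mul_rV_tr n (v : 'rV[R]_n) : v *m v^T = 0 -> v = 0.
Proof.
move=> /matrixP /(_ 0 0); rewrite !mxE => h.
apply/rowP => i; rewrite mxE; apply/eqP; rewrite -sqrf_eq0.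
have h2 : \sum_j v 0 j ^+ 2 = 0.
  by rewrite -[RHS]h; apply: eq_bigr => j _; rewrite mxE expr2.
move/eqP: h2; rewrite psumr_eq0 => [/allP h2|j _]; last exact: sqr_ge0.
by apply: (implyP (h2 i _)); rewrite // mem_index_enum.
Qed.

(** Over the reals v A A^T = 0 makes the sum of the squares of the entries of v A vanish. *)
Lemma gram_det_neq0 m n (A : 'M[R]_(m, n)) :
  (forall v : 'rV[R]_m, v *m A = 0 -> v = 0) -> \det (A *m A^T) != 0.
Proof.
move=> inj; apply/det0P => -[v v0 vA].
have : v *m A = 0.
  by apply: mul_rV_tr; rewrite trmx_mul mulmxA -[v *m A *m _]mulmxA vA mul0mx.
by move=> /inj /eqP; rewrite (negPf v0).
Qed.

(** With g the Gram determinant and Q = A^T adj(A A^T), the final identity is polynomial and holds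
    at every x, including the zeros of g; injectivity at [x0] serves only to make g nonzero
    there. *)
Lemma gram_left_inverse (T1 T2 : finType) (J : 'rV[R]_2 -> T1 -> T2 -> R)
    (Bt : set 'rV[R]_2) x0 : Bt x0 ->
  (forall x u w, Bt x -> anl (fun y => J y u w) x) ->
  (forall v : T1 -> R, (forall w, \sum_u v u * J x0 u w = 0) -> forall u, v u = 0) ->
  exists (g : 'rV[R]_2 -> R) (Q : T2 -> T1 -> 'rV[R]_2 -> R),
    [/\ forall x, Bt x -> anl g x, forall w u x, Bt x -> anl (Q w u) x, g x0 != 0 &
      forall x (v : T1 -> R) u,
        g x * v u = \sum_w (\sum_u' v u' * J x u' w) * Q w u x].
Proof.
move=> Bx0 aJ inj.
pose A x : 'M[R]_(#|T1|, #|T2|) := \matrix_(i, j) J x (enum_val i) (enum_val j).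
pose row (v : T1 -> R) : 'rV[R]_#|T1| := \row_i v (enum_val i).
have rowA x v : row v *m A x = \row_j \sum_u v u * J x u (enum_val j).
  apply/rowP => j; rewrite !mxE [RHS]big_enum_val /=.
  by apply: eq_bigr => i _; rewrite !mxE.
pose Gm x := A x *m (A x)^T.
have aA x i j : Bt x -> anl (fun y => A y i j) x.
  move=> Bx; apply: (anl_ext ltr01 _ (aJ x (enum_val i) (enum_val j) Bx)).
  by move=> y _; rewrite mxE.
have aG x i j : Bt x -> anl (fun y => Gm y i j) x.
  move=> Bx; apply: (anl_ext ltr01 (f := fun y => \sum_k A y i k * A y j k)).
    by move=> y _; rewrite [RHS]mxE; apply: eq_bigr => k _; rewrite [(A y)^T _ _]mxE.
  by apply: anl_sum => k; apply: anlM; exact: aA.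
pose Qm x := (A x)^T *m \adj (Gm x).
exists (fun x => \det (Gm x)), (fun w u x => Qm x (enum_rank w) (enum_rank u)); split.
- by move=> x Bx; apply: anl_det => i j; exact: aG.
- move=> w u x Bx.
  apply: (anl_ext ltr01
    (f := fun y => \sum_k A y k (enum_rank w) * (\adj (Gm y)) k (enum_rank u))).
    by move=> y _; rewrite [RHS]mxE; apply: eq_bigr => k _; rewrite [(A y)^T _ _]mxE.
  apply: anl_sum => k; apply: anlM; first exact: aA.
  by apply: anl_adjugate => i j; exact: aG.
- apply: gram_det_neq0 => v vA.
  have vE : v = row (fun u => v 0 (enum_rank u)).
    by apply/rowP => i; rewrite mxE enum_valK.
  have v0 := inj (fun u => v 0 (enum_rank u)) _.
  apply/rowP => i; rewrite mxE -[i]enum_valK v0// => w.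
  move: vA; rewrite {1}vE rowA => /rowP /(_ (enum_rank w)).
  by rewrite !mxE enum_rankK.
- move=> x v u.
  have : row v *m A x *m Qm x = \det (Gm x) *: row v.
    by rewrite /Qm mulmxA -[row v *m _ *m _]mulmxA -mulmxA mul_mx_adj mul_mx_scalar.
  move=> /rowP /(_ (enum_rank u)); rewrite [X in _ = X]mxE [row v _ _]mxE enum_rankK => <-.
  rewrite mxE [RHS](reindex (@enum_val T2 T2)) /=; last first.
    by apply: onW_bij; exact: enum_val_bij.
  by apply: eq_bigr => j _; rewrite rowA mxE enum_valK.
Qed.

End GramInverse.

(** * Jets *)

Section Jets.
Variable R : realType.
Implicit Types (x y z : 'rV[R]_2) (U : set 'rV[R]_2).

(** The product and chain rules on the coefficients of a sum of [p k] times f^(k) composed with phi: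
    the derivative of f^(k) feeds the coefficient of index k + 1. *)
Definition jet_step (d : 'I_2) (phi : 'rV[R]_2 -> R) (p : nat -> 'rV[R]_2 -> R)
    (k : nat) : 'rV[R]_2 -> R :=
  if k is l.+1 then pd d (p k) \+ (p l \* pd d phi) else pd d (p k).

(* [pderiv i j (a \* (f \o phi))] is the sum over k of
   [jet_coef a phi i j k \* (derive1n k f \o phi)]. *)
Definition jet_coef (a phi : 'rV[R]_2 -> R) (i j : nat) : nat -> 'rV[R]_2 -> R :=
  iter i (jet_step 0 phi) (iter j (jet_step 1 phi)
    (fun k => if k == 0%N then a else fun=> 0)).

Lemma jet_step_anl d phi p x : anl phi x -> (forall k, anl (p k) x) ->
  forall k, anl (jet_step d phi p k) x.
Proof.
move=> aphi ap [|k] /=; first exact: anl_pd.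
by apply: anlD; [exact: anl_pd|apply: anlM => //; exact: anl_pd].
Qed.

Lemma jet_coef_anl a phi i j k x : anl a x -> anl phi x -> anl (jet_coef a phi i j k) x.
Proof.
move=> aa aphi; rewrite /jet_coef.
have h0 l : anl (if l == 0%N then a else fun=> 0) x.
  by case: (l == 0%N) => //; exact: anl_cst.
have h1 l : anl (iter j (jet_step 1 phi) (fun k => if k == 0%N then a else fun=> 0) l) x.
  by elim: j l => [|j IH] l //=; apply: jet_step_anl.
by elim: i k => [|i IH] k //=; apply: jet_step_anl.
Qed.

Lemma jet_step_supp d phi p n : (forall k, (n < k)%N -> p k = fun=> 0) ->
  forall k, (n.+1 < k)%N -> jet_step d phi p k = fun=> 0.
Proof.
move=> p0 [|k] //= nk; rewrite (p0 k.+1) ?(ltnW nk)// p0// pd_cst.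
by apply/funext => z /=; rewrite mul0r addr0.
Qed.

Lemma jet_coef_supp a phi i j k : (i + j < k)%N -> jet_coef a phi i j k = fun=> 0.
Proof.
rewrite /jet_coef; set p0 := fun k => _.
have h1 l : (j < l)%N -> iter j (jet_step 1 phi) p0 l = fun=> 0.
  elim: j l => [|j IH] l jl /=; first by rewrite /p0 gtn_eqF.
  exact: jet_step_supp IH l jl.
elim: i k => [|i IH] k ik /=; first exact: h1.
exact: jet_step_supp IH k ik.
Qed.

Lemma is_derive_fsum (V : normedModType R) n (h : 'I_n -> V -> R) (t v : V)
    (dh : 'I_n -> R) :
  (forall i, is_derive t v (h i) (dh i)) ->
  is_derive t v (fun s => \sum_(i < n) h i s) (\sum_(i < n) dh i).
Proof. by move=> dh'; have := is_derive_sum dh'; rewrite fct_sumE. Qed.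

Variables (a phi : 'I_3 -> 'rV[R]_2 -> R).

(** The vanishing of [p l M] ensures that the derivative of order M, which need not be
    differentiable, is never differentiated. *)
Lemma jet_sum_derive d z M (f : 'I_3 -> R -> R) (p : 'I_3 -> nat -> 'rV[R]_2 -> R) :
  (forall l, anl (phi l) z) -> (forall l k, anl (p l k) z) ->
  (forall l k, (k < M)%N -> derivable (derive1n k (f l)) (phi l z) 1) ->
  (forall l, p l M = fun=> 0) ->
  is_derive z (bvec d)
    (fun y => \sum_l \sum_(k < M.+1) p l k y * derive1n k (f l) (phi l y))
    (\sum_l \sum_(k < M.+1) jet_step d (phi l) (p l) k z * derive1n k (f l) (phi l z)).
Proof.
move=> aphi ap df pM.
pose T l k y := p l k y * derive1n k (f l) (phi l y).
have dphi l : is_derive z (bvec d) (phi l) (pd d (phi l) z).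
  by apply: DeriveDef => //; exact: anl_derivable.
have dT l (k : 'I_M) : is_derive z (bvec d) (T l k)
    (pd d (p l k) z * derive1n k (f l) (phi l z) +
     p l k z * pd d (phi l) z * derive1n k.+1 (f l) (phi l z)).
  have dp : is_derive z (bvec d) (p l k) (pd d (p l k) z).
    by apply: DeriveDef => //; exact: anl_derivable.
  have d2 := is_derive_comp (derivableP (df l k (ltn_ord k))) (dphi l).
  have := is_deriveM dp d2; rewrite -derive1E -derive1nS => d3.
  apply: is_derive_eq d3 _; rewrite /GRing.scale /=.
  rewrite addrC; congr (_ + _); first exact: mulrC.
  by rewrite -mulrA; congr (_ * _); exact: mulrC.
pose D l (k : nat) := pd d (p l k) z * derive1n k (f l) (phi l z) +
     p l k z * pd d (phi l) z * derive1n k.+1 (f l) (phi l z).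
have e1 : (fun y => \sum_l \sum_(k < M.+1) p l k y * derive1n k (f l) (phi l y)) =
    (fun y => \sum_l \sum_(k < M) T l k y).
  apply/funext => y; apply: eq_bigr => l _.
  by rewrite big_ord_recr /= pM mul0r addr0.
rewrite e1; apply: is_derive_eq (is_derive_fsum (fun l => is_derive_fsum (dT l))) _.
apply: eq_bigr => l _.
rewrite [RHS]big_ord_recl /= big_split /=.
under [X in _ = _ + X]eq_bigr => k _ do rewrite /bump /= add1n mulrDl.
rewrite [X in _ = _ + X]big_split /= addrA; congr (_ + _).
have -> : \sum_(k < M) pd d (p l k) z * derive1n k (f l) (phi l z) =
    \sum_(k < M.+1) pd d (p l k) z * derive1n k (f l) (phi l z).
  by rewrite [RHS]big_ord_recr /= pM pd_cst mul0r addr0.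
rewrite [LHS]big_ord_recl; congr (_ + _).
Qed.

Lemma pderiv_jet M (f : 'I_3 -> R -> R) U : open U ->
  (forall z, U z -> forall l, [/\ anl (a l) z, anl (phi l) z &
    forall k, (k < M)%N -> derivable (derive1n k (f l)) (phi l z) 1]) ->
  forall i j, (i + j <= M)%N -> forall z, U z ->
  pderiv i j (Gsum a phi f) z =
  \sum_l \sum_(k < M.+1) jet_coef (a l) (phi l) i j k z * derive1n k (f l) (phi l z).
Proof.
move=> oU hU.
have stp d i j (F : 'rV[R]_2 -> R) (p : 'I_3 -> nat -> 'rV[R]_2 -> R) :
    (i + j < M)%N -> (forall l k z, U z -> anl (p l k) z) ->
    (forall l k, (i + j < k)%N -> p l k = fun=> 0) ->
    (forall z, U z -> F z = \sum_l \sum_(k < M.+1) p l k z * derive1n k (f l) (phi l z)) ->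
    forall z, U z -> pd d F z =
      \sum_l \sum_(k < M.+1) jet_step d (phi l) (p l) k z * derive1n k (f l) (phi l z).
  move=> ijM ap sp FE z Uz; rewrite (pd_eq d oU FE Uz) /pd.
  have d1 : forall l, anl (phi l) z by move=> l; case: (hU z Uz l).
  have d2 : forall l k, (k < M)%N -> derivable (derive1n k (f l)) (phi l z) 1.
    by move=> l; case: (hU z Uz l).
  have d3 : forall l k, anl (p l k) z by move=> l k; apply: ap.
  have d4 : forall l, p l M = fun=> 0 by move=> l; apply: sp.
  by case: (@jet_sum_derive d z M f p d1 d3 d2 d4).
elim=> [|i IHi] j ijM z Uz.
  elim: j ijM z Uz => [|j IHj] ijM z Uz.
    rewrite /pderiv /= /Gsum; apply: eq_bigr => l _.
    rewrite big_ord_recl /= big1 ?addr0// => k _.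
    by rewrite /jet_coef /= mul0r.
  have := @stp 1 0%N j (pderiv 0 j (Gsum a phi f)) (fun l => jet_coef (a l) (phi l) 0 j) ijM.
  rewrite /pderiv /jet_coef /=; apply=> //.
  - by move=> l k y Uy; case: (hU y Uy l) => h1 h2 _; exact: (jet_coef_anl 0 j k h1 h2).
  - by move=> l k jk; exact: (@jet_coef_supp _ _ 0 j).
  - by move=> y Uy; exact: (IHj (ltnW ijM)).
have := @stp 0 i j (pderiv i j (Gsum a phi f)) (fun l => jet_coef (a l) (phi l) i j) ijM.
rewrite /pderiv /jet_coef /=; apply=> //.
- by move=> l k y Uy; case: (hU y Uy l) => h1 h2 _; exact: (jet_coef_anl i j k h1 h2).
- by move=> l k jk; exact: jet_coef_supp.
- by move=> y Uy; exact: (IHi j (ltnW ijM)).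
Qed.

Lemma pderiv_jet_near M (f : 'I_3 -> R -> R) x :
  (forall l, anl (a l) x) -> (forall l, anl (phi l) x) ->
  (forall l, class_C_near M (f l) (phi l x)) ->
  exists2 d : R, 0 < d & forall i j, (i + j <= M)%N -> forall z, box x d z ->
  pderiv i j (Gsum a phi f) z =
  \sum_l \sum_(k < M.+1) jet_coef (a l) (phi l) i j k z * derive1n k (f l) (phi l z).
Proof.
move=> aa aphi cf.
have h l : exists2 d : R, 0 < d & forall z, box x d z ->
    [/\ anl (a l) z, anl (phi l) z &
    forall k, (k < M)%N -> derivable (derive1n k (f l)) (phi l z) 1].
  have [d1 d10 h1] := anl_near (aa l).
  have [d2 d20 h2] := anl_near (aphi l).
  have [d3 d30 h3] : exists2 d : R, 0 < d & forall z, box x d z ->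
      forall k, (k < M)%N -> derivable (derive1n k (f l)) (phi l z) 1.
    have /nbhs_ballP [e /= e0 he] := cf l.
    have [d d0 hd] := (continuous_boxP _ _).1 (anl_continuous (aphi l)) e e0.
    exists d => // z zx; have [|h _] := he (phi l z); last exact: h.
    by rewrite -ball_normE /= distrC; exact: hd.
  exists (Num.min d1 (Num.min d2 d3)); first by rewrite !lt_min d10 d20.
  move=> z; rewrite /box /= !lt_min => /and3P[z1 z2 z3].
  by split; [exact: h1|exact: h2|exact: h3].
have [d d0 hd] : exists2 d : R, 0 < d & forall l z, box x d z ->
    [/\ anl (a l) z, anl (phi l) z &
    forall k, (k < M)%N -> derivable (derive1n k (f l)) (phi l z) 1].
  have h' l : {d : R | 0 < d & forall z, box x d z ->
    [/\ anl (a l) z, anl (phi l) z &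
    forall k, (k < M)%N -> derivable (derive1n k (f l)) (phi l z) 1]} by exact/cid2.
  exists (\big[Num.min/1]_l s2val (h' l)).
    by apply: lt_bigmin => // l _; case: (h' l).
  move=> l z zx; have : box x (s2val (h' l)) z.
    by apply: box_le zx; exact: bigmin_le.
  by case: (h' l) => /= e _; apply.
exists d => // i j ijM z zx.
by apply: (pderiv_jet (@box_open _ x d)) => // y yx l; exact: hd.
Qed.

(** The kernel of J_M(x), with [c l k] in place of f_l^(k)(phi_l(x)). Entries beyond [M] are
    ignored, so one infinite sequence can be tested at all orders. *)
Definition jet_solution x M (c : 'I_3 -> nat -> R) :=
  forall i j, (i + j <= M)%N ->
    \sum_l \sum_(k < M.+1) jet_coef (a l) (phi l) i j k x * c l k = 0.

Definition jet_injective x M := forall c, jet_solution x M c ->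
  forall l k, (k <= M)%N -> c l k = 0.

Lemma jet_left_inverse (Bt : set 'rV[R]_2) x0 M : Bt x0 ->
  (forall l x, Bt x -> anl (a l) x) -> (forall l x, Bt x -> anl (phi l) x) ->
  jet_injective x0 M ->
  exists (g : 'rV[R]_2 -> R) (Q : nat -> nat -> 'I_3 -> nat -> 'rV[R]_2 -> R),
    [/\ forall x, Bt x -> anl g x, forall i j l k x, Bt x -> anl (Q i j l k) x, g x0 != 0 &
      forall x (c : 'I_3 -> nat -> R) l k, (k <= M)%N ->
        g x * c l k = \sum_(i < M.+1) \sum_(j < M.+1 | (i + j <= M)%N)
          (\sum_l' \sum_(k' < M.+1) jet_coef (a l') (phi l') i j k' x * c l' k') *
            Q i j l k x].
Proof.
move=> Bx0 aa aphi inj.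
pose T1 : finType := ('I_3 * 'I_M.+1)%type.
pose T2 : finType := ('I_M.+1 * 'I_M.+1)%type.
(* The triangle i + j <= M is completed to a square by zero columns, which add no equation. *)
pose J x (u : T1) (w : T2) : R :=
  if (w.1 + w.2 <= M)%N then jet_coef (a u.1) (phi u.1) w.1 w.2 u.2 x else 0.
have aJ x u w : Bt x -> anl (fun y => J y u w) x.
  move=> Bx; rewrite /J; case: (_ <= _)%N; last exact: anl_cst.
  by apply: jet_coef_anl; [exact: aa|exact: aphi].
have sumE x (v : T1 -> R) w : \sum_u v u * J x u w =
    if (w.1 + w.2 <= M)%N then
    \sum_l \sum_(k < M.+1) jet_coef (a l) (phi l) w.1 w.2 k x * v (l, k) else 0.
  rewrite /J; case: (_ <= _)%N; last by rewrite big1// => u _; rewrite mulr0.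
  rewrite pair_big /=; apply: eq_bigr => -[l k] _; exact: mulrC.
have [|g [Q [ag aQ g0 gQ]]] := @gram_left_inverse R T1 T2 J Bt x0 Bx0 aJ.
  move=> v hv [l k].
  pose c l' k' := v (l', inord k').
  have := inj c _ l k; rewrite /c inord_val -ltnS ltn_ord; apply=> // i j ijM.
  have li : (i < M.+1)%N by rewrite ltnS (leq_trans _ ijM) ?leq_addr.
  have lj : (j < M.+1)%N by rewrite ltnS (leq_trans _ ijM) ?leq_addl.
  have hw := hv (Ordinal li, Ordinal lj); rewrite sumE /= ijM in hw; rewrite -[RHS]hw.
  by apply: eq_bigr => l' _; apply: eq_bigr => k' _; rewrite inord_val.
exists g, (fun i j l k => Q (inord i, inord j) (l, inord k)); split=> //.
  by move=> i j l k x Bx; exact: aQ.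
move=> x c l k kM.
have := gQ x (fun u => c u.1 u.2) (l, inord k); rewrite /= inordK ?ltnS// => ->.
rewrite pair_big_dep /= [RHS]big_mkcond; apply: eq_bigr => -[i j] _ /=.
by rewrite sumE /= !inord_val; case: (_ <= _)%N => //; rewrite mul0r.
Qed.

(** Turns a statement on formal jets into one on actual functions, to which differential calculus
    applies. *)
Lemma jet_solution_of_poly x M (c : 'I_3 -> nat -> R) :
  (forall l, anl (a l) x) -> (forall l, anl (phi l) x) ->
  jet_solution x M c <->
  vanishes2 M (Gsum a phi (fun l => horner (jet_poly (c l) M (phi l x)))) x.
Proof.
move=> aa aphi; pose f l := horner (jet_poly (c l) M (phi l x)).
have cf l : class_C_near M (f l) (phi l x).
  by apply: smooth_at_class_C; exact: smooth_at_horner.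
have [d d0 hd] := pderiv_jet_near aa aphi cf.
have e i j : (i + j <= M)%N -> pderiv i j (Gsum a phi f) x =
  \sum_l \sum_(k < M.+1) jet_coef (a l) (phi l) i j k x * c l k.
  move=> ij; rewrite (hd i j ij x (box_center x d0)).
  apply: eq_bigr => l _; apply: eq_bigr => k _.
  by rewrite /f derive1n_jet_poly// -ltnS.
by split=> h i j ij; [rewrite e// h|rewrite -e// h].
Qed.

End Jets.

(** * Linear systems *)

Section Systems.
Variable R : realType.
Implicit Types (f g : 'rV[R]_2 -> R) (U S : set 'rV[R]_2) (x y z : 'rV[R]_2).

Lemma anl_inv g x : anl g x -> g x != 0 -> anl (fun z => (g z)^-1) x.
Proof.
move=> ag gx; have g2 : 0 < `|g x| / 2 by rewrite divr_gt0// normr_gt0.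
have [d d0 hd] := (continuous_boxP _ _).1 (anl_continuous ag) _ g2.
have [e e0 ae] := ag.
exists (Num.min d e); first by rewrite lt_min d0.
apply: (anb_inv (@box_open _ _ _) g2).
  by apply: anb_sub ae; apply: box_le; rewrite ge_min lexx orbT.
move=> z; rewrite /box /= lt_min => /andP[/hd zd _].
have := lerB_dist (g x) (g z); rewrite distrC in zd; move: zd.
by move: `|g x - g z| `|g x| `|g z| => *; lra.
Qed.

Lemma anl_family (I : finType) (F : I -> 'rV[R]_2 -> R) x : (forall i, anl (F i) x) ->
  exists d B s : R, [/\ 0 < d, 0 <= B, 0 <= s &
    forall i n, dbound n (box x d) (box x d) (F i) (gevrey B s 0)].
Proof.
move=> aF.
have : exists d B s : R, [/\ 0 < d, 0 <= B, 0 <= s &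
    forall i, i \in enum I -> forall n, dbound n (box x d) (box x d) (F i) (gevrey B s 0)].
  elim: (enum I) => [|i r [d [B [s [d0 B0 s0 h]]]]]; first by exists 1, 0, 0; split.
  have [e e0 [C [q [C0 q0 k]]]] := aF i.
  exists (Num.min d e), (B + C), (s + q); split; rewrite ?addr_ge0 ?lt_min ?d0//.
  move=> j; rewrite inE => /orP[/eqP ->|jr] n.
    apply: dbound_le (dbound_sub _ _ (k n)) _ => [||m _].
    - by apply: box_le; rewrite ge_min lexx orbT.
    - by apply: box_le; rewrite ge_min lexx orbT.
    - by apply: gevrey_mono; rewrite ?lerDr.
  apply: dbound_le (dbound_sub _ _ (h j jr n)) _ => [||m _].
  - by apply: box_le; rewrite ge_min lexx.
  - by apply: box_le; rewrite ge_min lexx.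
  - by apply: gevrey_mono; rewrite ?lerDl.
move=> [d [B [s [d0 B0 s0 h]]]]; exists d, B, s; split=> // i n.
by apply: h; rewrite mem_enum.
Qed.

Lemma dboundM0 n U S f g s : open U -> S `<=` U ->
  dbound n U S f s -> dbound n U S g (fun=> 0) -> dbound n U S (f \* g) (fun=> 0).
Proof.
move=> oU SU df dg; apply: dbound_le (dboundM oU SU df dg) _ => k _.
by rewrite /binom_conv big1// => i _; rewrite mulr0 mul0rn.
Qed.

(* A formal solution of a linear Pfaffian system with analytic coefficients
   converges; the remainders r only matter through their jets at x. *)
Lemma system_bound (J : finType) (v : J -> 'rV[R]_2 -> R)
    (b : 'I_2 -> J -> J -> 'rV[R]_2 -> R) (r : 'I_2 -> J -> 'rV[R]_2 -> R)
    U x n (C B s q : R) : open U -> U x ->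
  0 <= C -> 0 <= B -> 0 <= s -> 2 * s <= q -> 2 * B * #|J|%:R <= q ->
  (forall i j k m, dbound m U U (b i j k) (gevrey B s 0)) ->
  (forall j z, U z -> {for z, continuous (v j)}) ->
  (forall i j z, U z -> derivable (v j) z (bvec i)) ->
  (forall i j z, U z -> pd i (v j) z = \sum_k b i j k z * v k z + r i j z) ->
  (forall i j, dbound n U [set x] (r i j) (fun=> 0)) ->
  (forall j, `|v j x| <= C) ->
  forall m j, (m <= n.+1)%N -> dbound m U [set x] (v j) (gevrey C q 0).
Proof.
move=> oU Ux C0 B0 s0 sq Bq db cv dv pv dr vC.
have SU : [set x] `<=` U by move=> z ->.
have q0 : 0 <= q by apply: le_trans sq; rewrite mulr_ge0.
have g0 j z : [set x] z -> `|v j z| <= gevrey C q 0 0.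
  by move=> ->; rewrite /gevrey expr0 !mulr1.
elim=> [|m IH] j mn; (split; [exact: cv|exact: g0|]); first exact: I.
move=> i; split; first exact: dv.
apply: (@dbound_ext _ _ _ _ ((fun z => \sum_k b i j k z * v k z) \+ r i j)) => //.
  by move=> z Uz; rewrite pv.
have d1 : dbound m U [set x] (fun z => \sum_k b i j k z * v k z)
    (fun l => gevrey (2 * B * C) q 0 l *+ #|J|).
  have -> : #|J| = size (index_enum J) by rewrite -sum1_size -sum1_card.
  apply: (@dbound_sum _ _ _ _ _ _ (fun k => b i j k \* v k)) => //.
    by move=> l; rewrite gevrey_ge0 ?mulr_ge0.
  move=> k; apply: (@dboundM_gevrey _ _ _ _ _ _ B s) => //.
    by apply: dbound_sub (db i j k m).
  by apply: IH; exact: ltnW.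
apply: dbound_le (dboundD oU SU d1 (dbound_order _ (dr i j))) _; first by [].
(* The product costs 2B and the sum over [k] costs #|J|; both fit into the single factor q that the
   derivative gains, so the same C and q serve at every order. *)
move=> l _; rewrite addr0 gevrey_shift.
apply: le_trans (_ : gevrey (C * q) q 0 l <= _); last first.
  by rewrite gevrey_le_shift// mulr_ge0.
have -> : gevrey (2 * B * C) q 0 l *+ #|J| = gevrey (C * (2 * B * #|J|%:R)) q 0 l.
  by rewrite /gevrey -mulr_natr; ring.
by apply: gevrey_le => //; rewrite ler_wpM2l.
Qed.

End Systems.

(** * Decreasing sequences of subspaces *)

Section Subspaces.
Variable R : realType.

(** A matrix of maximal rank among those with row space inside [W] works: a vector of [W] outside
    its row space would raise the rank. *)
Lemma subspace_mx n (W : 'rV[R]_n -> Prop) : W 0 ->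
  (forall k u v, W u -> W v -> W (k *: u + v)) ->
  exists A : 'M[R]_n, forall w, W w <-> (w <= A)%MS.
Proof.
move=> W0 WL.
pose P k := `[< exists A : 'M[R]_n, \rank A = k /\ forall w, (w <= A)%MS -> W w >].
have P0 : exists k, P k.
  exists 0%N; apply/asboolP; exists 0; split; first exact: mxrank0.
  by move=> w; rewrite submx0 => /eqP ->.
have Pn k : P k -> (k <= n)%N by move=> /asboolP[A [<- _]]; exact: rank_leq_row.
case: (ex_maxnP P0 Pn) => k /asboolP [A [rA hA]] kmax.
exists A => w; split=> [Ww|]; last exact: hA.
apply: contrapT => /negP nwA.
have rk : (k < \rank (A + w)%MS)%N.
  rewrite -rA ltn_neqAle mxrankS ?addsmxSl// andbT.
  apply: contra nwA => /eqP rr.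
  have := mxrank_leqif_sup (addsmxSl A w) => -[_]; rewrite rr eqxx => /esym.
  by move=> /(submx_trans (addsmxSr A w)).
have : P (\rank (A + w)%MS).
  apply/asboolP; exists (A + w)%MS; split=> // u /sub_addsmxP [[D1 D2] /= ->].
  rewrite [D2]mx11_scalar mul_scalar_mx addrC; apply: WL => //.
  by apply: hA; exact: submxMl.
by move=> /kmax; rewrite leqNgt rk.
Qed.

(** The sequence is constant from the index at which the dimension is minimal, so a nonzero vector
    taken there lies in every member. *)
Lemma common_vector n (W : nat -> 'rV[R]_n -> Prop) : (forall N, W N 0) ->
  (forall N k u v, W N u -> W N v -> W N (k *: u + v)) ->
  (forall N w, W N.+1 w -> W N w) ->
  (forall N, exists2 w, w != 0 & W N w) ->
  exists2 w, w != 0 & forall N, W N w.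
Proof.
move=> W0 WL Wdec Wn.
have Wle N M w : (N <= M)%N -> W M w -> W N w.
  move=> /subnK <-; elim: (M - N)%N => [|k IH] //; rewrite addSn => /Wdec; exact: IH.
have /choice [A hA] N := subspace_mx (W0 N) (WL N).
have ex : exists k, `[< exists N, \rank (A N) = k >].
  by exists (\rank (A 0%N)); apply/asboolP; exists 0%N.
case: (ex_minnP ex) => k /asboolP[N0 rN0] kmin.
have [w wn /hA wA] := Wn N0; exists w => // N.
have [NN|NN] := leqP N N0; first by apply: Wle NN _; exact/hA.
have sA : (A N <= A N0)%MS.
  by apply/rV_subP => u /hA uN; apply/hA; apply: Wle uN; exact: ltnW.
have rr : (\rank (A N) == \rank (A N0))%N.
  by rewrite eqn_leq mxrankS//= rN0; apply: kmin; apply/asboolP; exists N.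
have := mxrank_leqif_sup sA => -[_]; rewrite rr => /esym sA'.
by apply/hA; apply: submx_trans wA sA'.
Qed.

End Subspaces.

(** * Elimination and growth of the jets in the kernel *)

Section JetGrowth.
Variable R : realType.
Implicit Types (x y z : 'rV[R]_2) (U : set 'rV[R]_2).

(** The Jacobian determinant, nonzero exactly where the gradients are independent. *)
Definition wedge (f g : 'rV[R]_2 -> R) z : R :=
  pd 0 f z * pd 1 g z - pd 1 f z * pd 0 g z.

(** The gradient after a quarter turn: it annihilates the gradient of [f] and pairs with that of g
    to [wedge f g]. *)
Definition rot_grad (f : 'rV[R]_2 -> R) (p : 'I_2) z : R :=
  if p == 0 then - pd 1 f z else pd 0 f z.

Variables (a phi : 'I_3 -> 'rV[R]_2 -> R).

Section Elimination.
Variables (U : set 'rV[R]_2) (u : 'I_3 -> nat -> 'rV[R]_2 -> R).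
Hypotheses (oU : open U) (aa : forall l z, U z -> anl (a l) z)
  (aphi : forall l z, U z -> anl (phi l) z)
  (du : forall l k i z, U z ->
     is_derive z (bvec i) (u l k) (pd i (phi l) z * u l k.+1 z)).

(** [u l k] plays the composite of f_l^(k) with phi_l, through the relation [du] between consecutive
    indices. *)
Lemma is_derive_comp_sum k p (g : 'I_3 -> 'rV[R]_2 -> R) z : U z ->
  (forall l, anl (g l) z) ->
  is_derive z (bvec p) (fun y => \sum_l g l y * u l k y)
    (\sum_l (pd p (g l) z * u l k z + g l z * pd p (phi l) z * u l k.+1 z)).
Proof.
move=> Uz ag; apply: is_derive_fsum => l.
have d1 := DeriveDef (@anl_derivable _ _ _ p (ag l)) erefl.
apply: is_derive_eq (is_deriveM d1 (du l k p Uz)) _; rewrite /GRing.scale /=.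
rewrite /pd; move: (derive _ _ _) (derive _ _ _) (g l z) (u l k z) (u l k.+1 z) => *.
ring.
Qed.

Definition coef_order0 l p q z := pd p (pd q (a l)) z.
Definition coef_order1 l p q z :=
  pd q (a l) z * pd p (phi l) z + pd p (a l \* pd q (phi l)) z.

Lemma pd2_comp_sum p q z : U z ->
  pd p (pd q (fun y => \sum_l a l y * u l 0%N y)) z =
  \sum_l (coef_order0 l p q z * u l 0%N z + coef_order1 l p q z * u l 1%N z +
    a l z * (pd p (phi l) z * pd q (phi l) z) * u l 2%N z).
Proof.
move=> Uz.
have e y : U y -> pd q (fun y => \sum_l a l y * u l 0%N y) y =
    ((fun y => \sum_l pd q (a l) y * u l 0%N y) \+
     (fun y => \sum_l (a l \* pd q (phi l)) y * u l 1%N y)) y.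
  move=> Uy; rewrite {1}/pd.
  case: (is_derive_comp_sum 0 q Uy (fun l => aa l Uy)) => _ ->.
  by rewrite big_split.
rewrite (pd_eq p oU e Uz).
have d1 := is_derive_comp_sum 0 p Uz (fun l => anl_pd q (aa l Uz)).
have d2 := is_derive_comp_sum 1 p Uz
  (fun l => anlM (aa l Uz) (anl_pd q (aphi l Uz))).
rewrite {1}/pd; case: (is_deriveD d1 d2) => _ ->.
rewrite -big_split /=; apply: eq_bigr => l _.
rewrite /coef_order0 /coef_order1 /=.
move: (pd p (pd q (a l)) z) (pd q (a l) z) (pd p (phi l) z) (pd q (phi l) z)
  (pd p (a l \* pd q (phi l)) z) (a l z) (u l 0%N z) (u l 1%N z) (u l 2%N z) => *.
ring.
Qed.

Lemma rot_grad_sum f g z : \sum_p rot_grad f p z * pd p g z = wedge f g z.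
Proof.
rewrite big_ord_recl big_ord1 /rot_grad /wedge /=.
have -> : lift ord0 ord0 = 1 :> 'I_2 by apply/val_inj.
move: (pd 0 f z) (pd 1 f z) (pd 0 g z) (pd 1 g z) => *; ring.
Qed.

(** Addition in ['I_3] is cyclic, so [l + 1] and [l + 2] are the two other indices. *)
Definition elim_coef (l : 'I_3) p q z :=
  rot_grad (phi (l + 1)) p z * rot_grad (phi (l + 2)) q z.

Definition elim_lead l z := a l z * (wedge (phi (l + 1)) (phi l) z *
  wedge (phi (l + 2)) (phi l) z).

(** The boolean, read as 0 or 1, is the order of the derivative that the coefficient multiplies; the
    unknowns of the linear system are indexed in the same way. *)
Definition elim_rest (t : bool) l l' z := \sum_p \sum_q elim_coef l p q z *
  (if t then coef_order1 l' p q z else coef_order0 l' p q z).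

(* Contracting the Hessian of the sum with the vectors orthogonal to the other
   two gradients isolates the second derivative of one unknown. *)
Lemma second_order_elim l z : U z ->
  \sum_p \sum_q elim_coef l p q z * pd p (pd q (fun y => \sum_l a l y * u l 0%N y)) z =
  elim_lead l z * u l 2%N z +
  \sum_l' (elim_rest false l l' z * u l' 0%N z + elim_rest true l l' z * u l' 1%N z).
Proof.
move=> Uz.
have w0 l' : wedge (phi l') (phi l') z = 0 by rewrite /wedge mulrC subrr.
transitivity (\sum_l' (a l' z * (wedge (phi (l + 1)) (phi l') z *
    wedge (phi (l + 2)) (phi l') z) * u l' 2%N z +
  (elim_rest false l l' z * u l' 0%N z + elim_rest true l l' z * u l' 1%N z))).
  transitivity (\sum_p \sum_q \sum_l' (elim_coef l p q z *
    (coef_order0 l' p q z * u l' 0%N z + coef_order1 l' p q z * u l' 1%N z +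
    a l' z * (pd p (phi l') z * pd q (phi l') z) * u l' 2%N z))).
    apply: eq_bigr => p _; apply: eq_bigr => q _.
    by rewrite pd2_comp_sum// mulr_sumr.
  under eq_bigr => p _ do rewrite exchange_big.
  rewrite exchange_big; apply: eq_bigr => l' _ /=.
  rewrite -!rot_grad_sum big_distrlr /= !mulr_suml mulr_sumr mulr_suml -!big_split /=.
  apply: eq_bigr => p _.
  rewrite !mulr_suml mulr_sumr mulr_suml -!big_split /=.
  apply: eq_bigr => q _; rewrite /elim_coef.
  move: (coef_order0 _ _ _ _) (coef_order1 _ _ _ _) (rot_grad _ _ _) (rot_grad _ _ _)
    (pd _ _ _) (pd _ _ _) (a _ _) (u _ _ _) (u _ _ _) (u _ _ _) => *; ring.
rewrite big_split /=; congr (_ + _).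
rewrite (bigD1 l) //= [X in _ + X]big1 ?addr0// => l' l'l.
have [->|->] : l' = l + 1 \/ l' = l + 2.
  case: l l' l'l => -[|[|[|//]]] i [[|[|[|//]]] j] //= _;
    ((left; exact/val_inj) || (right; exact/val_inj)).
- by rewrite w0 mul0r mulr0 mul0r.
- by rewrite w0 !mulr0 mul0r.
Qed.

End Elimination.

Lemma anl_nonzero_near (f : 'rV[R]_2 -> R) x : anl f x -> f x != 0 ->
  exists2 d : R, 0 < d & forall z, box x d z -> f z != 0.
Proof.
move=> af fx; have f0 : 0 < `|f x| by rewrite normr_gt0.
have [d d0 hd] := (continuous_boxP _ _).1 (anl_continuous af) _ f0.
exists d => // z /hd; apply: contraTneq => ->; rewrite sub0r normrN ltxx //.
Qed.

Lemma anb_horner U (f : 'rV[R]_2 -> R) (p : {poly R}) : open U -> anb U f ->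
  anb U (fun z => p.[f z]).
Proof.
move=> oU af; elim/poly_ind: p => [|p k IH].
  by apply: (anb_ext oU _ (anb_cst U 0)) => z _; rewrite horner0.
apply: (anb_ext oU _ (anbD oU (anbM oU IH af) (anb_cst U k))) => z _.
by rewrite hornerMXaddC.
Qed.

Lemma anl_wedge (f g : 'rV[R]_2 -> R) x : anl f x -> anl g x -> anl (wedge f g) x.
Proof.
move=> af ag; apply: anlD; first by apply: anlM; exact: anl_pd.
by apply: anlN; apply: anlM; exact: anl_pd.
Qed.

Lemma anl_rot_grad (f : 'rV[R]_2 -> R) p x : anl f x -> anl (rot_grad f p) x.
Proof.
move=> af; rewrite /rot_grad; case: (p == 0); last exact: anl_pd.
by apply: anlN; exact: anl_pd.
Qed.

Section AnalyticCoefficients.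
Variable x : 'rV[R]_2.
Hypotheses (aa : forall l, anl (a l) x) (aphi : forall l, anl (phi l) x).

Lemma anl_elim_coef l p q : anl (elim_coef l p q) x.
Proof. by apply: anlM; exact: anl_rot_grad. Qed.

Lemma anl_elim_lead l : anl (elim_lead l) x.
Proof. by apply: anlM => //; apply: anlM; exact: anl_wedge. Qed.

Lemma anl_elim_rest t l l' : anl (elim_rest t l l') x.
Proof.
apply: anl_sum => p; apply: anl_sum => q; apply: anlM; first exact: anl_elim_coef.
case: t; last by do 2!apply: anl_pd.
apply: anlD; first by apply: anlM; exact: anl_pd.
by apply: anl_pd; apply: anlM => //; exact: anl_pd.
Qed.

Hypotheses (a0 : forall l, a l x != 0)
  (w0 : forall k m, k != m -> wedge (phi k) (phi m) x != 0).

Lemma elim_lead_neq0 l : elim_lead l x != 0.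
Proof.
rewrite /elim_lead !mulf_neq0//; apply: w0; case: l => -[|[|[|//]]] i //.
Qed.

Lemma pd_direction l : exists i, pd i (phi l) x != 0.
Proof.
have /eqP h : wedge (phi l) (phi (l + 1)) x != 0.
  by apply: w0; case: l => -[|[|[|//]]] i.
have [l0|l0] := eqVneq (pd 0 (phi l) x) 0; last by exists 0.
have [l1|l1] := eqVneq (pd 1 (phi l) x) 0; last by exists 1.
by case: h; rewrite /wedge l0 l1 !mul0r subrr.
Qed.

(** The constant [A] is fixed before [n], [c] and [C]. The composites of orders 0 and 1 solve a
    linear system up to a flat remainder, so [system_bound] controls them at [x]; dividing by a
    nonzero partial derivative of phi_l recovers the higher f_l^(k). *)
Theorem jet_growth : exists2 A : R, 0 <= A & forall n c (C : R),
  jet_solution a phi x n.+2 c -> 0 <= C ->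
  (forall l, `|c l 0%N| <= C /\ `|c l 1%N| <= C) ->
  forall l k, (k <= n.+2)%N -> `|c l k| <= C * A ^+ k * (k`!)%:R.
Proof.
have /choice [dir dir0] := pd_direction.
(* A single product, so that one neighbourhood makes every denominator nonzero. *)
pose nz z := \prod_l elim_lead l z * \prod_l pd (dir l) (phi l) z.
have anz : anl nz x.
  apply: anlM; apply: anl_prod => l _; first exact: anl_elim_lead.
  by apply: anl_pd.
have nz0 : nz x != 0.
  by rewrite mulf_neq0//; apply/prodf_neq0 => l _ //; exact: elim_lead_neq0.
have [d1 d10 nzd] := anl_nonzero_near anz nz0.
have leadU z l : box x d1 z -> elim_lead l z != 0.
  by move=> /nzd; rewrite mulf_eq0 negb_or => /andP[/prodf_neq0 h _]; exact: h.
have dirU z l : box x d1 z -> pd (dir l) (phi l) z != 0.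
  by move=> /nzd; rewrite mulf_eq0 negb_or => /andP[_ /prodf_neq0 h]; exact: h.
pose J : finType := ('I_3 * bool)%type.
pose e i l z := pd i (phi l) z * (elim_lead l z)^-1.
(* Rows of order 0 express the chain rule; rows of order 1 come from solving the contracted Hessian
   for the second derivative, whose coefficient is [elim_lead]. *)
pose b i (j k : J) z : R := if j.2 then - (e i j.1 z * elim_rest k.2 j.1 k.1 z)
  else if k == (j.1, true) then pd i (phi j.1) z else 0.
have ae i l : anl (e i l) x.
  by apply: anlM; [exact: anl_pd|apply: anl_inv; [exact: anl_elim_lead|exact: elim_lead_neq0]].
have ab i j k : anl (b i j k) x.
  rewrite /b; case: j.2; first by apply: anlN; apply: anlM => //; exact: anl_elim_rest.
  by case: (k == _); [exact: anl_pd|exact: anl_cst].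
pose rc i l p q z := e i l z * elim_coef l p q z.
(* All coefficient functions are gathered in one finite family, to share one box and one pair of
   constants B, s. *)
pose F (t : ('I_2 * J * J) + ('I_3 + ('I_3 + ('I_3 + 'I_2 * 'I_3 * 'I_2 * 'I_2)))) z :=
  match t with
  | inl ijk => b ijk.1.1 ijk.1.2 ijk.2 z
  | inr (inl l) => (pd (dir l) (phi l) z)^-1
  | inr (inr (inl l)) => a l z
  | inr (inr (inr (inl l))) => phi l z
  | inr (inr (inr (inr ilpq))) => rc ilpq.1.1.1 ilpq.1.1.2 ilpq.1.2 ilpq.2 z
  end.
have aF t : anl (F t) x.
  rewrite /F; case: t => [ijk|[l|[l|[l|ilpq]]]]; [exact: ab| |exact: aa|exact: aphi|].
    by apply: anl_inv => //; exact: anl_pd.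
  by apply: anlM => //; exact: anl_elim_coef.
have [d2 [B [s [d20 B0 s0 dF]]]] := anl_family aF.
pose d := Num.min d1 d2; have dp : 0 < d by rewrite lt_min d10.
pose U := box x d; have oU : open U := @box_open _ x d.
have Ux : U x := box_center x dp.
have U1 : U `<=` box x d1 by apply: box_le; rewrite ge_min lexx.
have dU t n : dbound n U U (F t) (gevrey B s 0).
  by apply: dbound_sub (dF t n); apply: box_le; rewrite ge_min lexx orbT.
have SU : [set x] `<=` U by move=> z ->.
have bF t : anb U (F t) by exists B, s.
have aU l z : U z -> anl (a l) z.
  by move=> Uz; exact: anb_anl oU Uz (bF (inr (inr (inl l)))).
have phiU l z : U z -> anl (phi l) z.
  by move=> Uz; exact: anb_anl oU Uz (bF (inr (inr (inr (inl l))))).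
pose q := 2 * s + 2 * B * #|J|%:R.
have q1 : 2 * s <= q by rewrite lerDl !mulr_ge0.
have q2 : 2 * B * #|J|%:R <= q by rewrite lerDr mulr_ge0.
have q0 : 0 <= q by rewrite addr_ge0// ?mulr_ge0// mulr_ge0.
(* [dbound_vector_field] grows by 2Bq per derivative; the summand 1 gives A >= 1, which absorbs the
   offset between A^k and A^(k+1) at the end. *)
pose A := 2 * B * q + 1.
have A1 : 1 <= A by rewrite lerDr !mulr_ge0.
exists A; first by apply: le_trans A1.
move=> n c C sol C0 cC.
pose p l := jet_poly (c l) n.+2 (phi l x).
pose u l k z := (derivn k (p l)).[phi l z].
have ux l k : (k <= n.+2)%N -> u l k x = c l k.
  by move=> kn; rewrite /u -derive1n_horner derive1n_jet_poly.
have bu l k : anb U (u l k) by apply: anb_horner => //; exact: bF (inr (inr (inr (inl l)))).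
have du l k i z : U z -> is_derive z (bvec i) (u l k) (pd i (phi l) z * u l k.+1 z).
  move=> Uz; rewrite mulrC.
  have h1 := DeriveDef (@anl_derivable _ _ _ i (phiU l z Uz)) erefl.
  have h2 : is_derive (phi l z) 1 (horner (derivn k (p l))) (derivn k.+1 (p l)).[phi l z].
    by rewrite derivnS; exact: is_derive_poly.
  exact: is_derive_comp h2 h1.
have pdu l k i z : U z -> pd i (u l k) z = pd i (phi l) z * u l k.+1 z.
  by move=> Uz; rewrite {1}/pd; case: (du l k i z Uz) => _ ->.
pose G z := \sum_l a l z * u l 0%N z.
(* Two of these n + 2 orders are spent on the Hessian, which leaves a remainder flat to order n,
   bounds on the unknowns to order n + 1, and values of f_l^(k) for k <= n + 2. *)
have flatG : dbound n.+2 U [set x] G (fun=> 0).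
  have bG : anb U G.
    by apply: anb_sum => // l; apply: anbM => //; exact: bF (inr (inr (inl l))).
  have [C1 [k1 [_ _ dG]]] := bG.
  apply: (@dbound_flat _ _ _ _ _ _ oU Ux (dbound_sub _ _ (dG n.+2))) => //.
  have := (jet_solution_of_poly n.+2 c aa aphi).1 sol.
  have -> // : Gsum a phi (fun l => horner (jet_poly (c l) n.+2 (phi l x))) = G.
  by apply/funext => z; apply: eq_bigr => l _; rewrite /u derivn0.
pose r i (j : J) z := if j.2 then
  \sum_p \sum_q rc i j.1 p q z * pd p (pd q G) z else 0.
pose v (j : J) := u j.1 (nat_of_bool j.2).
have dv m j : (m <= n.+1)%N -> dbound m U [set x] (v j) (gevrey C q 0).
  apply: (@system_bound _ J v b r U x n C B s q) => //.
  - by move=> i j1 k1 m1; exact: dU (inl (i, j1, k1)) m1.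
  - by move=> j1 z Uz; apply: anb_continuous (bu _ _) Uz.
  - by move=> i j1 z Uz; case: (du j1.1 j1.2 i z Uz).
  - move=> i [l t] z Uz; rewrite pdu// /r /v /=.
    have e2 : \sum_p0 \sum_q0 rc i l p0 q0 z * pd p0 (pd q0 G) z = e i l z *
        \sum_p0 \sum_q0 elim_coef l p0 q0 z * pd p0 (pd q0 G) z.
      rewrite mulr_sumr; apply: eq_bigr => p0 _; rewrite mulr_sumr.
      by apply: eq_bigr => q0' _; rewrite -mulrA.
    case: t => /=; last first.
      rewrite addr0 (bigD1 (l, true))//= big1 ?addr0 => [|k kl].
        by rewrite /b /= eqxx.
      by rewrite /b /= (negPf kl) mul0r.
    rewrite e2 (second_order_elim oU aU phiU du _ Uz).
    have -> : \sum_k b i (l, true) k z * u k.1 k.2 z = - (e i l z *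
       \sum_l' (elim_rest false l l' z * u l' 0%N z + elim_rest true l l' z * u l' 1%N z)).
      rewrite -(pair_bigA _ (fun l' (t : bool) => b i (l, true) (l', t) z * u l' t z)) /=.
      rewrite mulr_sumr -sumrN; apply: eq_bigr => l' _; rewrite big_bool /b /=.
      move: (e _ _ _) (elim_rest _ _ _ _) (elim_rest _ _ _ _) (u _ _ _) (u _ _ _).
      by move=> *; ring.
    have := leadU z l (U1 z Uz); rewrite /e.
    move: (pd _ _ _) (elim_lead _ _) (u _ _ _) (\sum_l' _) => x1 x2 x3 x4 x20.
    by field.
  - move=> i [l t]; rewrite /r /=; case: t; last exact: dbound_zero.
    have dsum (I : finType) (H : I -> 'rV[R]_2 -> R) :
        (forall t, dbound n U [set x] (H t) (fun=> 0)) ->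
        dbound n U [set x] (fun z => \sum_t H t z) (fun=> 0).
      by move=> dH; apply: dbound_le (dbound_sum _ oU SU _ dH) _ => //= k _; rewrite mul0rn.
    apply: (dsum _) => p0; apply: (dsum _) => q0'.
    apply: (@dboundM0 _ _ _ _ _ _ (gevrey B s 0) oU SU).
      exact: dbound_sub (dU (inr (inr (inr (inr (i, l, p0, q0'))))) n).
    exact: (dbound_pd p0 (dbound_pd q0' flatG)).
  - move=> [l t]; rewrite /v /=; case: t; rewrite ux//; [exact: (cC l).2|exact: (cC l).1].
move=> l [|k] kn.
  by rewrite expr0 fact0 !mulr1; exact: (cC l).1.
(* The recursion starts from the composite of order 1, so k steps reach the derivative of order k +
   1. *)
have dk : dbound (n.+1 - k) U [set x] (u l k.+1) (gevrey (C * (2 * B * q) ^+ k) q k).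
  apply: (@dbound_vector_field R n.+1 U [set x] (fun k => u l k.+1)
    (fun z => (pd (dir l) (phi l) z)^-1) C q B s (dir l) k) => //.
  - move=> k' z Uz; rewrite pdu// mulKf//; exact: dirU (U1 z Uz).
  - exact: (dv n.+1 (l, true)).
  - exact: dbound_sub (dU (inr (inl l)) n.+1).
have /= := dbound0 dk (erefl x); rewrite ux// => h; apply: le_trans h _.
rewrite /gevrey expr0 mulr1 add0n -[leRHS]mulrA -[leLHS]mulrA ler_wpM2l//.
have Bq0 : 0 <= 2 * B * q by rewrite !mulr_ge0.
apply: ler_pM; rewrite ?exprn_ge0//; last by rewrite ler_nat leq_fact.
apply: (@le_trans _ _ (A ^+ k)); last by rewrite exprSr ler_peMr// exprn_ge0// (le_trans _ A1).
by rewrite lerXn2r ?nnegrE// ?lerDl// (le_trans _ A1).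
Qed.

End AnalyticCoefficients.

End JetGrowth.

(** * Formal solutions *)

Section FormalSolution.
Variable R : realType.
Implicit Types (x y z : 'rV[R]_2) (U : set 'rV[R]_2).
Variables (a phi : 'I_3 -> 'rV[R]_2 -> R).

Lemma jet_solutionS x M c : jet_solution a phi x M.+1 c -> jet_solution a phi x M c.
Proof.
move=> sol i j ij; rewrite -[RHS](sol i j (leqW ij)); apply: eq_bigr => l _.
rewrite [RHS]big_ord_recr /= (jet_coef_supp (a l) (phi l)) ?mul0r ?addr0//.
Qed.

Lemma jet_solution_le x M N c : (M <= N)%N ->
  jet_solution a phi x N c -> jet_solution a phi x M c.
Proof.
by move=> /subnK <-; elim: (N - M)%N => [|k IH] //; rewrite addSn => /jet_solutionS.
Qed.

Lemma jet_solution_comb x M (t : R) c d :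
  jet_solution a phi x M c -> jet_solution a phi x M d ->
  jet_solution a phi x M (fun l k => t * c l k + d l k).
Proof.
move=> sc sd i j ij.
transitivity (t * (\sum_l \sum_(k < M.+1) jet_coef (a l) (phi l) i j k x * c l k) +
  \sum_l \sum_(k < M.+1) jet_coef (a l) (phi l) i j k x * d l k).
  2: by rewrite sc// sd// mulr0 addr0.
rewrite mulr_sumr -big_split /=; apply: eq_bigr => l _.
rewrite mulr_sumr -big_split /=; apply: eq_bigr => k _.
by rewrite mulrDr mulrCA.
Qed.

Section AtPoint.
Variable x : 'rV[R]_2.
Hypotheses (aa : forall l, anl (a l) x) (aphi : forall l, anl (phi l) x)
  (a0 : forall l, a l x != 0)
  (w0 : forall k m, k != m -> wedge (phi k) (phi m) x != 0).

(** Passing to the limit takes place among first order jets, a space of fixed finite dimension,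
    since each of them determines its whole solution. *)
Lemma formal_solution : (forall n, ~ jet_injective a phi x n.+2) ->
  exists (c : 'I_3 -> nat -> R) (C A : R), [/\ 0 <= C, 0 <= A,
    forall M, jet_solution a phi x M c,
    forall l k, `|c l k| <= C * A ^+ k * (k`!)%:R &
    ~ (forall l, c l 0%N = 0 /\ c l 1%N = 0)].
Proof.
move=> ninj; have [A A0 growth] := jet_growth aa aphi a0 w0.
pose J : finType := ('I_3 * bool)%type.
pose W n (w : 'rV[R]_#|J|) := exists2 c, jet_solution a phi x n.+2 c &
  forall j : J, w 0 (enum_rank j) = c j.1 (nat_of_bool j.2).
(* The growth bound with C = 0. *)
have uniq0 n c : jet_solution a phi x n.+2 c ->
    (forall l, c l 0%N = 0 /\ c l 1%N = 0) ->
    forall l k, (k <= n.+2)%N -> c l k = 0.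
  move=> sc c0 l k kn; apply/eqP; rewrite -normr_le0.
  have := growth n c 0 sc (lexx 0) _ l k kn; rewrite !mul0r; apply=> l'.
  by case: (c0 l') => -> ->; rewrite normr0.
have [n|n t w1 w2|n w [c sc wc]|n|w wn hw] := @common_vector R #|J| W.
- exists (fun _ _ => 0) => [i j _|j]; last by rewrite mxE.
  by rewrite big1// => l _; rewrite big1// => k _; rewrite mulr0.
- move=> [c s1 e1] [d s2 e2]; exists (fun l k => t * c l k + d l k).
    exact: jet_solution_comb.
  by move=> j; rewrite !mxE e1 e2.
- by exists c => //; exact: jet_solutionS.
- apply: contrapT => h; apply: (ninj n) => c sc; apply: (uniq0 n c sc) => l.
  pose w : 'rV[R]_#|J| := \row_i c (enum_val i).1 (nat_of_bool (enum_val i).2).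
  have wE j : w 0 (enum_rank j) = c j.1 (nat_of_bool j.2) by rewrite mxE enum_rankK.
  have [w00|w00] := eqVneq w 0; last by case: h; exists w => //; exists c.
  by rewrite -(wE (l, false)) -(wE (l, true)) w00 !mxE.
have /choice [cc ccP] : forall n, exists c, jet_solution a phi x n.+2 c /\
  forall j : J, w 0 (enum_rank j) = c j.1 (nat_of_bool j.2).
  by move=> n; case: (hw n) => c; exists c.
(* The difference solves the lower order problem with zero first order jet. Hence the chosen
   solutions extend one another, and their diagonal is a solution of every order. *)
have agree m n l k : (m <= n)%N -> (k <= m.+2)%N -> cc m l k = cc n l k.
  move=> mn km; have [s1 e1] := ccP m; have [s2 e2] := ccP n.
  have s2' : jet_solution a phi x m.+2 (cc n) by apply: jet_solution_le s2; rewrite !ltnS.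
  apply/eqP; rewrite -subr_eq0 -[_ - _]opprB oppr_eq0 -[- cc m l k]mulN1r addrC; apply/eqP.
  apply: (uniq0 m _ (jet_solution_comb (-1) s1 s2')) => // l'.
  by rewrite -(e1 (l', false)) -(e1 (l', true)) -(e2 (l', false)) -(e2 (l', true))
    !mulN1r !addNr.
pose c l k := cc k l k.
have cE n l k : (k <= n.+2)%N -> cc n l k = c l k.
  move=> kn; have [nk|/ltnW kn'] := leqP n k; first exact: agree.
  by apply/esym; apply: agree => //; rewrite !leqW.
have solc M : jet_solution a phi x M c.
  apply: (jet_solution_le (leqW (leqnSn M))) => i j ij.
  have [s1 _] := ccP M; rewrite -[RHS](s1 i j ij).
  by apply: eq_bigr => l _; apply: eq_bigr => k _; rewrite cE// -ltnS.
pose C := \sum_l (`|c l 0%N| + `|c l 1%N|).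
have C0 : 0 <= C by apply: sumr_ge0 => l _; rewrite addr_ge0.
have cC l : `|c l 0%N| + `|c l 1%N| <= C.
  by rewrite /C (bigD1 l) //= lerDl; apply: sumr_ge0 => l' _; rewrite addr_ge0.
exists c, C, A; split=> // [l k|c00].
  apply: (growth k c C (solc _)) => // [l'|]; last by rewrite !leqW.
  by split; apply: le_trans (cC l'); rewrite ?lerDl ?lerDr.
case/eqP: wn; apply/rowP => i; rewrite mxE -[i]enum_valK.
have [_ ->] := ccP 0%N; rewrite cE; last by case: (enum_val i).2.
by case: (enum_val i) => l [] /=; case: (c00 l).
Qed.

(** Otherwise a nonzero formal solution exists and converges; its sum G is analytic and flat at [x],
    hence zero nearby, and the main hypothesis kills the first order jet. *)
Lemma nondegenerate_jet_injective Bt : open Bt -> Bt x -> main_hypothesis Bt a phi ->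
  exists n, jet_injective a phi x n.+2.
Proof.
move=> oB Bx mh; apply: contrapT => /forallNP /formal_solution.
move=> [c [C [A [C0 A0 sol cC]]]]; apply => l.
pose f l := psum1 (fun k => c l k / (k`!)%:R) (phi l x).
have p0 : 0 < 32 * A + 1 by rewrite ltr_wpDl// mulr_ge0.
(* Meets the threshold [32 * A * d <= 1] of [psum1_spec], also when A = 0. *)
pose d := (32 * A + 1)^-1; have d0 : 0 < d by rewrite invr_gt0.
have Ad : 32 * A * d <= 1 by rewrite ler_pdivrMr// mul1r lerDl.
have cK l' k : `|c l' k / (k`!)%:R| <= C * A ^+ k.
  have k0 : 0 < (k`!)%:R :> R by rewrite ltr0n fact_gt0.
  rewrite normrM normfV [`|k`!%:R|]ger0_norm ?(ltW k0)//.
  by rewrite ler_pdivrMr.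
have fspec l' := psum1_spec (phi l' x) C0 A0 d0 Ad (cK l').
have fsm l' : smooth_at (f l') (phi l' x) by exists d => //; case: (fspec l').
have fval l' k : derive1n k (f l') (phi l' x) = c l' k.
  case: (fspec l') => _ _ ->; rewrite mulrC divfK// pnatr_eq0 -lt0n fact_gt0//.
have near_phi l' : exists2 e : R, 0 < e &
    anb (box x e) (phi l') /\ forall z, box x e z -> `|phi l' z - phi l' x| < d.
  have [e1 e10 b1] := aphi l'.
  have [e2 e20 h2] := (continuous_boxP _ _).1 (anl_continuous (aphi l')) _ d0.
  exists (Num.min e1 e2); first by rewrite lt_min e10.
  split; first by apply: anb_sub b1; apply: box_le; rewrite ge_min lexx.
  by move=> z; rewrite /box /= lt_min => /andP[_ /h2]; rewrite distrC.
have acomp l' : anl (fun z => f l' (phi l' z)) x.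
  have [e e0 [be he]] := near_phi l'.
  exists e => //; have [dk bk _] := fspec l'.
  pose u k z := derive1n k (f l') (phi l' z).
  have du k i z : box x e z -> is_derive z (bvec i) (u k) (pd i (phi l') z * u k.+1 z).
    move=> zx; rewrite mulrC.
    have h1 := DeriveDef (@anb_derivable _ _ _ i z be zx) erefl.
    have h2 : is_derive (phi l' z) 1 (derive1n k (f l')) (derive1n k.+1 (f l') (phi l' z)).
      by rewrite derive1nS derive1E; apply: derivableP; apply: dk; exact: he.
    exact: is_derive_comp h2 h1.
  apply: (@anb_comp _ (box x e) u (phi l') (2 * C) (2 * A) _ _ _ be _ du _ 0%N).
  - exact: box_open.
  - by rewrite mulr_ge0.
  - by rewrite mulr_ge0.
  - move=> k z zx; apply: continuous_comp; first exact: anb_continuous be zx.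
    by apply/differentiable_continuous/derivable1_diffP; apply: dk; exact: he.
  - by move=> k z zx; apply: bk; exact: he.
have aG : anl (Gsum a phi f) x.
  by apply: anl_sum => l'; apply: anlM => //; exact: acomp.
have Gflat i j : pderiv i j (Gsum a phi f) x = 0.
  have [e e0 he] := @pderiv_jet_near _ a phi (i + j) f x aa aphi
    (fun l' => smooth_at_class_C _ (fsm l')).
  rewrite he//; last exact: box_center.
  rewrite -[RHS](sol (i + j)%N i j (leqnn _)); apply: eq_bigr => l' _.
  by apply: eq_bigr => k _; rewrite fval.
have [e1 e10 G0] := anl_flat_zero aG Gflat.
have [e2 e20 hB] := open_box oB Bx.
have [e3 e30 h3] : exists2 e : R, 0 < e & forall l' z, box x e z ->
    `|phi l' z - phi l' x| < d.
  have h' l' : {e : R | 0 < e & forall z, box x e z -> `|phi l' z - phi l' x| < d}.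
    by apply: cid2; have [e e0 [_ he]] := near_phi l'; exists e.
  exists (\big[Num.min/1]_l' s2val (h' l')).
    by apply: lt_bigmin => // l' _; case: (h' l').
  move=> l' z zx; have : box x (s2val (h' l')) z.
    by apply: box_le zx; exact: bigmin_le.
  by case: (h' l') => /= e _; apply.
pose e := Num.min e1 (Num.min e2 e3).
have e0 : 0 < e by rewrite !lt_min e10 e20.
have Ux := box_center x e0.
have f0 z : box x e z -> f l (phi l z) = 0.
  move=> zx; apply: (mh (box x e) f (@box_open _ _ _)); last by exists z.
  - by exists x.
  - by move=> y; rewrite /box /= !lt_min => /and3P[_ ye _]; exact: hB.
  - move=> l' _ [y yx <-]; apply: (psum1_analytic C0 A0 d0 Ad (cK l')).
    by apply: h3; move: yx; rewrite /box /= !lt_min => /and3P[].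
  - by move=> y; rewrite /box /= !lt_min => /and3P[ye _ _]; exact: G0.
split; first by rewrite -fval; exact: f0.
(* The first derivative of f_l is read off by differentiating the zero function, f_l composed with
   phi_l, in a direction where phi_l has nonzero derivative. *)
have [i i0] := pd_direction w0 l.
apply: (mulIf i0); rewrite mul0r -fval.
have h1 := DeriveDef (@anl_derivable _ _ _ i (aphi l)) erefl.
have h2 : is_derive (phi l x) 1 (f l) (derive1n 1 (f l) (phi l x)).
  rewrite derive1n1 derive1E; apply: derivableP.
  by case: (fsm l) => d' d'0 h; apply: (h 0%N); rewrite subrr normr0.
have h3' := is_derive_comp h2 h1.
have := pd_eq i (@box_open _ x e) f0 Ux; rewrite pd_cst => <-.
by case: h3' => _ <-.
Qed.

End AtPoint.
End FormalSolution.

(** * The equivalence *)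

Section Equivalence.
Variable R : realType.
Implicit Types (x y z : 'rV[R]_2) (U : set 'rV[R]_2).

Lemma free_gradient (f g : 'rV[R]_2 -> R) x :
  free [:: gradient f x; gradient g x] = (wedge f g x != 0).
Proof.
rewrite free_cons seq1_free span_seq1 /wedge.
have gE h k : gradient h x 0 k = pd k h x by rewrite mxE.
rewrite -!gE; move: (gradient f x) (gradient g x) => u v.
have [->|v0] := eqVneq v 0; first by rewrite !mxE !mulr0 subrr eqxx andbF.
rewrite andbT; congr (~~ _); apply/vlineP/eqP => [[k ->]|w0].
  by rewrite !mxE; ring.
have [v00|v00] := eqVneq (v 0 0) 0.
  have v01 : v 0 1 != 0.
    apply: contra_neq v0 => v01; apply/rowP => i.
    by rewrite mxE; have [->|->] := I2P i.
  exists (u 0 1 / v 0 1); apply/rowP => i; rewrite mxE; have [->|->] := I2P i.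
    move/eqP: w0; rewrite v00 !mulr0 subr0 mulf_eq0 (negPf v01) orbF => /eqP ->.
    by [].
  by rewrite divfK.
exists (u 0 0 / v 0 0); apply/rowP => i; rewrite mxE; have [->|->] := I2P i.
  by rewrite divfK.
by apply: (mulIf v00); rewrite mulrAC divfK//; apply/esym/eqP; rewrite -subr_eq0 w0.
Qed.

Lemma anl_bounded Bt c (r : R) (f : 'rV[R]_2 -> R) : eball c r `<=` Bt ->
  (forall x, Bt x -> anl f x) ->
  exists2 D, 0 <= D & forall x, eball c r x -> `|f x| <= D.
Proof.
move=> BB af.
have cf : {within eball c r, continuous f}.
  by apply: continuous_in_subspaceT => x; rewrite inE => /BB /af /anl_continuous.
have := compact_bounded (continuous_compact cf (@compact_eball _ c r)).
move=> /pinfty_ex_gt0 [D D0 hD]; exists D; first exact: ltW.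
by move=> x xB; apply: hD; exists x.
Qed.

(** Some local equation is nonzero at [x], hence on a box that misses [Sigma]. Nonemptiness matters
    because the infimum of the empty set is 0. *)
Lemma distance_gt0 Bt Sigma x : analytic_variety Bt Sigma -> Sigma !=set0 -> Bt x ->
  ~ Sigma x -> 0 < distance x Sigma.
Proof.
move=> [SB SV] S0 Bx nS; have [W [n [g [oW Wx ag SW]]]] := SV x Bx.
have [i gi] : exists i, g i x != 0.
  apply: contrapT => /forallNP h; apply: nS.
  suff : (Sigma `&` W) x by case.
  by rewrite SW; split=> // i; apply/eqP; apply: contrapT => /negP; exact: h.
have [d1 d10 h1] := anl_nonzero_near (analytic2_anl (ag i x Wx)) gi.
have [d2 d20 h2] := open_box oW Wx.
apply: (@lt_le_trans _ _ (Num.min d1 d2)); first by rewrite lt_min d10.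
apply: lb_le_inf; first by case: S0 => y Sy; exists (enorm (x - y)), y.
move=> _ [y Sy <-]; apply: le_trans (norm_le_enorm _); rewrite distrC leNgt.
apply/negP; rewrite lt_min => /andP[y1 y2].
have : (Sigma `&` W) y by split=> //; exact: h2.
by rewrite SW => -[_ /(_ i) g0]; have := h1 y y1; rewrite g0 eqxx.
Qed.

Variables (Bt : set 'rV[R]_2) (a phi : 'I_3 -> 'rV[R]_2 -> R).
Hypotheses (oB : open Bt) (cB : connected Bt)
  (aa : forall l x, Bt x -> anl (a l) x) (aphi : forall l x, Bt x -> anl (phi l) x).

Lemma jet_injective_vanish x M (f : 'I_3 -> R -> R) : Bt x -> jet_injective a phi x M ->
  (forall l, class_C_near M (f l) (phi l x)) ->
  vanishes2 M (Gsum a phi f) x -> forall l, vanishes1 M (f l) (phi l x).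
Proof.
move=> Bx inj cf G0 l; apply: (inj (fun l k => derive1n k (f l) (phi l x)) _ l) => i j ij.
have [d d0 hd] := pderiv_jet_near (fun l => aa l Bx) (fun l => aphi l Bx) cf.
by rewrite -(hd i j ij x (box_center x d0)); exact: G0.
Qed.

(** Testing the vanishing property on polynomials with a prescribed jet. *)
Lemma vanish_jet_injective x M : Bt x ->
  (forall f : 'I_3 -> R -> R, (forall l, class_C_near M (f l) (phi l x)) ->
    vanishes2 M (Gsum a phi f) x -> forall l, vanishes1 M (f l) (phi l x)) ->
  jet_injective a phi x M.
Proof.
move=> Bx h c /(jet_solution_of_poly _ _ (fun l => aa l Bx) (fun l => aphi l Bx)) /h van l k kM.
have := van _ l k kM; rewrite derive1n_jet_poly//; apply=> l'.
by apply: smooth_at_class_C; exact: smooth_at_horner.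
Qed.

(** The left inverse at derivative order 0 gives g times f_l composed with phi_l equal to 0 on U.
    Even far from [x0], g vanishes on no nonempty open subset of [Bt], and continuity concludes. *)
Lemma jet_injective_main_hypothesis x0 M : Bt x0 -> jet_injective a phi x0 M ->
  main_hypothesis Bt a phi.
Proof.
move=> Bx0 /(jet_left_inverse Bx0 aa aphi) [g [Q [ag aQ g0 gQ]]].
move=> U f oU _ UB af G0 l _ [x Ux <-].
have fsm l' z : U z -> smooth_at (f l') (phi l' z).
  by move=> Uz; apply: analytic1_smooth; apply: af; exists z.
have gf z : U z -> g z * f l (phi l z) = 0.
  move=> Uz; have Bz := UB z Uz.
  have [d d0 hd] := pderiv_jet_near (fun l => aa l Bz) (fun l => aphi l Bz)
    (fun l' => smooth_at_class_C M (fsm l' z Uz)).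
  rewrite (gQ z (fun l k => derive1n k (f l) (phi l z)) l 0%N)//.
  apply: big1 => i _; apply: big1 => j ij.
  rewrite -(hd i j ij z (box_center z d0)).
  by rewrite (pderiv_eq i j oU G0 Uz) pderiv0 mul0r.
apply: contrapT => /eqP fx.
have cfx : {for x, continuous (f l \o phi l)}.
  apply: continuous_comp; first by apply: anl_continuous; apply: aphi; exact: UB.
  apply/differentiable_continuous/derivable1_diffP.
  by have [d d0 h] := fsm l x Ux; apply: (h 0%N); rewrite subrr normr0.
have fx0 : 0 < `|f l (phi l x)| by rewrite normr_gt0.
have [d1 d10 h1] := (continuous_boxP _ _).1 cfx _ fx0.
have [d2 d20 h2] := open_box oU Ux.
have d0 : 0 < Num.min d1 d2 by rewrite lt_min d10.
have [||||z zx gz] := @nonzero_somewhere R Bt (box x (Num.min d1 d2)) g oB cB ag.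
- by move=> /(_ x0 Bx0) /eqP; rewrite (negPf g0).
- exact: box_open.
- by exists x; exact: box_center.
- by move=> z; rewrite /box /= lt_min => /andP[_ /h2 /UB].
move: zx; rewrite /box /= lt_min => /andP[/h1 z1 /h2 Uz].
move/eqP: (gf z Uz); rewrite mulf_eq0 (negPf gz) /= => /eqP fz.
by move: z1; rewrite /= fz sub0r normrN ltxx.
Qed.

Variables (c : 'rV[R]_2) (r : R).
Hypotheses (r0 : 0 < r) (BB : eball c r `<=` Bt).

Lemma jet_injective_estimate x0 M : Bt x0 -> jet_injective a phi x0 M ->
  exists (C tau : R) (Sigma : set 'rV[R]_2),
  [/\ 0 < tau, analytic_variety Bt Sigma, positive_codimension Sigma,
      Sigma !=set0 &
    forall (x : 'rV[R]_2) (f : 'I_3 -> R -> R), eball c r x ->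
      (forall j, class_C_near M (f j) (phi j x)) ->
      distance x Sigma `^ tau *
        (\sum_j \sum_(k < M.+1) `|derive1n k (f j) (phi j x)|)
      <= C * (\sum_(i < M.+1) \sum_(j < M.+1 | (i + j <= M)%N)
                `|pderiv i j (Gsum a phi f) x|)].
Proof.
move=> Bx0 /(jet_left_inverse Bx0 aa aphi) [g [Q [ag aQ g0 gQ]]].
have ng : ~ (forall x, Bt x -> g x = 0).
  by move=> /(_ x0 Bx0) /eqP; rewrite (negPf g0).
have [tau [K [S [tau0 K0 [SV SC] Sc Sg]]]] := lojasiewicz r0 oB cB BB ag ng.
pose T : finType := ('I_M.+1 * 'I_M.+1 * 'I_3 * 'I_M.+1)%type.
pose QT (t : T) x := Q t.1.1.1 t.1.1.2 t.1.2 t.2 x.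
have /choice [D hD] (t : T) : exists D, 0 <= D /\ forall x, eball c r x -> `|QT t x| <= D.
  have [D D0 h] := anl_bounded BB (fun x Bx => aQ t.1.1.1 t.1.1.2 t.1.2 t.2 x Bx).
  by exists D.
pose E := \sum_t D t.
have E0 : 0 <= E by apply: sumr_ge0 => t _; case: (hD t).
have DE t : D t <= E.
  by rewrite /E (bigD1 t) //= lerDl; apply: sumr_ge0 => t' _; case: (hD t').
(* Each of the 3(M + 1) terms on the left is at most K E times the sum on the right: K comes from
   the Lojasiewicz inequality, E bounds the entries of the left inverse on the compact ball. *)
exists (\sum_(l < 3) \sum_(k < M.+1) K * E), tau, S; split=> //; first by exists c.
move=> x f xB cf; have Bx := BB xB.
set V := \sum_(i < M.+1) \sum_(j < M.+1 | (i + j <= M)%N) _.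
have [d d0 hd] := pderiv_jet_near (fun l => aa l Bx) (fun l => aphi l Bx) cf.
rewrite mulr_sumr mulr_suml; apply: ler_sum => l _.
rewrite mulr_sumr mulr_suml; apply: ler_sum => k _.
have kM : (k <= M)%N by rewrite -ltnS.
have -> : K * E * V = K * (V * E) by rewrite -mulrA [E * V]mulrC.
apply: le_trans (ler_wpM2r (normr_ge0 _) (Sg x xB)) _.
rewrite -mulrA ler_wpM2l ?(ltW K0)// -normrM.
rewrite (gQ x (fun l k => derive1n k (f l) (phi l x)) l k kM) /V mulr_suml.
apply: le_trans (ler_norm_sum _ _ _) _; apply: ler_sum => i _.
rewrite mulr_suml; apply: le_trans (ler_norm_sum _ _ _) _; apply: ler_sum => j ij.
rewrite normrM -(hd i j ij x (box_center x d0)) ler_wpM2l//.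
by apply: le_trans (DE (i, j, l, k)); case: (hD (i, j, l, k)) => _; exact.
Qed.

(** Having no interior, [Sigma] misses a point of the ball; there the weight is positive and the
    estimate forces injectivity. *)
Lemma estimate_jet_injective M (C tau : R) (Sigma : set 'rV[R]_2) :
  analytic_variety Bt Sigma -> positive_codimension Sigma -> Sigma !=set0 ->
  (forall (x : 'rV[R]_2) (f : 'I_3 -> R -> R), eball c r x ->
      (forall j, class_C_near M (f j) (phi j x)) ->
      distance x Sigma `^ tau *
        (\sum_j \sum_(k < M.+1) `|derive1n k (f j) (phi j x)|)
      <= C * (\sum_(i < M.+1) \sum_(j < M.+1 | (i + j <= M)%N)
                `|pderiv i j (Gsum a phi f) x|)) ->
  exists2 x, Bt x & jet_injective a phi x M.
Proof.
move=> SV SC S0 est.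
have r2 : 0 < r / 2 by rewrite divr_gt0.
have [x xc nS] : exists2 x, box c (r / 2) x & ~ Sigma x.
  apply: contrapT => h; have : (Sigma^°) c.
    apply: (@interiorS _ (box c (r / 2))).
      by move=> x xc; apply: contrapT => nS; apply: h; exists x.
    by rewrite (interior_id _).1 //; [exact: box_center|exact: box_open].
  by rewrite SC.
have xB := box_eball r0 xc; exists x; first exact: BB.
have Bx := BB xB.
have dp : 0 < distance x Sigma `^ tau by apply: powR_gt0; exact: distance_gt0 SV S0 Bx nS.
apply: vanish_jet_injective => // f cf G0 l k kM.
have := est x f xB cf; rewrite [X in C * X]big1 ?mulr0 => [|i _]; last first.
  by rewrite big1// => j ij; rewrite G0// normr0.
rewrite pmulr_rle0// => h; apply/eqP; rewrite -normr_le0; apply: le_trans h.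
rewrite (bigD1 l) //= (bigD1 (Ordinal (kM : (k < M.+1)%N))) //= -addrA lerDl.
by rewrite addr_ge0//; apply: sumr_ge0 => *; rewrite ?sumr_ge0.
Qed.

Hypotheses (na : forall l, ~ (forall x, Bt x -> a l x = 0))
  (nw : forall i j, i != j -> ~ (forall x, Bt x -> wedge (phi i) (phi j) x = 0)).

(** The product of all [a l] and of all wedges of distinct pairs is not identically zero, hence not
    zero on the whole of an open box inside the ball. *)
Lemma nondegenerate_somewhere : exists2 x, eball c r x & nondegenerate_at a phi x.
Proof.
have Bc : Bt c by apply: BB; exact: eball_center.
pose T : finType := ('I_3 * 'I_3)%type.
pose F1 x := \prod_l a l x.
pose F2 x := \prod_(t : T | t.1 != t.2) wedge (phi t.1) (phi t.2) x.
have aF1 x : Bt x -> anl F1 x by move=> Bx; apply: anl_prod => l _; exact: aa.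
have aF2 x : Bt x -> anl F2 x.
  by move=> Bx; apply: anl_prod => t _; apply: anl_wedge; exact: aphi.
have nF1 : ~ (forall x, Bt x -> F1 x = 0).
  exact: (prod_not_zero oB cB Bc).
have nF2 : ~ (forall x, Bt x -> F2 x = 0).
  apply: (prod_not_zero oB cB Bc) => [t x Bx|t t12]; last exact: nw.
  by apply: anl_wedge; exact: aphi.
have r2 : 0 < r / 2 by rewrite divr_gt0.
have [|||||x xc Fx] := @nonzero_somewhere R Bt (box c (r / 2)) (F1 \* F2) oB cB.
- by move=> x Bx; apply: anlM; [exact: aF1|exact: aF2].
- exact: mul_not_zero.
- exact: box_open.
- by exists c; exact: box_center.
- by move=> x /(box_eball r0) /BB.
exists x; first exact: box_eball.
move: Fx; rewrite /= mulf_eq0 negb_or => /andP[/prodf_neq0 h1 /prodf_neq0 h2].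
split=> [l|i j ij]; first exact: h1.
by rewrite free_gradient; exact: (h2 (i, j)).
Qed.

End Equivalence.
Theorem proposition13p1 (R : realType) (c : 'rV[R]_2) (r : R)
    (Bt : set 'rV[R]_2) (a phi : 'I_3 -> 'rV[R]_2 -> R)
    (r_gt0 : 0 < r)
    (Bt_open : open Bt) (Bt_connected : connected Bt)
    (B_sub : eball c r `<=` Bt)
    (a_analytic : forall j, analytic2_on Bt (a j))
    (phi_analytic : forall j, analytic2_on Bt (phi j))
    (a_neq0 : forall j, ~ (forall x, Bt x -> a j x = 0))
    (phi_nonconstant : forall j,
       ~ (exists k : R, forall x, eball c r x -> phi j x = k))
    (phi_independent : ~ (exists i j : 'I_3, i != j /\
       forall x, Bt x ->
         ~~ free [:: gradient (phi i) x; gradient (phi j) x])) :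
  [<->
    main_hypothesis Bt a phi;

    forall x : 'rV[R]_2, eball c r x -> nondegenerate_at a phi x ->
      exists M : nat, (0 < M)%N /\
        forall f : 'I_3 -> R -> R,
          (forall j, class_C_near M (f j) (phi j x)) ->
          vanishes2 M (Gsum a phi f) x ->
          forall j, vanishes1 M (f j) (phi j x);

    exists (M : nat) (C tau : R) (Sigma : set 'rV[R]_2),
      [/\ 0 < tau, analytic_variety Bt Sigma, positive_codimension Sigma,
          Sigma !=set0 &
        forall (x : 'rV[R]_2) (f : 'I_3 -> R -> R), eball c r x ->
          (forall j, class_C_near M (f j) (phi j x)) ->
          distance x Sigma `^ tau *
            (\sum_j \sum_(k < M.+1) `|derive1n k (f j) (phi j x)|)
          <= C * (\sum_(i < M.+1) \sum_(j < M.+1 | (i + j <= M)%N)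
                    `|pderiv i j (Gsum a phi f) x|)]].
Proof.
have aa l x : Bt x -> anl (a l) x by move=> Bx; apply: analytic2_anl; exact: a_analytic.
have aphi l x : Bt x -> anl (phi l) x by move=> Bx; apply: analytic2_anl; exact: phi_analytic.
have nw i j : i != j -> ~ (forall x, Bt x -> wedge (phi i) (phi j) x = 0).
  move=> ij h; apply: phi_independent; exists i, j; split=> // x Bx.
  by rewrite free_gradient h// eqxx.
tfae.
- move=> mh x xB [a0 w0]; have Bx := B_sub x xB.
  have [n inj] := nondegenerate_jet_injective (fun l => aa l x Bx) (fun l => aphi l x Bx) a0
    (fun k m km => etrans (esym (free_gradient _ _ _)) (w0 k m km)) Bt_open Bx mh.
  by exists n.+2; split=> // f; exact: (jet_injective_vanish aa aphi Bx inj).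
(* One nondegenerate point suffices: the left inverse built there is analytic on all of [Bt]. *)
- move=> h.
  have [x xB nd] := nondegenerate_somewhere Bt_open Bt_connected aa aphi r_gt0 B_sub a_neq0 nw.
  have [M [_ van]] := h x xB nd; have Bx := B_sub x xB.
  have inj := vanish_jet_injective aa aphi Bx van.
  exists M; exact: (jet_injective_estimate Bt_open Bt_connected aa aphi r_gt0 B_sub Bx inj).
- move=> [M [C [tau [Sigma [tau0 SV SC S0 est]]]]].
  have [x Bx inj] := estimate_jet_injective aa aphi r_gt0 B_sub SV SC S0 est.
  exact: (jet_injective_main_hypothesis Bt_open Bt_connected aa aphi Bx inj).
Qed.
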